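(* Let $n\geqslant1$. For every $\varpi\in S_n$, $$\mathfrak{C}_{\varpi}(X,Y)=\mathfrak{S}_{\varpi^*}(\omega_0X,-Y),$$ where $\varpi^*=\omega_0\varpi\omega_0$. In particular, $\mathfrak{C}_{\varpi}(X,Y)$ has nonnegative integer coefficients.
   Context: $X=(x_1,\ldots,x_n)$, $Y=(y_1,\ldots,y_n)$ are commuting independent variables. $\omega_0=(n,n-1,\ldots,1)$ is the longest element of $S_n$ (permutations in one-line notation), and $f(\omega_0X,-Y)$ denotes $f(x_n,\ldots,x_1,-y_1,\ldots,-y_n)$. Weyl group and divided differences. $W_n$ is the hyperoctahedral group of signed permutations of $\{1,\ldots,n\}$ (a bar denotes a negative entry), generated by the simple transpositions $s_i$ ($1\leqslant i\leqslant n-1$), generating $S_n\subset W_n$, and $s_0$; right multiplication by $s_i$ interchanges the entries in positions $i,i+1$, and $(u_1,\ldots,u_n)s_0=(\overline{u}_1,u_2,\ldots,u_n)$. Its longest element is $w_0=(\overline1,\ldots,\overline n)$. $W_n$ acts on $\mathbb{Z}[Y][X]$: $s_i$ interchanges $x_i,x_{i+1}$, and $s_0$ sends $x_1$ to $-x_1$. $\partial_i(f)=(f-s_if)/(x_i-x_{i+1})$ for $1\leqslant i\leqslant n-1$, $\partial_0(f)=(f-s_0f)/(2x_1)$; $\partial'_i=-\partial_i$ for $1\leqslant i\leqslant n-1$, $\partial'_0=\partial_0$. For a reduced word $w=s_{a_1}\cdots s_{a_r}$, $\partial_w=\partial_{a_1}\circ\cdots\circ\partial_{a_r}$ and $\partial'_w=\partial'_{a_1}\circ\cdots\circ\partial'_{a_r}$.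 Type $A$ double Schubert polynomials: $\Delta(X,Y)=\prod_{i+j\leqslant n}(x_i-y_j)$ and $\mathfrak{S}_\varpi(X,Y)=\partial_{\varpi^{-1}\omega_0}(\Delta(X,Y))$ for $\varpi\in S_n$. $\widetilde Q$-polynomials: $\widetilde Q_i(X)=e_i(X)$ (elementary symmetric polynomial), $\widetilde Q_{i,j}=\widetilde Q_i\widetilde Q_j+2\sum_{k=1}^j(-1)^k\widetilde Q_{i+k}\widetilde Q_{j-k}$, and for $\lambda=(\lambda_1\geqslant\cdots\geqslant\lambda_r\geqslant0)$ with $r$ even (put $\lambda_r=0$ if necessary), $\widetilde Q_\lambda=\mathrm{Pfaffian}[\widetilde Q_{\lambda_i,\lambda_j}]_{1\leqslant i<j\leqslant r}$. $\mathcal{D}_n$ is the set of strict partitions (distinct nonzero parts, possibly none) with all parts at most $n$; $\lambda'$ is the strict partition whose parts are the complement of the parts of $\lambda$ in $\{1,\ldots,n\}$; $\widetilde Q(X,Y)=\sum_{\lambda\in\mathcal{D}_n}\widetilde Q_\lambda(X)\widetilde Q_{\lambda'}(Y)$. Type $C$ double Schubert polynomials: $\mathfrak{C}_w(X,Y)=(-1)^{n(n-1)/2}\,\partial'_{w^{-1}w_0}\bigl(\Delta(X,Y)\widetilde Q(X,Y)\bigr)$ for $w\in W_n$. *)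

(* Defs.v *)
From mathcomp Require Import all_boot all_order all_algebra all_fingroup.
From mathcomp Require Export mpoly.
From mathcomp Require Import zify.

Set Implicit Arguments.
Unset Strict Implicit.
Unset Printing Implicit Defensive.

Import Order.TTheory GRing.Theory Num.Theory.
Local Open Scope ring_scope.

(* The product of permutations in mathcomp is in diagrammatic order;            *)
(* [compg u v] is the usual product uv = "v first, then u", for which right     *)
(* multiplication acts on the positions of the one-line notation.               *)
Definition compg (gT : finGroupType) (u v : gT) : gT := (v * u)%g.

Section SignedPermutations.

Variable n : nat.

(* (i, false) stands for the entry i + 1 and (i, true) for its barred version.  *)
Definition bar_fun (p : 'I_n * bool) : 'I_n * bool := (p.1, ~~ p.2).

Lemma bar_fun_inj : injective bar_fun.
Proof. by move=> [i b] [j c] [-> /negb_inj ->]. Qed.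

Definition bar : {perm 'I_n * bool} := perm bar_fun_inj.

(* A signed permutation w is a bijection of {1, ..., n, \bar 1, ..., \bar n}    *)
(* commuting with the bar; its one-line notation is i |-> w (i, false).         *)
Definition Weyl := subg_of 'C[bar]%G.

Definition lift_fun (s : 'S_n) (p : 'I_n * bool) : 'I_n * bool := (s p.1, p.2).

Lemma lift_fun_inj s : injective (lift_fun s).
Proof. by move=> [i b] [j c] [/perm_inj -> ->]. Qed.

Lemma lift_cent s : perm (@lift_fun_inj s) \in 'C[bar]%g.
Proof. by apply/cent1P; rewrite /commute; apply/permP => p; rewrite !permM !permE. Qed.

Definition Weyl_of_perm (s : 'S_n) : Weyl := Subg (lift_cent s).

Lemma flip_cent (i : 'I_n) : tperm (i, false) (i, true) \in 'C[bar]%g.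
Proof.
apply/cent1P; rewrite /commute; apply/permP => -[j b]; rewrite !permM !permE /= /bar_fun.
rewrite !xpair_eqE.
by case: b; case: (eqVneq j i) => [->|ne]; rewrite /= ?eqxx ?xpair_eqE ?andbF //= ?(negPf ne) ?eqxx.
Qed.

Definition prev_ord (i : 'I_n) : 'I_n :=
  Ordinal (leq_ltn_trans (leq_pred i) (ltn_ord i)).

(* Positions are numbered from 0, so that for i >= 1 the transposition s_i      *)
(* exchanges the positions i - 1 and i, and s_0 changes the sign at position 0. *)
Definition sgen (i : 'I_n) : Weyl :=
  if i == 0 :> nat then Subg (flip_cent i)
  else Weyl_of_perm (tperm (prev_ord i) i).

Definition w0 : Weyl := Subg (cent1id bar).

Definition omega0 : 'S_n := perm (@rev_ord_inj n).

Definition wprod (a : seq 'I_n) : Weyl :=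
  foldr (fun i u => compg (sgen i) u) 1%g a.

(* Generation of W_n by the s_i. The element of a coset of <s_0, ..., s_{n-1}>  *)
(* maximizing [height] is the identity.                                         *)
Definition entry (w : Weyl) (i : 'I_n) : int :=
  let p := sgval w (i, false) in (-1) ^+ p.2 * (p.1.+1)%:Z.

Definition height (w : Weyl) : int := \sum_(i < n) (i.+1)%:Z * entry w i.

Lemma sgvalM (u v : Weyl) : sgval (u * v)%g = (sgval u * sgval v)%g.
Proof. by []. Qed.

Lemma sgval_bar (w : Weyl) i b :
  sgval w (i, b) = ((sgval w (i, false)).1, b (+) (sgval w (i, false)).2).
Proof.
case: b => /=; last by case: (sgval w _).
have /cent1P/permP/(_ (i, false)) := valP w.
by rewrite !permM !permE /bar_fun /= => ->.
Qed.

Lemma entry_flip (w : Weyl) (i j : 'I_n) : i = 0 :> nat ->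
  entry (sgen i * w)%g j = (if j == i then -1 else 1) * entry w j.
Proof.
move=> i0; rewrite /entry sgvalM permM /sgen i0 /= permE /= xpair_eqE andbT.
case: (eqVneq j i) => [->|ne] /=; last by rewrite xpair_eqE andbF mul1r.
rewrite (sgval_bar w i true) /= signrN mulN1r mulNr //.
Qed.

Lemma entry_swap (w : Weyl) (i j : 'I_n) : (0 < i)%N ->
  entry (sgen i * w)%g j = entry w (tperm (prev_ord i) i j).
Proof.
move=> i0; rewrite /entry sgvalM permM /sgen -[_ == _]negbK -lt0n i0 /=.
by rewrite (permE (@lift_fun_inj _)).
Qed.

Lemma entry_eq (w : Weyl) i j : entry w i = entry w j -> i = j.
Proof.
rewrite /entry => E.
have {}E : sgval w (i, false) = sgval w (j, false).
  move: E; case: (sgval w (i, false)) => k b; case: (sgval w (j, false)) => l c /=.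
  case: b; case: c; rewrite ?(expr1, expr0, mul1r, mulN1r) => // /eqP;
    rewrite ?eqr_opp => // /eqP.
  - by case=> /val_inj ->.
  - by case=> /val_inj ->.
by have [] := perm_inj E.
Qed.

Lemma height_max1 (w : Weyl) :
  (forall i, height (sgen i * w)%g <= height w) -> w = 1%g.
Proof.
move=> H.
have pos (i : 'I_n) : i = 0%N :> nat -> 0 < entry w i.
  move=> i0; have := H i; rewrite /height (bigD1 i) //= [leRHS](bigD1 i) //=.
  rewrite entry_flip // eqxx (eq_bigr (fun j : 'I_n => (j.+1)%:Z * entry w j)); last first.
    by move=> j ne; rewrite entry_flip // (negPf ne) mul1r.
  rewrite lerD2r i0 !mul1r mulN1r /entry.
  by case: (sgval w _) => k [] /=.
have inc (i : 'I_n) : (0 < i)%N -> entry w (prev_ord i) < entry w i.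
  move=> i0; have ne : prev_ord i != i by rewrite -val_eqE /= neq_ltn prednK // leqnn.
  rewrite lt_neqAle; apply/andP; split.
    by apply: contra ne => /eqP/entry_eq ->.
  have := H i; rewrite /height (bigD1 i) //= (bigD1 (prev_ord i)) //=.
  rewrite [leRHS](bigD1 i) //= [X in _ <= _ + X](bigD1 (prev_ord i)) //=.
  rewrite !entry_swap // tpermL tpermR.
  rewrite (eq_bigr (fun j : 'I_n => (j.+1)%:Z * entry w j)); last first.
    by move=> j /andP[n1 n2]; rewrite entry_swap // tpermD // eq_sym.
  rewrite !addrA lerD2r prednK //.
  set a := entry w _; set b := entry w i.
  rewrite -addn1 PoszD !mulrDl !mul1r.
  by rewrite [_ + a]addrC [_ + b]addrC -!addrA [X in _ <= _ + X]addrC lerD2r.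
have lo (k : nat) (i : 'I_n) : i = k :> nat -> (k.+1)%:Z <= entry w i.
  elim: k i => [|k IH] i ik; first exact: pos.
  have i0 : (0 < i)%N by rewrite ik.
  have ei : prev_ord i = k :> nat by rewrite /= ik.
  have := le_lt_trans (IH _ ei) (inc i i0).
  by lia.
have hi (k : nat) (i : 'I_n) : (i + k).+1 = n -> entry w i <= (i.+1)%:Z.
  elim: k i => [|k IH] i ik.
    have := ltn_ord (sgval w (i, false)).1; rewrite /entry.
    by case: (sgval w _) => l [] /=; rewrite ?expr1 ?expr0; lia.
  have lt : (i.+1 < n)%N by lia.
  have ep : prev_ord (Ordinal lt) = i by apply: val_inj.
  have := lt_le_trans (inc (Ordinal lt) isT) (IH (Ordinal lt) _).
  by rewrite ep /= addSn -addnS => /(_ ik); lia.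
have ent (i : 'I_n) : entry w i = (i.+1)%:Z.
  apply/eqP; rewrite eq_le (lo i) // andbT (hi (n - i.+1)%N) //.
  by rewrite -addSn subnKC.
apply: val_inj => /=; apply/permP => [[i b]]; rewrite perm1 sgval_bar.
have := ent i; rewrite /entry; case: (sgval w (i, false)) => k [] //=.
by rewrite mul1r => -[/val_inj ->]; rewrite addbF.
Qed.

Lemma sgen_generate (w : Weyl) : w \in <<[set sgen i | i : 'I_n]>>%g.
Proof.
set H := <<_>>%g.
have wH : w \in (H :* w)%g by apply: rcoset_refl.
case: (@Order.TotalTheory.arg_maxP _ _ _ w (mem (H :* w)%g) height wH) => u uH umax.
have u1 : u = 1%g.
  apply: height_max1 => i; apply: umax.
  have /rcosetP[h hH ->] := uH; rewrite mulgA; apply/rcosetP.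
  by exists (sgen i * h)%g => //; rewrite groupM // mem_gen // imset_f.
have /rcosetP[h hH] := uH; rewrite u1 => /eqP; rewrite eq_sym -eq_invg_mul => /eqP <-.
by rewrite groupV.
Qed.

Lemma word_exists (w : Weyl) : exists k, [exists a : k.-tuple 'I_n, wprod a == w].
Proof.
have /gen_prodgP[k [c cP ->]] := sgen_generate w.
have cP' j : exists i, sgen i == c j by have /imsetP[i _ ->] := cP j; exists i.
exists k; apply/existsP; exists [tuple of rev [tuple xchoose (cP' j) | j < k]].
apply/eqP; rewrite /= /wprod.
have E (a : seq 'I_n) (z : Weyl) :
    foldr (fun i u => compg (sgen i) u) z (rev a) = (z * \prod_(i <- a) sgen i)%g.
  elim: a z => [|i a IH] z; first by rewrite big_nil mulg1.
  by rewrite rev_cons foldr_rcons IH big_cons /compg mulgA.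
rewrite E mul1g big_map /= enumT.
rewrite [index_enum _]unlock.
apply: eq_bigr => j _.
exact/eqP/(xchooseP (cP' j)).
Qed.

Definition wlen (w : Weyl) : nat := ex_minn (word_exists w).

Definition reduced_word (w : Weyl) (a : seq 'I_n) : bool :=
  (wprod a == w) && (size a == wlen w).

Lemma reduced_word_exists (w : Weyl) : exists a, reduced_word w a.
Proof.
rewrite /reduced_word /wlen; case: ex_minnP => k /existsP[a aw] _.
by exists a; rewrite aw size_tuple eqxx.
Qed.

End SignedPermutations.

Section Polynomials.

Variable n : nat.

(* Z[X, Y]: the first n variables are X, the last n are Y.                      *)
Definition polyXY := {mpoly int[n + n]}.

Definition xvar (i : 'I_n) : polyXY := 'X_(lshift n i).
Definition yvar (j : 'I_n) : polyXY := 'X_(rshift n j).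

(* f(A, B)                                                                      *)
Definition substXY (A B : 'I_n -> polyXY) (f : polyXY) : polyXY :=
  f \mPo [tuple match split k with inl i => A i | inr j => B j end | k < n + n].

Lemma substXY_is_rmorphism A B :
  GRing.monoid_morphism (substXY A B) * GRing.zmod_morphism (substXY A B).
Proof.
by split; [split; [exact: comp_mpoly1 | move=> f g; exact: rmorphM]
  | move=> f g; exact: raddfB].
Qed.

Lemma substXY_X A B k :
  substXY A B 'X_k = match split k with inl i => A i | inr j => B j end.
Proof. by rewrite /substXY comp_mpolyXU -tnth_nth tnth_mktuple. Qed.

(* w x_i = x_{w_i}, where x_{\bar j} = - x_j                                    *)
Definition wact (w : Weyl n) : polyXY -> polyXY :=
  substXY (fun i => let p := sgval w (i, false) in (-1) ^+ p.2 * xvar p.1) yvar.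

Definition divdiff_den (i : 'I_n) : polyXY :=
  if i == 0 :> nat then 2%:R * xvar i else xvar (prev_ord i) - xvar i.

Lemma divdiff_exists (i : 'I_n) (f : polyXY) :
  exists g : polyXY, g * divdiff_den i == f - wact (sgen i) f.
Proof.
pose P (f : polyXY) := exists g : polyXY, g * divdiff_den i == f - wact (sgen i) f.
have [[s1 sM] sB] : GRing.monoid_morphism (wact (sgen i)) *
    GRing.zmod_morphism (wact (sgen i)) by apply: substXY_is_rmorphism.
have P0 : P 0.
  by exists 0; rewrite /wact /substXY comp_mpoly0 mul0r subrr.
have PD a b : P a -> P b -> P (a + b).
  move=> [g /eqP ga] [h /eqP hb]; exists (g + h).
  by rewrite mulrDl ga hb [wact _ (a + b)]comp_mpolyD opprD addrACA.
have PM a b : P a -> P b -> P (a * b).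
  move=> [g /eqP ga] [h /eqP hb]; exists (g * b + wact (sgen i) a * h).
  rewrite mulrDl -[wact _ _ * _ * _]mulrA hb [g * b]mulrC -mulrA ga sM.
  by rewrite !mulrBr addrA [b * wact _ _]mulrC subrK [b * a]mulrC.
have PC c : P c%:MP.
  by exists 0; rewrite /wact /substXY comp_mpolyC mul0r subrr.
have P1 : P 1 by rewrite -mpolyC1; apply: (PC).
have PX k : P 'X_k.
  rewrite /P /wact substXY_X /divdiff_den /sgen.
  case: splitP => [j kj|j kj]; last first.
    exists 0; rewrite mul0r eq_sym subr_eq0; apply/eqP; congr ('X_ _).
    by apply: val_inj.
  have -> : k = lshift n j by apply: val_inj.
  rewrite -/(xvar j); case: ifP => [/eqP i0|/negbT i0] /=; rewrite permE /=.
    case: (eqVneq j i) => [->|ne].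
      exists 1; rewrite eqxx /= expr1 mulN1r opprK mul1r.
      by rewrite mulr_natl mulr2n.
    by exists 0; rewrite !xpair_eqE (negPf ne) /= mul1r mul0r subrr.
  rewrite mul1r; case: tpermP => [->|->|_ _].
  - by exists 1; rewrite mul1r.
  - by exists (-1); rewrite mulN1r opprB.
  - by exists 0; rewrite mul0r subrr.
elim/mpolyind: f => [//|c m f _ _ IH]; apply: PD => //.
rewrite -mul_mpolyC; apply: (PM) => //; rewrite mpolyXE_id.
apply: (big_ind P P1 PM) => k _; elim: (m k : nat) => [|d IHd]; first by rewrite expr0.
by rewrite exprS; apply: PM.
Qed.

(* The quotient (f - s_i f) / (x_i - x_{i+1}), resp. (f - s_0 f) / (2 x_1) when *)
(* i = 0; it is unique, Z[X, Y] being an integral domain.                       *)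
Definition divdiff (i : 'I_n) (f : polyXY) : polyXY := xchoose (divdiff_exists i f).

Lemma divdiffE i f : divdiff i f * divdiff_den i = f - wact (sgen i) f.
Proof. exact/eqP/(xchooseP (divdiff_exists i f)). Qed.

Definition divdiff' (i : 'I_n) (f : polyXY) : polyXY :=
  if i == 0 :> nat then divdiff i f else - divdiff i f.

(* The choice of the reduced word of w does not matter, the operators           *)
(* satisfying the braid relations.                                              *)
Definition divdiffw (w : Weyl n) (f : polyXY) : polyXY :=
  foldr divdiff f (xchoose (reduced_word_exists w)).

Definition divdiffw' (w : Weyl n) (f : polyXY) : polyXY :=
  foldr divdiff' f (xchoose (reduced_word_exists w)).

(* The condition is i + j <= n for indices numbered from 1.                     *)
Definition DeltaXY : polyXY :=
  \prod_(i < n) \prod_(j < n | (i.+1 + j.+1 <= n)%N) (xvar i - yvar j).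

Definition SchubertA (w : 'S_n) : polyXY :=
  divdiffw (Weyl_of_perm (compg w^-1%g (omega0 n))) DeltaXY.

End Polynomials.

Section Pfaffian.

Variables (R : comNzRingType) (m : nat).

Lemma evenpos_proof (k : 'I_m) : (k.*2 < m.*2)%N.
Proof. by rewrite ltn_double. Qed.

Lemma oddpos_proof (k : 'I_m) : (k.*2.+1 < m.*2)%N.
Proof. by rewrite ltn_Sdouble. Qed.

Definition evenpos (k : 'I_m) : 'I_(m.*2) := Ordinal (evenpos_proof k).
Definition oddpos (k : 'I_m) : 'I_(m.*2) := Ordinal (oddpos_proof k).

(* Perfect matchings of {0, ..., 2m - 1}, written as permutations               *)
(* i_1 j_1 ... i_m j_m with i_k < j_k and i_1 < ... < i_m.                      *)
Definition is_matching (s : 'S_(m.*2)) : bool :=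
  [forall k : 'I_m, (s (evenpos k) < s (oddpos k))%N] &&
  [forall k : 'I_m, forall l : 'I_m, (k < l)%N ==> (s (evenpos k) < s (evenpos l))%N].

(* Only the entries above the diagonal of A are used.                           *)
Definition Pfaffian (A : 'M[R]_(m.*2)) : R :=
  \sum_(s : 'S_(m.*2) | is_matching s)
    (-1) ^+ s * \prod_(k < m) A (s (evenpos k)) (s (oddpos k)).

End Pfaffian.

Section QtildePolynomials.

Variable n : nat.

Definition Qt1 (i : nat) : {mpoly int[n]} := mesym n int i.

Definition Qt2 (i j : nat) : {mpoly int[n]} :=
  Qt1 i * Qt1 j +
  2%:R * \sum_(1 <= k < j.+1) (-1) ^+ k * Qt1 (i + k) * Qt1 (j - k).

(* The default value of [nth] pads la with a zero part if its length is odd.    *)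
Definition Qtilde (la : seq nat) : {mpoly int[n]} :=
  Pfaffian (\matrix_(i < (uphalf (size la)).*2, j < (uphalf (size la)).*2)
              Qt2 (nth 0%N la i) (nth 0%N la j)).

(* Strict partitions with parts at most n are encoded by their sets of parts,   *)
(* i : 'I_n standing for the part i + 1.                                        *)
Definition parts (A : {set 'I_n}) : seq nat := rev [seq (i : 'I_n).+1 | i <- enum A].

Lemma mem_parts A (i : 'I_n) : (i.+1 \in parts A) = (i \in A).
Proof.
by rewrite mem_rev (mem_map (f := fun i : 'I_n => i.+1)) ?mem_enum // => x y [/val_inj].
Qed.

Lemma parts_bound A k : k \in parts A -> (0 < k <= n)%N.
Proof. by rewrite mem_rev => /mapP[i _ ->] /=. Qed.

Lemma parts_strict A : sorted gtn (parts A).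
Proof.
rewrite rev_sorted sorted_map.
have -> : enum A = filter (mem A) (enum 'I_n) by rewrite enumT.
apply: sorted_filter; first by move=> x y z; apply: ltn_trans.
have := iota_ltn_sorted 0 n; rewrite -val_enum_ord sorted_map.
exact: sub_sorted.
Qed.

Lemma parts_onto la : sorted gtn la -> {in la, forall k, 0 < k <= n}%N ->
  exists A, parts A = la.
Proof.
move=> sla lab; exists [set i : 'I_n | i.+1 \in la].
apply: (irr_sorted_eq (leT := gtn)) (parts_strict _) sla _.
- by move=> x y z /= yx zy; apply: ltn_trans zy yx.
- by move=> x /=; rewrite ltnn.
move=> k; apply/idP/idP => [|kla].
  by rewrite mem_rev => /mapP[i]; rewrite mem_enum inE => ila ->.
have /andP[k0 kn] := lab k kla; case: k kla k0 kn => // k kla _ kn.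
by rewrite (mem_parts _ (Ordinal kn)) inE.
Qed.

Definition QtildeXY : polyXY n :=
  \sum_(A : {set 'I_n})
    (Qtilde (parts A) \mPo [tuple xvar i | i < n]) *
    (Qtilde (parts (~: A)) \mPo [tuple yvar i | i < n]).

Definition SchubertC (w : Weyl n) : polyXY n :=
  (-1) ^+ (n * n.-1)./2 *
  divdiffw' (compg w^-1%g (w0 n)) (DeltaXY n * QtildeXY).

(* f(omega_0 X, - Y)                                                            *)
Definition revX_oppY (f : polyXY n) : polyXY n :=
  substXY (fun i => xvar (rev_ord i)) (fun j => - yvar j) f.

Definition star (w : 'S_n) : 'S_n := compg (omega0 n) (compg w (omega0 n)).

End QtildePolynomials.

(* Main.v *)
From HB Require Import structures.
Require Import Defs.
From mathcomp Require Import all_boot all_order all_algebra all_fingroup.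
From mathcomp Require Import ring zify.
Set Implicit Arguments.
Unset Strict Implicit.
Unset Printing Implicit Defensive.
Import Order.TTheory GRing.Theory Num.Theory.
Local Open Scope ring_scope.

(** Both families are obtained from one polynomial each by divided differences,
    and the substitution reversing X exchanges the type A operator of index i with
    the type C operator of index n - i ([revX_oppY_divdiff]).  A reduced word for
    the type C polynomial of w is made of the reversed letters n - i of a reduced
    word for the type A polynomial of w^*, followed by a reduced word of
    v = (-n, ..., -1) ([reduced_word_C]); by Matsumoto's theorem ([matsumoto]) any
    reduced words may be used.  So the identity follows from its case of the
    longest permutation ([SchubertC_base]): up to sign, the divided difference of v
    maps Delta(X, Y) Qtilde(X, Y) to the product of the x_k + y_j with j < k, which
    is Delta(omega_0 X, - Y).

    The divided difference of v is a composite of n chains, the (m + 1)-st of which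
    is d_m ... d_1 d_0.  By the twisted Leibniz rule, a chain turns the staircase
    in m + 1 variables times a symmetric f into the staircase in m variables times
    the chain of (x_0 - y_0) ... (x_0 - y_(m-1)) f ([ddG_stair]).  This shortens by
    one the products of elementary symmetric polynomials e_k of which f is a
    combination with invariant coefficients ([lenlt_rmpart]).  Hence v kills
    Delta f as soon as f is made of products of fewer than n of the e_k
    ([ddG_short]), and only the term Qtilde_(n, ..., 1)(X) of Qtilde(X, Y) counts.
    Modulo what is killed, all matchings in its Pfaffian give plus or minus
    e_1 ... e_n ([ddG_Delta_matching]) and their signs add up to 1
    ([matching_sign]).

    There remains the value on e_1 ... e_n ([ddG_Delta_top]).  With
    E(T) = (x_0 + T) ... (x_(n-1) + T), the value on E(y_0) ... E(y_(n-1)) is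
    computed chain by chain: the roots y_j of the staircase meet the parameters of
    the factors E(y_j) ([ddG_test]).  The same value is reached from e_1 ... e_n by
    replacing the e_k one after the other by factors E(y_a): the value on
    e_1 ... e_k E(T) E(y_(k+1)) ... E(y_(n-1)) is a polynomial in T of degree less
    than n - k which vanishes at the - y_a with a > k, because E(T) E(- T) is
    invariant, and its leading coefficient is the value with e_(k+1) in place of
    E(T) ([ddG_Delta_evalE_step]).

    For the positivity, let f be obtained from Delta(X, Y) by divided differences
    of type A, and let R_k f be obtained by inserting 0 before the variable x_k.
    Then R_k f - R_(k-1) f is x_(k-1) R_(k-1) of a divided difference of f
    ([ins0_step]), and the last R_k f is f.  So f - f(0, Y) has nonnegative
    coefficients in X and - Y by induction, starting from the longest words.
    Exchanging X and - Y maps f to a polynomial of the same kind ([swapXY_ddw]),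
    which leaves the constant term; by homogeneity it is 0 unless the word has
    maximal length, when f is 0 or 1. *)

(** * The Weyl group action and divided differences *)

Lemma rmorph_mpoly_ext (N : nat) (T : nzRingType)
    (f g : {rmorphism {mpoly int[N]} -> T}) :
  (forall k, f 'X_k = g 'X_k) -> f =1 g.
Proof.
move=> fg p; elim/mpolyind: p => [|c m p _ _ IH]; first by rewrite !rmorph0.
rewrite !rmorphD IH; congr (_ + _); rewrite -mul_mpolyC !rmorphM.
congr (_ * _).
  have -> : c%:MP = c%:~R :> {mpoly int[N]}.
    by rewrite -[in LHS](intz c); apply: (rmorph_int (@mpolyC N int)).
  by rewrite !rmorph_int.
rewrite mpolyXE_id !rmorph_prod; apply: eq_bigr => i _.
by rewrite !rmorphXn /= fg.
Qed.

HB.instance Definition _ (n : nat) (A B : 'I_n -> polyXY n) :=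
  GRing.isZmodMorphism.Build _ _ (substXY A B) (snd (substXY_is_rmorphism A B)).
HB.instance Definition _ (n : nat) (A B : 'I_n -> polyXY n) :=
  GRing.isMonoidMorphism.Build _ _ (substXY A B) (fst (substXY_is_rmorphism A B)).
HB.instance Definition _ (n : nat) (w : Weyl n) :=
  GRing.RMorphism.copy (wact w) (substXY _ _).

Section Action.
Variable n : nat.
Implicit Types (i j k : 'I_n) (f g h : polyXY n) (u w : Weyl n).

Lemma substXY_x (A B : 'I_n -> polyXY n) i : substXY A B (xvar i) = A i.
Proof.
rewrite substXY_X; case: splitP => j /= ij; last by have := ltn_ord i; lia.
by congr A; apply: val_inj.
Qed.

Lemma substXY_y (A B : 'I_n -> polyXY n) j : substXY A B (yvar j) = B j.
Proof.
rewrite substXY_X; case: splitP => k /= jk; first by have := ltn_ord k; lia.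
by congr B; apply: val_inj; apply/eqP; rewrite -(eqn_add2l n) jk.
Qed.

Lemma polyXY_ext (T : nzRingType) (f g : {rmorphism polyXY n -> T}) :
  (forall i, f (xvar i) = g (xvar i)) -> (forall j, f (yvar j) = g (yvar j)) ->
  f =1 g.
Proof.
move=> fx fy; apply: rmorph_mpoly_ext => k; rewrite -(splitK k).
by case: (split k) => j; [exact: fx | exact: fy].
Qed.

Lemma wact_x w i :
  wact w (xvar i) = let p := sgval w (i, false) in (-1) ^+ p.2 * xvar p.1.
Proof. exact: substXY_x. Qed.

Lemma wact_y w j : wact w (yvar j) = yvar j.
Proof. exact: substXY_y. Qed.

Lemma wactM u w f : wact (u * w)%g f = wact w (wact u f).
Proof.
apply: (polyXY_ext (f := wact (u * w)%g) (g := wact w \o wact u)) => [i|j] /=;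
  last by rewrite !wact_y.
have E : sgval (u * w)%g (i, false) = sgval w (sgval u (i, false)).
  by rewrite Defs.sgvalM permM.
rewrite !wact_x E; case: (sgval u _) => j b /=.
rewrite rmorphM rmorph_sign /= wact_x sgval_bar /=.
by rewrite mulrA signr_addb.
Qed.

Lemma wact1 f : wact 1%g f = f.
Proof.
apply: (polyXY_ext (f := wact 1%g) (g := idfun)) => [i|j] /=; last by rewrite wact_y.
by rewrite wact_x /= perm1 mul1r.
Qed.

Lemma sgenK i : (sgen i * sgen i = 1)%g.
Proof.
rewrite /sgen; case: ifP => _; apply: val_inj => /=; first exact: tperm2.
apply/permP => -[j b]; rewrite permM !permE /= /lift_fun /=.
by rewrite tpermK.
Qed.

Lemma sgenV i : ((sgen i)^-1 = sgen i)%g.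
Proof. by apply/eqP; rewrite eq_invg_mul sgenK. Qed.

Local Notation S i := (wact (sgen i)).

Lemma sactK i f : S i (S i f) = f.
Proof. by rewrite -wactM sgenK wact1. Qed.

Lemma sact0_x i j : i = 0 :> nat -> S i (xvar j) = if j == i then - xvar j else xvar j.
Proof.
move=> i0; rewrite wact_x /sgen i0 /= permE /= xpair_eqE andbT.
case: eqVneq => [->|ne] /=; first by rewrite mulN1r.
by rewrite xpair_eqE andbF /= mul1r.
Qed.

Lemma sactS_x i j : (0 < i)%N -> S i (xvar j) = xvar (tperm (prev_ord i) i j).
Proof. by move=> i0; rewrite wact_x /sgen -[_ == _]negbK -lt0n i0 /= permE mul1r. Qed.

Lemma divdiff_den_neq0 i : divdiff_den i != 0.
Proof.
apply/eqP => /(congr1 (mcoeff U_(lshift n i))); rewrite mcoeff0 /divdiff_den.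
case: ifP => [_|/negbT i0].
  by rewrite mulr_natl mcoeffMn mcoeffXU eqxx.
rewrite mcoeffB !mcoeffXU eqxx (inj_eq (@lshift_inj _ _)) -val_eqE /=.
by case: eqP => //; lia.
Qed.

End Action.

(** * Divided differences in an abstract ring *)

(** The values of the reflections on the variables and the relations between the
    reflections determine the calculus of divided differences.  The elements y_j are
    parameters: besides their invariance, the interpolation arguments below use that
    they are distinct and that the y_a + y_b do not vanish.  Indices count from 0
    and only those below n are meaningful. *)
Record dd_system (n : nat) (R : idomainType) := DDSystem {
  xv : nat -> R;
  yv : nat -> R;
  sg : nat -> {rmorphism R -> R};
  dd : nat -> R -> R;
  dden := (fun i => if i is j.+1 then xv j - xv j.+1 else 2%:R * xv 0) : nat -> R;
  dden_neq0 : forall i, (i < n)%N -> dden i != 0;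
  ddE : forall i f, (i < n)%N -> dd i f * dden i = f - sg i f;
  sgK : forall i f, (i < n)%N -> sg i (sg i f) = f;
  sg0x0 : (0 < n)%N -> sg 0 (xv 0) = - xv 0;
  sg0x : forall j, (0 < j < n)%N -> sg 0 (xv j) = xv j;
  sgxl : forall j, (j.+1 < n)%N -> sg j.+1 (xv j) = xv j.+1;
  sgx : forall j k, (j.+1 < n)%N -> (k < n)%N -> k != j -> k != j.+1 ->
    sg j.+1 (xv k) = xv k;
  sgy : forall i j, (i < n)%N -> sg i (yv j) = yv j;
  sgC : forall i j f, (i.+1 < j < n)%N -> sg i (sg j f) = sg j (sg i f);
  sg_braid3 : forall i f, (0 < i)%N -> (i.+1 < n)%N ->
    sg i (sg i.+1 (sg i f)) = sg i.+1 (sg i (sg i.+1 f));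
  sg_braid4 : forall f, (1 < n)%N ->
    sg 0 (sg 1 (sg 0 (sg 1 f))) = sg 1 (sg 0 (sg 1 (sg 0 f)));
  yv_inj : forall a b, (a < n)%N -> (b < n)%N -> yv a = yv b -> a = b;
  yvD_neq0 : forall a b, (a < n)%N -> (b < n)%N -> yv a + yv b != 0
}.

Section DividedDifferences.
Variables (n : nat) (R : idomainType) (d : dd_system n R).
Implicit Types (f g h : R) (i j k m : nat).
Local Notation x := (xv d).
Local Notation y := (yv d).
Local Notation S := (sg d).
Local Notation D := (dd d).
Local Notation den := (dden d).

Lemma sgxr j : (j.+1 < n)%N -> S j.+1 (x j.+1) = x j.
Proof. by move=> jn; rewrite -(sgxl d jn) sgK. Qed.

Lemma sg_dden i : (i < n)%N -> S i (den i) = - den i.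
Proof.
case: i => [|i] i_n; rewrite /dden; first by rewrite rmorphM rmorph_nat sg0x0 ?mulrN.
by rewrite rmorphB sgxl // sgxr // opprB.
Qed.

Lemma dd_uniq i f g : (i < n)%N -> g * den i = f - S i f -> D i f = g.
Proof. by move=> i_n H; apply: (mulIf (dden_neq0 d i_n)); rewrite ddE ?H. Qed.

Lemma ddD i f g : (i < n)%N -> D i (f + g) = D i f + D i g.
Proof. move=> i_n; apply: dd_uniq => //; rewrite mulrDl !ddE // rmorphD; ring. Qed.

Lemma ddN i f : (i < n)%N -> D i (- f) = - D i f.
Proof. move=> i_n; apply: dd_uniq => //; rewrite mulNr !ddE // rmorphN; ring. Qed.

Lemma ddB i f g : (i < n)%N -> D i (f - g) = D i f - D i g.
Proof. by move=> i_n; rewrite ddD ?ddN. Qed.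

Lemma ddM i f g : (i < n)%N -> D i (f * g) = D i f * g + S i f * D i g.
Proof.
move=> i_n; apply: dd_uniq => //.
rewrite mulrDl mulrAC ddE // -mulrA ddE // rmorphM; ring.
Qed.

Lemma dd_inv i f : (i < n)%N -> S i f = f -> D i f = 0.
Proof. by move=> i_n H; apply: dd_uniq => //; rewrite H subrr mul0r. Qed.

Lemma dd0 i : (i < n)%N -> D i 0 = 0.
Proof. by move=> i_n; rewrite dd_inv ?rmorph0. Qed.

Lemma dd1 i : (i < n)%N -> D i 1 = 0.
Proof. by move=> i_n; rewrite dd_inv ?rmorph1. Qed.

Lemma dd_sum i (I : Type) (r : seq I) (P : pred I) (F : I -> R) : (i < n)%N ->
  D i (\sum_(a <- r | P a) F a) = \sum_(a <- r | P a) D i (F a).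
Proof. by move=> i_n; apply: (big_morph (D i) (fun f g => ddD f g i_n) (dd0 i_n)). Qed.

Lemma dd_invl i f g : (i < n)%N -> S i f = f -> D i (f * g) = f * D i g.
Proof. by move=> i_n H; rewrite ddM // dd_inv // H mul0r add0r. Qed.

Lemma dd_invr i f g : (i < n)%N -> S i g = g -> D i (f * g) = D i f * g.
Proof. by move=> i_n H; rewrite mulrC dd_invl // mulrC. Qed.

Lemma sg_dd i f : (i < n)%N -> S i (D i f) = D i f.
Proof.
move=> i_n; apply/esym/dd_uniq => //; apply: (@oppr_inj _).
by rewrite -mulrN -sg_dden // -rmorphM ddE // rmorphB sgK // opprB.
Qed.

Lemma dd_sqr i f : (i < n)%N -> D i (D i f) = 0.
Proof. by move=> i_n; rewrite dd_inv ?sg_dd. Qed.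

Lemma dd_xr j : (j.+1 < n)%N -> D j.+1 (x j.+1) = -1.
Proof. by move=> jn; apply: dd_uniq => //; rewrite mulN1r sgxr // opprB. Qed.

Lemma dd0_x0 : (0 < n)%N -> D 0 (x 0) = 1.
Proof. by move=> n0; apply: dd_uniq => //; rewrite sg0x0 // mul1r opprK /dden; ring. Qed.

Lemma sg_dden_far i j : (i.+1 < j < n)%N -> S i (den j) = den j /\ S j (den i) = den i.
Proof.
move=> /andP[ij jn]; case: j ij jn => // j ij jn; rewrite /dden.
case: i ij => [|i] ij; split; rewrite ?rmorphM ?rmorphB ?rmorph_nat /=.
- by rewrite !sg0x // ?jn ?(ltnW jn) ?andbT.
- by rewrite sgx //; lia.
- by rewrite !sgx //; lia.
- by rewrite !sgx //; lia.
Qed.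

Lemma sg_dd_far i j f : (i.+1 < j < n)%N ->
  S i (D j f) = D j (S i f) /\ S j (D i f) = D i (S j f).
Proof.
move=> H; have [H1 H2] := sg_dden_far H; have /andP[ij jn] := H.
have i_n : (i < n)%N by lia.
split; apply/esym/dd_uniq => //.
  by rewrite -{1}H1 -rmorphM ddE // rmorphB (sgC d f H).
by rewrite -{1}H2 -rmorphM ddE // rmorphB -(sgC d f H).
Qed.

Lemma ddC i j f : (i.+1 < j < n)%N -> D i (D j f) = D j (D i f).
Proof.
move=> H; have [H1 H2] := sg_dden_far H; have /andP[ij jn] := H.
have i_n : (i < n)%N by lia.
have [E1 E2] := sg_dd_far f H.
apply: dd_uniq => //; apply: (mulIf (dden_neq0 d jn)).
rewrite mulrAC ddE // mulrBl E1 !ddE // E2 mulrBl !ddE //.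
by rewrite (sgC d f H); ring.
Qed.

End DividedDifferences.

(** * Braid relations *)

Section Braid.
Variables (n : nat) (R : idomainType) (d : dd_system n R).
Implicit Types (f g h : R) (i j k m : nat).
Local Notation x := (xv d).
Local Notation y := (yv d).
Local Notation S := (sg d).
Local Notation D := (dd d).
Local Notation den := (dden d).

(** The right hand side is the alternating sum over the dihedral group of order 6; the
    braid relation of the reflections makes its last term, and so the whole sum,
    symmetric in i and j. *)
Lemma dden_expand i j f (al be : R) : (i < n)%N -> (j < n)%N ->
  al = den i -> be = den j -> S i be = al + be -> S j al = al + be ->
  D i (D j (D i f)) * (al * be * (al + be)) =
  f - S i f - S j f + S j (S i f) + S i (S j f) - S i (S j (S i f)).
Proof.
move=> i_n jn al_i be_j Sibe Sjal.
have Sial : S i al = - al by rewrite al_i sg_dden.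
set g := D i f; set h := D j g; set k := D i h.
have eg : g * al = f - S i f by rewrite al_i ddE.
have eh : h * be = g - S j g by rewrite be_j ddE.
have ek : k * al = h - S i h by rewrite al_i ddE.
have Sg : S i g = g by rewrite sg_dd.
have e1 : S i h * (al + be) = g - S i (S j g).
  by rewrite -Sibe -rmorphM eh rmorphB Sg.
have e2 : S j g * (al + be) = S j f - S j (S i f).
  by rewrite -Sjal -rmorphM eg rmorphB.
have e3 : S i (S j g) * be = S i (S j f) - S i (S j (S i f)).
  have -> : be = S i (S j al) by rewrite Sjal rmorphD Sial Sibe; ring.
  by rewrite -!rmorphM eg !rmorphB.
transitivity (k * al * be * (al + be)); first by ring.
rewrite ek.
transitivity (h * be * (al + be) - S i h * (al + be) * be); first by ring.
rewrite eh e1.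
transitivity (g * al - S j g * (al + be) + S i (S j g) * be); first by ring.
by rewrite eg e2 e3; ring.
Qed.

Lemma dd_braid3 i f : (0 < i)%N -> (i.+1 < n)%N ->
  D i (D i.+1 (D i f)) = D i.+1 (D i (D i.+1 f)).
Proof.
case: i => // i _ i_n; have i_n' : (i.+1 < n)%N by lia.
pose al := den i.+1; pose be := den i.+2.
have Sbe : S i.+1 be = al + be.
  by rewrite /al /be /dden rmorphB sgxr // sgx; [ring | lia..].
have Sal : S i.+2 al = al + be.
  by rewrite /al /be /dden rmorphB sgxl // sgx; [ring | lia..].
apply: (@mulIf _ (al * be * (al + be))).
  apply: mulf_neq0; first by apply: mulf_neq0; exact: dden_neq0.
  by apply: contraNneq (dden_neq0 d i_n) => H; rewrite -/be -(sgK d be i_n') Sbe H rmorph0.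
rewrite (dden_expand f i_n' i_n erefl erefl Sbe Sal).
have -> : al * be * (al + be) = be * al * (be + al) by ring.
rewrite [al + be]addrC in Sbe Sal.
rewrite (dden_expand f i_n i_n' erefl erefl Sal Sbe) sg_braid3 //; ring.
Qed.

(** Both sides, multiplied by the four positive roots of type C_2, are the
    alternating sum over the dihedral group of order 8. *)
Lemma dd_braid4 f : (1 < n)%N ->
  D 0 (D 1 (D 0 (D 1 f))) = D 1 (D 0 (D 1 (D 0 f))).
Proof.
move=> n1; have n0 : (0 < n)%N by lia.
pose al := den 0; pose be := den 1; pose ga := x 0 + x 1; pose de := 2%:R * x 1.
have Sx : [/\ S 0 (x 0) = - x 0, S 0 (x 1) = x 1, S 1 (x 0) = x 1 & S 1 (x 1) = x 0].
  by split; [rewrite sg0x0 | rewrite sg0x // n1 | rewrite sgxl | rewrite sgxr].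
case: Sx => S00 S01 S10 S11.
have Sabe : S 0 be = - ga by rewrite /be /ga /dden rmorphB S00 S01; ring.
have Saga : S 0 ga = - be by rewrite /be /ga /dden rmorphD S00 S01; ring.
have Sade : S 0 de = de by rewrite /de rmorphM rmorph_nat S01.
have Sbal : S 1 al = de by rewrite /al /de /dden rmorphM rmorph_nat S10.
have Sbga : S 1 ga = ga by rewrite /ga rmorphD S10 S11 addrC.
have Sbde : S 1 de = al by rewrite /al /de /dden rmorphM rmorph_nat S11.
have nz : al * be * ga * de != 0.
  have nzb : be != 0 by rewrite dden_neq0.
  have nza : al != 0 by rewrite dden_neq0.
  apply: mulf_neq0; [apply: mulf_neq0; first exact: mulf_neq0|].
    by apply: contraNneq nzb => H; rewrite -(sgK d be n0) Sabe H oppr0 rmorph0.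
  by apply: contraNneq nza => H; rewrite -Sbde H rmorph0.
apply: (mulIf nz).
transitivity (- (f - S 1 f) + (S 0 f - S 0 (S 1 f)) - (S 1 (S 0 f) - S 1 (S 0 (S 1 f)))
   + (S 0 (S 1 (S 0 f)) - S 0 (S 1 (S 0 (S 1 f))))).
  set g1 := D 1 f; set g2 := D 0 g1; set g3 := D 1 g2; set g4 := D 0 g3.
  have e1 : g1 * be = f - S 1 f by rewrite ddE.
  have e2 : g2 * al = g1 - S 0 g1 by rewrite ddE.
  have e3 : g3 * be = g2 - S 1 g2 by rewrite ddE.
  have e4 : g4 * al = g3 - S 0 g3 by rewrite ddE.
  have Sg1 : S 1 g1 = g1 by rewrite sg_dd.
  have Sg2 : S 0 g2 = g2 by rewrite sg_dd.
  have a3 : S 0 g3 * - ga = g2 - S 0 (S 1 g2) by rewrite -Sabe -rmorphM e3 rmorphB Sg2.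
  have b2 : S 1 g2 * de = g1 - S 1 (S 0 g1) by rewrite -Sbal -rmorphM e2 rmorphB Sg1.
  have c2 : S 0 (S 1 g2) * de = S 0 g1 - S 0 (S 1 (S 0 g1)).
    by rewrite -{1}Sade -rmorphM b2 rmorphB.
  have a1 : S 0 g1 * - ga = S 0 f - S 0 (S 1 f) by rewrite -Sabe -rmorphM e1 rmorphB.
  have b1 : S 1 (S 0 g1) * - ga = S 1 (S 0 f) - S 1 (S 0 (S 1 f)).
    by rewrite -{1}Sbga -rmorphN -rmorphM a1 rmorphB.
  have c1 : S 0 (S 1 (S 0 g1)) * be = S 0 (S 1 (S 0 f)) - S 0 (S 1 (S 0 (S 1 f))).
    have -> : be = S 0 (- ga) by rewrite rmorphN Saga opprK.
    by rewrite -rmorphM b1 rmorphB.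
  transitivity (g4 * al * be * ga * de); first by ring.
  rewrite e4; transitivity (g3 * be * (ga * de) + S 0 g3 * - ga * (be * de)); first by ring.
  rewrite e3 a3.
  transitivity (g2 * al * de - S 1 g2 * de * ga - S 0 (S 1 g2) * de * be).
    by rewrite /al /be /ga /de /dden; ring.
  rewrite e2 b2 c2.
  transitivity (- (g1 * be) + S 0 g1 * - ga - S 1 (S 0 g1) * - ga
    + S 0 (S 1 (S 0 g1)) * be); last by rewrite e1 a1 b1 c1.
  by rewrite /al /be /ga /de /dden; ring.
set h1 := D 0 f; set h2 := D 1 h1; set h3 := D 0 h2; set h4 := D 1 h3.
have e1 : h1 * al = f - S 0 f by rewrite ddE.
have e2 : h2 * be = h1 - S 1 h1 by rewrite ddE.
have e3 : h3 * al = h2 - S 0 h2 by rewrite ddE.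
have e4 : h4 * be = h3 - S 1 h3 by rewrite ddE.
have Sh1 : S 0 h1 = h1 by rewrite sg_dd.
have Sh2 : S 1 h2 = h2 by rewrite sg_dd.
have b3 : S 1 h3 * de = h2 - S 1 (S 0 h2) by rewrite -Sbal -rmorphM e3 rmorphB Sh2.
have a2 : S 0 h2 * - ga = h1 - S 0 (S 1 h1) by rewrite -Sabe -rmorphM e2 rmorphB Sh1.
have b2 : S 1 (S 0 h2) * - ga = S 1 h1 - S 1 (S 0 (S 1 h1)).
  by rewrite -{1}Sbga -rmorphN -rmorphM a2 rmorphB.
have b1 : S 1 h1 * de = S 1 f - S 1 (S 0 f) by rewrite -Sbal -rmorphM e1 rmorphB.
have c1 : S 0 (S 1 h1) * de = S 0 (S 1 f) - S 0 (S 1 (S 0 f)).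
  by rewrite -{1}Sade -rmorphM b1 rmorphB.
have d1 : S 1 (S 0 (S 1 h1)) * al = S 1 (S 0 (S 1 f)) - S 1 (S 0 (S 1 (S 0 f))).
  by rewrite -Sbde -rmorphM c1 rmorphB.
symmetry.
transitivity (h4 * be * (al * ga * de)); first by ring.
rewrite e4; transitivity (h3 * al * (ga * de) - S 1 h3 * de * (al * ga)); first by ring.
rewrite e3 b3.
transitivity (- 2%:R * (h2 * be) * ga + S 0 h2 * - ga * de - S 1 (S 0 h2) * - ga * al).
  by rewrite /al /be /ga /de /dden; ring.
rewrite e2 a2 b2.
transitivity (- (h1 * al) + S 1 h1 * de - S 0 (S 1 h1) * de + S 1 (S 0 (S 1 h1)) * al).
  by rewrite /al /be /ga /de /dden; ring.
rewrite e1 b1 c1 d1 sg_braid4 //; ring.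
Qed.

End Braid.

(** * Length and reduced words in the hyperoctahedral group *)

Section Length.
Variable n : nat.
Implicit Types (i j k : 'I_n) (u w z : Weyl n) (a b c : seq 'I_n).

Lemma entry_inj u w : entry u =1 entry w -> u = w.
Proof.
move=> E; apply: val_inj => /=; apply/permP => -[i b]; rewrite (sgval_bar u) (sgval_bar w).
suff -> : sgval u (i, false) = sgval w (i, false) by [].
move: (E i); rewrite /entry.
case: (sgval u (i, false)) => k s; case: (sgval w (i, false)) => l t /=.
by case: s; case: t; rewrite ?expr1 ?expr0 ?mulN1r ?mul1r // => H;
  congr (_, _); apply: val_inj => /=; lia.
Qed.

Lemma entry_neq0 w i : entry w i != 0.
Proof. by rewrite /entry; case: (sgval w _) => k []; rewrite /= ?mulN1r ?mul1r; lia. Qed.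

Lemma entry_sgen w i k : entry (sgen i * w)%g k =
  if i == 0 :> nat then (if k == i then - entry w k else entry w k)
  else entry w (tperm (prev_ord i) i k).
Proof.
case: ifP => [/eqP i0|/negbT i0]; last by rewrite entry_swap // lt0n.
by rewrite entry_flip //; case: ifP; rewrite ?mulN1r ?mul1r.
Qed.

Lemma prev_ord_neq i : (0 < i)%N -> prev_ord i != i.
Proof. by move=> i0; rewrite -val_eqE /=; lia. Qed.

Lemma sgen_comm i j w : (i.+1 < j)%N -> (sgen i * (sgen j * w) = sgen j * (sgen i * w))%g.
Proof.
move=> ij; apply: entry_inj => k.
have j0 : (j == 0 :> nat) = false by lia.
rewrite !entry_sgen !j0.
have n1 : j != i by rewrite -val_eqE /=; lia.
have n2 : prev_ord j != i by rewrite -val_eqE /=; lia.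
have E0 : (tperm (prev_ord j) j k == i) = (k == i).
  by rewrite -{1}(tpermD n2 n1) (inj_eq perm_inj).
case: ifP => i0; first by rewrite E0.
have n3 : j != prev_ord i by rewrite -val_eqE /=; lia.
have n4 : prev_ord j != prev_ord i by rewrite -val_eqE /=; lia.
congr (entry _ _).
case: (tpermP (prev_ord i) i k) => [->|->|/eqP k1 /eqP k2].
- by rewrite [tperm _ j (prev_ord i)]tpermD // tpermL tpermD.
- by rewrite [tperm _ j i]tpermD // tpermR tpermD.
case: (tpermP (prev_ord j) j k) => [_|_|/eqP k3 /eqP k4]; rewrite tpermD // eq_sym //.
Qed.

Lemma tperm_braid (T : finType) (p q r k : T) : p != q -> q != r -> p != r ->
  tperm p q (tperm q r (tperm p q k)) = tperm q r (tperm p q (tperm q r k)).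
Proof.
move=> pq qr pr; have qp : q != p by rewrite eq_sym.
have rq : r != q by rewrite eq_sym. have rp : r != p by rewrite eq_sym.
have [->|kp] := eqVneq k p.
  by rewrite tpermL tpermL [tperm q r p]tpermD // tpermL tpermL tpermD.
have [->|kq] := eqVneq k q.
  by rewrite tpermR [tperm q r p]tpermD // tpermL tpermL [tperm p q r]tpermD // tpermR.
have [->|kr] := eqVneq k r.
  by rewrite [tperm p q r]tpermD // tpermR tpermR tpermD.
have E1 : tperm p q k = k by rewrite tpermD // eq_sym.
have E2 : tperm q r k = k by rewrite tpermD // eq_sym.
by rewrite !(E1, E2).
Qed.

Lemma sgen_braid3 i j w : (0 < i)%N -> j = i.+1 :> nat ->
  (sgen i * (sgen j * (sgen i * w)) = sgen j * (sgen i * (sgen j * w)))%g.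
Proof.
move=> i0 ji; apply: entry_inj => k.
rewrite !entry_sgen.
have -> : (j == 0 :> nat) = false by lia.
have -> : (i == 0 :> nat) = false by lia.
have -> : prev_ord j = i by apply: val_inj; rewrite /= ji.
congr (entry _ _); apply: tperm_braid; rewrite -val_eqE /=; lia.
Qed.

Lemma sgen_braid4 i j w : i = 0 :> nat -> j = 1 :> nat ->
  (sgen i * (sgen j * (sgen i * (sgen j * w))) =
   sgen j * (sgen i * (sgen j * (sgen i * w))))%g.
Proof.
move=> i0 j1; apply: entry_inj => k.
rewrite !entry_sgen.
rewrite i0 j1 /=.
have -> : prev_ord j = i by apply: val_inj; rewrite /= i0 j1.
have ij : i != j by rewrite -val_eqE /= i0 j1.
have ji : j != i by rewrite eq_sym.
have [->|ki] := eqVneq k i.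
  by rewrite !(tpermL, tpermR, eqxx, negPf ji, negPf ij).
have [->|kj] := eqVneq k j.
  by rewrite !(tpermL, tpermR, eqxx, negPf ji, negPf ij).
have E : tperm i j k = k by rewrite tpermD // eq_sym.
by rewrite !(E, negPf ki).
Qed.

Definition desc i w : bool :=
  if i == 0 :> nat then entry w i < 0 else entry w i < entry w (prev_ord i).

(** The number of positive roots of type C made negative by w; the terms are for the
    roots e_j - e_i, e_i + e_j and 2 e_i. *)
Definition invn w : nat :=
  (\sum_(p : 'I_n * 'I_n) (p.1 < p.2) *
     ((entry w p.2 < entry w p.1)%R + (entry w p.1 + entry w p.2 < 0)%R)
   + \sum_(i < n) (entry w i < 0)%R)%N.

Lemma desc_sgen i w : desc i (sgen i * w)%g = ~~ desc i w.
Proof.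
rewrite /desc !entry_sgen eqxx; case: (i == 0 :> nat) / boolP => i0 //.
  by rewrite oppr_lt0 -leNgt le_eqVlt eq_sym (negPf (entry_neq0 _ _)).
rewrite tpermL tpermR -leNgt le_eqVlt.
case: eqP => [/entry_eq E|] //=.
by have := prev_ord_neq (i := i); rewrite E eqxx; lia.
Qed.

Lemma invn_sgen_up i w : ~~ desc i w -> invn (sgen i * w)%g = (invn w).+1.
Proof.
rewrite /desc /invn -addnS; case: ifP => [/eqP i0|/negbT i0] nd.
  congr addn.
    apply: eq_bigr => -[j k] _ /=; case: (ltnP j k) => jk; rewrite ?mul0n // !mul1n.
    rewrite !entry_sgen i0 /=.
    have -> : (k == i) = false by rewrite -val_eqE /=; lia.
    case: ifP => // _; rewrite addnC; congr (nat_of_bool _ + nat_of_bool _)%N; lia.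
  rewrite (bigD1 i) //= [in RHS](bigD1 i) //= entry_sgen i0 eqxx /=.
  rewrite eqxx; have -> : (- entry w i < 0) = true by have := entry_neq0 w i; lia.
  have -> : (entry w i < 0) = false by lia.
  rewrite add1n add0n; congr _.+1; apply: eq_bigr => j /negPf ji.
  by rewrite entry_sgen i0 /= ji.
have pi : prev_ord i != i by rewrite prev_ord_neq ?lt0n.
set tau := tperm (prev_ord i) i.
have E (j : 'I_n) : entry (sgen i * w)%g j = entry w (tau j) by rewrite entry_sgen (negPf i0).
have -> : (\sum_(j < n) (entry (sgen i * w)%g j < 0)%R = \sum_(j < n) (entry w j < 0)%R)%N.
  rewrite (reindex_inj (@perm_inj _ tau)); apply: eq_bigr => j _.
  by rewrite E tpermK.
rewrite addnS -addSn; congr addn.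
pose h (p : 'I_n * 'I_n) := (tau p.1, tau p.2).
have hK : involutive h by move=> [j k]; rewrite /h /= !tpermK.
rewrite (reindex_inj (inv_inj hK)) /=.
have ne : (prev_ord i, i) != (i, prev_ord i) by rewrite xpair_eqE (negPf pi).
have ne' : (i, prev_ord i) != (prev_ord i, i) by rewrite eq_sym.
rewrite (bigD1 (prev_ord i, i)) //= (bigD1 (i, prev_ord i)) //=.
rewrite [in RHS](bigD1 (prev_ord i, i)) //= [in RHS](bigD1 (i, prev_ord i)) //=.
have tl : tau (prev_ord i) = i by rewrite /tau tpermL.
have tr : tau i = prev_ord i by rewrite /tau tpermR.
rewrite !E !(tl, tr) /=.
have l1 : (i.-1 < i)%N by lia.
have l2 : (i < i.-1)%N = false by lia.
rewrite l1 l2 !mul0n !mul1n !add0n.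
have -> : (entry w (prev_ord i) < entry w i) = true.
  rewrite lt_neqAle leNgt nd andbT; apply/eqP => /entry_eq H.
  by rewrite H eqxx in pi.
rewrite (negPf nd) add0n add1n addSn; congr _.+1.
rewrite [entry w i + _]addrC; congr addn.
apply: eq_bigr => -[j k] /= /andP[]; rewrite !xpair_eqE !negb_and => H1 H2.
rewrite !E !tpermK; congr muln.
suff -> : (tau j < tau k)%N = (j < k)%N by [].
move: H1 H2; rewrite /tau.
case: tpermP => [->|->|/eqP j1 /eqP j2]; case: tpermP => [->|->|/eqP k1 /eqP k2];
  try move: j1 j2; try move: k1 k2; rewrite -?val_eqE /=; lia.
Qed.

Lemma invn_sgen_down i w : desc i w -> invn w = (invn (sgen i * w)%g).+1.
Proof.
move=> dw; have := @invn_sgen_up i (sgen i * w)%g.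
by rewrite desc_sgen dw mulgA sgenK mul1g; apply.
Qed.

Lemma invn1 : invn 1%g = 0%N.
Proof.
have E (j : 'I_n) : entry 1%g j = j.+1 :> int by rewrite /entry /= perm1 mul1r.
rewrite /invn !big1 // => [i _|[j k] _ /=]; rewrite !E; first by lia.
by case: ltnP => //= jk; lia.
Qed.

(** A signed permutation without descents maximizes the height. *)
Lemma exists_desc w : w != 1%g -> exists i, desc i w.
Proof.
move=> w1; case: (pickP (desc^~ w)) => [i di|nd]; first by exists i.
case/eqP: w1; apply: height_max1 => i; move: (nd i); rewrite /desc /height.
case: ifP => [/eqP i0|/negbT i0] /negbT di.
  apply: ler_sum => j _; rewrite entry_sgen i0 /= ler_pM2l //.
  by case: eqP => // ->; lia.
have pi : prev_ord i != i by rewrite prev_ord_neq ?lt0n.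
rewrite (bigD1 i) //= (bigD1 (prev_ord i)) //= [leRHS](bigD1 i) //=.
rewrite [X in _ <= _ + X](bigD1 (prev_ord i)) //= !entry_sgen (negPf i0) tpermL tpermR.
rewrite !addrA; apply: lerD.
  have -> : i.-1.+1 = i by lia.
  by have := i0; nia.
apply: ler_sum => j /andP[j1 j2].
by rewrite entry_sgen (negPf i0) tpermD // eq_sym.
Qed.

(** A letter prepended to a word acts on the positions of the inverse of the product
    of the word; this is the side on which the entries change in a simple way. *)
Definition winv a : Weyl n := ((wprod a)^-1)%g.

Lemma winv_nil : winv [::] = 1%g. Proof. exact: invg1. Qed.

Lemma winv_cons i a : winv (i :: a) = (sgen i * winv a)%g.
Proof. by rewrite /winv /= /compg invMg sgenV. Qed.

Lemma invn_winv a : (invn (winv a) <= size a)%N.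
Proof.
elim: a => [|i a IH]; first by rewrite winv_nil invn1.
rewrite winv_cons /=; case: (boolP (desc i (winv a))) => di.
  by have := invn_sgen_down di; lia.
by rewrite invn_sgen_up.
Qed.

Lemma word_of_invn w : exists a, winv a = w /\ size a = invn w.
Proof.
elim: {w}(invn w) {-2}w (erefl (invn w)) => [|k IH] w wk.
  exists [::]; rewrite winv_nil; split=> //; apply/esym/eqP.
  by apply: contra_eqT wk => /exists_desc[i /invn_sgen_down ->].
have /exists_desc[i di] : w != 1%g by apply/eqP => w1; move: wk; rewrite w1 invn1.
have := invn_sgen_down di; rewrite wk => -[e]; have [a [aw sa]] := IH _ (esym e).
by exists (i :: a); rewrite winv_cons aw /= sa -e mulgA sgenK mul1g.
Qed.

Lemma wlenE w : wlen w = invn w^-1%g.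
Proof.
have [a [aw sa]] := word_of_invn (w^-1)%g.
rewrite /wlen; case: ex_minnP => k /existsP[b /eqP bw] kmin; apply/eqP.
rewrite eqn_leq; apply/andP; split.
  rewrite -sa; apply: kmin; apply/existsP; exists (in_tuple a); apply/eqP.
  by apply: invg_inj; rewrite -aw.
by rewrite -bw; apply: leq_trans (invn_winv b) _; rewrite size_tuple.
Qed.

Definition red a : bool := size a == invn (winv a).

Lemma reduced_wordE w a : reduced_word w a = (wprod a == w) && red a.
Proof.
rewrite /reduced_word; case: eqP => //= <-.
by rewrite wlenE.
Qed.

Lemma red_cons i a : red (i :: a) -> red a /\ ~~ desc i (winv a).
Proof.
rewrite /red winv_cons /=; have := invn_winv a.
case: (boolP (desc i (winv a))) => di.
  by have := invn_sgen_down di => -> /= ? /eqP; lia.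
by rewrite invn_sgen_up // => ? /eqP[->].
Qed.

Lemma cons_red i a : red a -> ~~ desc i (winv a) -> red (i :: a).
Proof. by rewrite /red winv_cons => /eqP sa di; rewrite invn_sgen_up // /= sa. Qed.

Lemma invn_sgen2 i j w : desc i w -> desc j (sgen i * w)%g ->
  invn w = (invn (sgen j * (sgen i * w))%g).+2.
Proof. by move=> di dj; rewrite (invn_sgen_down di) (invn_sgen_down dj). Qed.

Section Matsumoto.
Variables (V : Type) (T : 'I_n -> V -> V).
Hypothesis T_comm : forall i j v, (i.+1 < j)%N -> T i (T j v) = T j (T i v).
Hypothesis T_braid3 : forall i j v, (0 < i)%N -> j = i.+1 :> nat ->
  T i (T j (T i v)) = T j (T i (T j v)).
Hypothesis T_braid4 : forall i j v, i = 0 :> nat -> j = 1 :> nat ->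
  T i (T j (T i (T j v))) = T j (T i (T j (T i v))).

Lemma desc_far i j w : (i.+1 < j)%N -> desc i w -> desc j w ->
  desc j (sgen i * w)%g /\ desc i (sgen j * w)%g.
Proof.
move=> ij; rewrite /desc !entry_sgen.
have j0 : (j == 0 :> nat) = false by lia.
have n1 : j != i by rewrite -val_eqE /=; lia.
have n2 : prev_ord j != i by rewrite -val_eqE /=; lia.
have n3 : j != prev_ord i by rewrite -val_eqE /=; lia.
have n4 : prev_ord j != prev_ord i by rewrite -val_eqE /=; lia.
rewrite j0 (negPf n1) (negPf n2).
rewrite [tperm (prev_ord j) j i]tpermD // [tperm (prev_ord i) i j]tpermD 1?eq_sym //.
rewrite [tperm (prev_ord i) i _]tpermD 1?eq_sym // [tperm _ _ _]tpermD //.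
by case: ifP.
Qed.

(** This lemma and the next two: an element with the descents i and j has a reduced
    word starting with either of the longest words in i and j. *)
Lemma matsumoto_far i j w : (i.+1 < j)%N -> desc i w -> desc j w ->
  exists c, [/\ winv (j :: c) = (sgen i * w)%g, winv (i :: c) = (sgen j * w)%g &
    (size c).+2 = invn w].
Proof.
move=> ij di dj; have [d1 d2] := desc_far ij di dj.
have [c [cw sc]] := word_of_invn (sgen j * (sgen i * w))%g.
exists c; rewrite !winv_cons cw sc -(invn_sgen2 di d1); split=> //.
  by rewrite mulgA sgenK mul1g.
by rewrite -(sgen_comm w ij) mulgA sgenK mul1g.
Qed.

Lemma matsumoto_braid3 i j w : (0 < i)%N -> j = i.+1 :> nat -> desc i w -> desc j w ->
  exists c, [/\ winv (j :: i :: c) = (sgen i * w)%g,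
    winv (i :: j :: c) = (sgen j * w)%g & (size c).+3 = invn w].
Proof.
move=> i0 ji di dj.
have i0' : (i == 0 :> nat) = false by lia.
have j0 : (j == 0 :> nat) = false by lia.
have pj : prev_ord j = i by apply: val_inj; rewrite /= ji.
have n1 : prev_ord i != j by rewrite -val_eqE /=; lia.
have n2 : i != j by rewrite -val_eqE /=; lia.
have n3 : prev_ord i != i by rewrite -val_eqE /=; lia.
have d1 : desc j (sgen i * w)%g.
  move: di dj; rewrite /desc !entry_sgen i0' j0 pj tpermR tpermD //.
  by move=> di dj; apply: lt_trans dj di.
have d2 : desc i (sgen j * (sgen i * w))%g.
  move: dj; rewrite /desc !entry_sgen i0' j0 pj tpermL.
  by rewrite [tperm i j _]tpermD 1?eq_sym // tpermL [tperm _ _ j]tpermD.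
have [c [cw sc]] := word_of_invn (sgen i * (sgen j * (sgen i * w)))%g.
exists c; rewrite !winv_cons cw sc; split.
- by rewrite mulgA mulgA -[(_ * _ * sgen i)%g]mulgA sgenK mulg1 mulgA sgenK mul1g.
- rewrite (sgen_braid3 w i0 ji).
  by rewrite mulgA mulgA -[(_ * _ * sgen j)%g]mulgA sgenK mulg1 mulgA sgenK mul1g.
by rewrite (invn_sgen2 di d1) (invn_sgen_down d2).
Qed.

Lemma matsumoto_braid4 i j w : i = 0 :> nat -> j = 1 :> nat -> desc i w -> desc j w ->
  exists c, [/\ winv (j :: i :: j :: c) = (sgen i * w)%g,
    winv (i :: j :: i :: c) = (sgen j * w)%g & (size c).+4 = invn w].
Proof.
move=> i0 j1 di dj.
have pj : prev_ord j = i by apply: val_inj; rewrite /= i0 j1.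
have n1 : (j == i) = false by rewrite -val_eqE /= i0 j1.
move: di dj; rewrite /desc i0 j1 /= pj => di dj.
have d1 : desc j (sgen i * w)%g.
  by rewrite /desc !entry_sgen i0 j1 /= pj eqxx n1; lia.
have d2 : desc i (sgen j * (sgen i * w))%g.
  by rewrite /desc !entry_sgen i0 j1 /= pj tpermL n1; lia.
have d3 : desc j (sgen i * (sgen j * (sgen i * w)))%g.
  by rewrite /desc !entry_sgen i0 j1 /= pj tpermL tpermR eqxx n1; lia.
have [c [cw sc]] := word_of_invn (sgen j * (sgen i * (sgen j * (sgen i * w))))%g.
have K u k : (sgen k * (sgen k * u))%g = u by rewrite mulgA sgenK mul1g.
exists c; rewrite !winv_cons cw sc; split.
- by rewrite !K.
- by rewrite -(sgen_braid4 w i0 j1) !K.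
have di' : desc i w by rewrite /desc i0.
by rewrite (invn_sgen2 di' d1) (invn_sgen2 d2 d3).
Qed.

Lemma matsumoto_front i j a b w : (i < j)%N -> desc i w -> desc j w ->
  winv a = (sgen i * w)%g -> winv b = (sgen j * w)%g ->
  (size a).+1 = invn w -> (size b).+1 = invn w ->
  (forall c, size c = size a -> winv c = winv a ->
    forall v, foldr T v a = foldr T v c) ->
  (forall c, size c = size b -> winv c = winv b ->
    forall v, foldr T v b = foldr T v c) ->
  forall v, T i (foldr T v a) = T j (foldr T v b).
Proof.
move=> ij di dj wi wj sa sb keya keyb v.
have [ij1|ji] := ltnP i.+1 j.
  have [c [c1 c2 sc]] := matsumoto_far ij1 di dj.
  rewrite (keya (j :: c)) /=; [|lia|by rewrite c1].
  rewrite (keyb (i :: c)) /=; [|lia|by rewrite c2].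
  exact: T_comm.
have {ji} ji : j = i.+1 :> nat by lia.
have [i0|i0] := posnP i.
  rewrite i0 in ji.
  have [c [c1 c2 sc]] := matsumoto_braid4 i0 ji di dj.
  rewrite (keya (j :: i :: j :: c)) /=; [|lia|by rewrite c1].
  rewrite (keyb (i :: j :: i :: c)) /=; [|lia|by rewrite c2].
  exact: T_braid4.
have [c [c1 c2 sc]] := matsumoto_braid3 i0 ji di dj.
rewrite (keya (j :: i :: c)) /=; [|lia|by rewrite c1].
rewrite (keyb (i :: j :: c)) /=; [|lia|by rewrite c2].
exact: T_braid3.
Qed.

(** Matsumoto's theorem: two reduced words of the same element are connected by
    braid moves.  By induction on the length, it suffices to treat words with
    different first letters i and j: the element then has both as descents, hence
    a reduced word starting with the longest word in i and j. *)
Lemma matsumoto a b : red a -> red b -> winv a = winv b ->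
  forall v, foldr T v a = foldr T v b.
Proof.
elim: {a}(size a) {-2}a b (erefl (size a)) => [|k IH] a b.
  move/size0nil => -> _ /eqP sb ab; move: sb; rewrite -ab winv_nil invn1.
  by move/size0nil => ->.
case: a => // i a [sa] ra rb ab v.
have [ra' di] := red_cons ra.
have sb : size b = k.+1.
  by move: ra rb => /eqP + /eqP ->; rewrite -ab /= sa => <-.
case: b sb rb ab => // j b [sb] rb ab.
have [rb' dj] := red_cons rb.
move: (ab); rewrite !winv_cons => ab'.
set w := winv (i :: a).
have Nw : invn w = k.+1 by move/eqP: ra; rewrite -/w /= sa.
have wi : winv a = (sgen i * w)%g by rewrite /w winv_cons mulgA sgenK mul1g.
have wj : winv b = (sgen j * w)%g by rewrite /w ab winv_cons mulgA sgenK mul1g.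
have {}di : desc i w by rewrite /w winv_cons desc_sgen.
have {}dj : desc j w by rewrite /w ab winv_cons desc_sgen.
(* a braid move at the front, the induction hypothesis applying behind it *)
have key c (u : V) : size c = k -> winv c = winv a -> foldr T u a = foldr T u c.
  move=> sc ca; apply: IH => //; rewrite /red sc ca.
  by move/eqP: ra' => <-; rewrite sa.
have key' c (u : V) : size c = k -> winv c = winv b -> foldr T u b = foldr T u c.
  move=> sc cb; apply: IH => //; rewrite /red sc cb.
  by move/eqP: rb' => <-; rewrite sb.
rewrite /=.
have [eij|nij] := eqVneq i j.
  rewrite -eij; congr (T i _); apply: key => //.
  by rewrite wi wj eij.
have na : (size a).+1 = invn w by rewrite Nw sa.
have nb : (size b).+1 = invn w by rewrite Nw sb.
have [ij|ji|ij] := ltngtP i j.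
- by apply: (matsumoto_front ij di dj) => // c; [rewrite sa => sc ca u; apply: key|
    rewrite sb => sc cb u; apply: key'].
- by apply/esym/(matsumoto_front ji dj di) => // c; [rewrite sb => sc cb u; apply: key'|
    rewrite sa => sc ca u; apply: key].
by rewrite (val_inj ij) eqxx in nij.
Qed.

(** This is how the square of T i, when it is zero, makes the operator of a word that
    is not reduced vanish. *)
Lemma nonred_cons i a : red a -> ~~ red (i :: a) ->
  exists c, forall v, foldr T v a = T i (foldr T v c).
Proof.
move=> ra nr; have di : desc i (winv a) by apply: contraR nr; exact: cons_red.
have [c [cw sc]] := word_of_invn (sgen i * winv a)%g.
exists c => v; apply: (matsumoto (b := i :: c)) => //.
  by rewrite /red winv_cons cw mulgA sgenK mul1g (invn_sgen_down di) /= sc.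
by rewrite winv_cons cw mulgA sgenK mul1g.
Qed.

End Matsumoto.

End Length.

(** * Chains of divided differences *)

Section Chains.
Variables (n : nat) (R : idomainType) (d : dd_system n R).
Implicit Types (f g h c : R) (i j k m a : nat).
Local Notation x := (xv d).
Local Notation y := (yv d).
Local Notation S := (sg d).
Local Notation D := (dd d).

Fixpoint dd_chain a k f : R := if k is k'.+1 then dd_chain a.+1 k' (D a f) else f.

Lemma dd_chainD a k f g : (a + k <= n)%N -> dd_chain a k (f + g) = dd_chain a k f + dd_chain a k g.
Proof.
elim: k a f g => [|k IH] a f g akn //=.
by rewrite ddD ?IH //; lia.
Qed.

Lemma dd_chain0 a k : (a + k <= n)%N -> dd_chain a k 0 = 0.
Proof. by elim: k a => [|k IH] a akn //=; rewrite dd0 ?IH //; lia. Qed.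

Lemma dd_chainN a k f : (a + k <= n)%N -> dd_chain a k (- f) = - dd_chain a k f.
Proof. by elim: k a f => [|k IH] a f akn //=; rewrite ddN ?IH //; lia. Qed.

Lemma dd_chain_sum a k (I : Type) (r : seq I) (P : pred I) (F : I -> R) : (a + k <= n)%N ->
  dd_chain a k (\sum_(i <- r | P i) F i) = \sum_(i <- r | P i) dd_chain a k (F i).
Proof.
move=> akn.
exact: (big_morph (dd_chain a k) (fun f g => dd_chainD f g akn) (dd_chain0 akn)).
Qed.

Lemma dd_chain_invl a k c f : (a + k <= n)%N -> (forall i, (a <= i < a + k)%N -> S i c = c) ->
  dd_chain a k (c * f) = c * dd_chain a k f.
Proof.
elim: k a f => [|k IH] a f akn Sc //=.
rewrite dd_invl ?IH //; [lia | move=> i ai; apply: Sc; lia | lia | apply: Sc; lia].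
Qed.

Lemma dd_chain_invr a k c f : (a + k <= n)%N -> (forall i, (a <= i < a + k)%N -> S i c = c) ->
  dd_chain a k (f * c) = dd_chain a k f * c.
Proof. by move=> akn Sc; rewrite mulrC dd_chain_invl // mulrC. Qed.

Lemma dd_monomial_ge a b e : (a.+1 < n)%N ->
  D a.+1 (x a ^+ (b + e) * x a.+1 ^+ b) =
  \sum_(i < e) x a ^+ (b + (e.-1 - i)) * x a.+1 ^+ (b + i).
Proof.
move=> an; apply: dd_uniq => //.
rewrite rmorphM !rmorphXn sgxl // sgxr // /dden !exprD.
transitivity (x a ^+ b * x a.+1 ^+ b * (x a ^+ e - x a.+1 ^+ e)); last by ring.
rewrite subrXX mulrCA mulrC; congr (_ * _); rewrite mulr_sumr.
by apply: eq_bigr => i _; rewrite -subn1 subnAC subn1 !exprD; ring.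
Qed.

Lemma dd_monomial_le a b e : (a.+1 < n)%N ->
  D a.+1 (x a ^+ b * x a.+1 ^+ (b + e)) =
  - \sum_(i < e) x a ^+ (b + (e.-1 - i)) * x a.+1 ^+ (b + i).
Proof.
move=> an; apply: dd_uniq => //; rewrite mulNr -dd_monomial_ge // ddE //.
by rewrite opprB !rmorphM !rmorphXn !sgxl // !sgxr // [x a.+1 ^+ _ * _]mulrC
  [X in _ = _ - X]mulrC.
Qed.

Section Staircase.
Variable H : nat -> {poly R}.
Hypothesis size_H : forall k, (size (H k) <= k.+1)%N.
Hypothesis H_inv : forall i k, (i < n)%N -> map_poly (S i) (H k) = H k.

Lemma H_coef_inv i k j : (i < n)%N -> S i (H k)`_j = (H k)`_j.
Proof. by move=> i_n; rewrite -{2}(H_inv k i_n) coef_map. Qed.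

Lemma sg_H i k t : (i < n)%N -> S i (H k).[t] = (H k).[S i t].
Proof. by move=> i_n; rewrite -horner_map H_inv. Qed.

Lemma H_expand k t : (H k).[t] = \sum_(j < k.+1) (H k)`_j * t ^+ j.
Proof. exact/horner_coef_wide. Qed.

(** A product of polynomials in the k variables following x_a (included), the
    degrees in them being at most k - 1, ..., 1, 0; the staircase Delta is of this
    kind. *)
Fixpoint gen_stair a k : R := if k is k'.+1 then (H k').[x a] * gen_stair a.+1 k' else 1.

Lemma sg_gen_stair i a k : (0 < i < a)%N -> (a + k <= n)%N -> S i (gen_stair a k) = gen_stair a k.
Proof.
elim: k a => [|k IH] a ia akn /=; first by rewrite rmorph1.
rewrite rmorphM IH; [|lia..]; rewrite sg_H; last lia.
by case: i ia {IH} => // i ia; rewrite sgx //; lia.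
Qed.

Lemma sg0_gen_stair a k : (0 < a)%N -> (a + k <= n)%N -> S 0 (gen_stair a k) = gen_stair a k.
Proof.
elim: k a => [|k IH] a a0 akn /=; first by rewrite rmorph1.
by rewrite rmorphM IH; [|lia..]; rewrite sg_H ?sg0x //; lia.
Qed.

(** Each divided difference lowers the exponent of the variable that it passes
    on to the next one below the bound allowed there, until no degree is left. *)
Lemma dd_chain_low a k b : (a + k < n)%N -> (b < k)%N ->
  dd_chain a.+1 k (x a ^+ b * gen_stair a.+1 k) = 0.
Proof.
elim: k a b => // k IH a b akn bk /=.
have an : (a.+1 < n)%N by lia.
have bk2 : (a.+2 + k <= n)%N by lia.
rewrite mulrA dd_invr // ?sg_gen_stair //; [|lia..].
have mono j : (j < k.+1)%N ->
    dd_chain a.+2 k (D a.+1 (x a ^+ b * x a.+1 ^+ j) * gen_stair a.+2 k) = 0.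
  move=> jk.
  have zero p q : (q < k)%N -> dd_chain a.+2 k (x a ^+ p * x a.+1 ^+ q * gen_stair a.+2 k) = 0.
    move=> qk; rewrite -mulrA dd_chain_invl //; first by rewrite IH ?mulr0 //; lia.
    by case=> // i ai; rewrite rmorphXn sgx //; lia.
  have [jb|bj] := leqP j b.
    rewrite -{1}(subnKC jb) dd_monomial_ge // mulr_suml dd_chain_sum // big1 // => i _.
    by apply: zero; have := ltn_ord i; lia.
  rewrite -(subnKC (ltnW bj)) dd_monomial_le // mulNr dd_chainN // mulr_suml dd_chain_sum //.
  by rewrite big1 ?oppr0 // => i _; apply: zero; have := ltn_ord i; lia.
rewrite H_expand mulr_sumr dd_sum // mulr_suml dd_chain_sum // big1 // => j _.
rewrite mulrCA dd_invl ?H_coef_inv // -mulrA dd_chain_invl ?mono ?mulr0 // => i ai.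
by rewrite H_coef_inv //; lia.
Qed.

(** The staircase on the last k of k + 1 consecutive variables is moved to the
    first k of them.  In the Leibniz rule for the first operator, the reflected f
    differs from f by the divided difference of f times the root, which trades the
    factor in x_(a+1) for the same factor in x_a; the remaining term has too low
    degrees by [dd_chain_low]. *)
Lemma dd_chain_shift a k f : (a + k < n)%N ->
  (forall i, (a.+1 < i <= a + k)%N -> S i f = f) ->
  dd_chain a.+1 k (f * gen_stair a.+1 k) = dd_chain a.+1 k f * gen_stair a k.
Proof.
elim: k a f => [|k IH] a f akn Sf //=.
have an : (a.+1 < n)%N by lia.
have akn' : (a.+2 + k <= n)%N by lia.
rewrite mulrA dd_invr ?sg_gen_stair //; [|lia..].
rewrite ddM // mulrDl dd_chainD //.
have -> : dd_chain a.+2 k (S a.+1 f * D a.+1 (H k).[x a.+1] * gen_stair a.+2 k) =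
          dd_chain a.+2 k ((S a.+1 f - f + f) * D a.+1 (H k).[x a.+1] * gen_stair a.+2 k).
  by rewrite subrK.
have -> : S a.+1 f - f = - (D a.+1 f * (x a - x a.+1)) by rewrite -opprB -ddE.
set q := D a.+1 (H k).[x a.+1].
have eq_q : q * (x a - x a.+1) = (H k).[x a.+1] - (H k).[x a].
  by rewrite ddE // sg_H // sgxr.
have zero : dd_chain a.+2 k (f * q * gen_stair a.+2 k) = 0.
  rewrite -mulrA dd_chain_invl //; last by move=> i ai; apply: Sf; lia.
  suff -> : dd_chain a.+2 k (q * gen_stair a.+2 k) = 0 by rewrite mulr0.
  rewrite /q H_expand dd_sum // mulr_suml dd_chain_sum // big1 // => j _.
  rewrite dd_invl ?H_coef_inv // -mulrA dd_chain_invl //; last first.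
    by move=> i ai; rewrite H_coef_inv //; lia.
  have := dd_monomial_le 0 j an; rewrite expr0 mul1r add0n => ->.
  rewrite mulNr dd_chainN // mulr_suml dd_chain_sum // big1 ?oppr0 ?mulr0 // => i _.
  rewrite -mulrA dd_chain_invl //; last by case=> // l al; rewrite rmorphXn sgx //; lia.
  by rewrite dd_chain_low ?mulr0 //; have := ltn_ord i; have := ltn_ord j; lia.
rewrite -dd_chainD // -[RHS]addr0 -zero.
have -> : dd_chain a.+2 k (D a.+1 f) * ((H k).[x a] * gen_stair a.+1 k) =
          dd_chain a.+2 k ((H k).[x a] * D a.+1 f * gen_stair a.+2 k).
  rewrite -mulrA dd_chain_invl //; last first.
    by case=> // i ai; rewrite sg_H ?sgx //; lia.
  rewrite IH; [by rewrite mulrCA | lia |].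
  move=> i ai; have [|_ ->] := @sg_dd_far n R d a.+1 i f; first lia.
  by rewrite Sf //; lia.
rewrite -dd_chainD //; congr (dd_chain _ _ _); rewrite -!mulrDl; congr (_ * _).
transitivity (D a.+1 f * (H k).[x a.+1] - D a.+1 f * (q * (x a - x a.+1)) + f * q); first by ring.
by rewrite eq_q; ring.
Qed.

End Staircase.

Lemma dd_chain_pow a k b : (a + k < n)%N -> (b < k)%N -> dd_chain a.+1 k (x a ^+ b) = 0.
Proof.
move=> akn bk; have := @dd_chain_low (fun=> 1) _ _ a k b akn bk.
have -> : gen_stair (fun=> 1) a.+1 k = 1.
  by elim: k (a.+1) {akn bk} => //= k IH a'; rewrite IH hornerC mulr1.
by rewrite mulr1; apply=> *; rewrite ?size_poly1 ?rmorph1.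
Qed.

Lemma dd_chain_poly a k (q : {poly R}) : (a + k < n)%N -> (size q <= k)%N ->
  (forall i, (i < n)%N -> map_poly (S i) q = q) -> dd_chain a.+1 k q.[x a] = 0.
Proof.
move=> akn sq Sq; rewrite (horner_coef_wide _ sq) dd_chain_sum; last lia.
apply: big1 => i _; rewrite dd_chain_invl; [by rewrite dd_chain_pow ?mulr0 | lia |].
by move=> j aj; rewrite -{2}(Sq j) ?coef_map //; lia.
Qed.

Lemma dd_chain_prodD a k c : (a + k < n)%N -> (forall i, (i < n)%N -> S i c = c) ->
  dd_chain a.+1 k (\prod_(i < k) (x (a.+1 + i)%N + c)) = (-1) ^+ k.
Proof.
move=> akn Sc; elim: k a akn => [|k IH] a akn /=; first by rewrite big_ord0.
rewrite big_ord_recl /= addn0 dd_invr; [|lia|]; last first.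
  rewrite rmorph_prod; apply: eq_bigr => i _; have := ltn_ord i => ik.
  by rewrite /bump /= rmorphD Sc; [rewrite sgx //; lia | lia].
rewrite ddD ?dd_xr ?(dd_inv _ (Sc _ _)); [|lia..].
rewrite addr0 mulN1r dd_chainN; last lia.
rewrite exprS mulN1r -(IH a.+1); last lia.
by congr (- dd_chain _ _ _); apply: eq_bigr => i _; rewrite /bump /= addnS.
Qed.

End Chains.

(** * Elementary symmetric polynomials and the length filtration *)

Lemma prod_swap_adjacent (R : comNzRingType) (F G : nat -> R) m i : (i.+1 < m)%N ->
  G i = F i.+1 -> G i.+1 = F i ->
  (forall l, (l < m)%N -> l != i -> l != i.+1 -> G l = F l) ->
  \prod_(l < m) G l = \prod_(l < m) F l.
Proof.
move=> im Gi Gi1 GF.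
have split_prod (K : nat -> R) : \prod_(l < m) K l =
    \prod_(0 <= l < i) K l * (K i * K i.+1 * \prod_(i.+2 <= l < m) K l).
  rewrite -(big_mkord xpredT K) (big_cat_nat (n := i)) //=; last lia.
  by rewrite [\prod_(i <= l < m) _]big_ltn; [rewrite (@big_ltn _ _ _ i.+1) ?mulrA | lia].
rewrite !split_prod Gi Gi1 [F i.+1 * _]mulrC; congr (_ * (_ * _)).
  by rewrite !big_nat; apply: eq_bigr => l li; apply: GF; lia.
by rewrite !big_nat; apply: eq_bigr => l li; apply: GF; lia.
Qed.

Section Elementary.
Variables (n : nat) (R : idomainType) (d : dd_system n R).
Implicit Types (f g h c : R) (i j k m a r : nat) (s : seq nat).
Local Notation x := (xv d).
Local Notation y := (yv d).
Local Notation S := (sg d).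
Local Notation D := (dd d).
Local Notation dd_chain := (dd_chain d).

Definition epoly m : {poly R} := \prod_(i < m) (1 + (x i)%:P * 'X).

(** These are the elementary symmetric polynomials of the first m variables. *)
Definition e m k : R := (epoly m)`_k.

Lemma coefDMX (q : {poly R}) c k :
  ((1 + c%:P * 'X) * q)`_k = q`_k + c * (if k is k'.+1 then q`_k' else 0).
Proof. by rewrite mulrDl mul1r -mulrA coefD coefCM coefXM; case: k. Qed.

Lemma e_0 m : e m 0 = 1.
Proof.
rewrite /e /epoly; elim: m => [|m IH]; first by rewrite big_ord0 coef1.
by rewrite big_ord_recr /= mulrC coefDMX mulr0 addr0.
Qed.

Lemma e_recr m k : e m.+1 k.+1 = e m k.+1 + x m * e m k.
Proof. by rewrite /e /epoly big_ord_recr /= mulrC coefDMX. Qed.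

Lemma size_epoly m : (size (epoly m) <= m.+1)%N.
Proof.
apply: leq_trans (size_prod_leq _ _) _ => /=; rewrite card_ord.
rewrite leq_subLR; apply: (@leq_trans (2 * m).+1); last lia.
rewrite ltnS.
apply: leq_trans (_ : \sum_(i < m) 2 <= _)%N; last by rewrite sum_nat_const card_ord mulnC.
apply: leq_sum => i _; rewrite addrC -polyC1 size_MXaddC.
by case: ifP => // _; rewrite ltnS size_polyC leq_b1.
Qed.

Lemma e_big m k : (m < k)%N -> e m k = 0.
Proof. by move=> mk; rewrite /e nth_default //; apply: leq_trans (size_epoly m) mk. Qed.

Lemma e_mm m : e m m = \prod_(i < m) x i.
Proof.
elim: m => [|m IH]; first by rewrite e_0 big_ord0.
by rewrite e_recr e_big // add0r IH big_ord_recr mulrC.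
Qed.

Lemma sg_epoly_sym i m : (0 < i < m)%N -> (m <= n)%N -> map_poly (S i) (epoly m) = epoly m.
Proof.
case: i => // i im mn; rewrite /epoly rmorph_prod /=.
apply: (@prod_swap_adjacent _ (fun l => 1 + (x l)%:P * 'X)
  (fun l => map_poly (S i.+1) (1 + (x l)%:P * 'X)) m i) => // [||l lm li li1];
  rewrite rmorphD rmorph1 rmorphM /= map_polyX map_polyC /=.
- by rewrite sgxl //; lia.
- by rewrite sgxr //; lia.
- by rewrite sgx //; lia.
Qed.

Lemma sg_e_sym i m k : (0 < i < m)%N -> (m <= n)%N -> S i (e m k) = e m k.
Proof. by move=> im mn; rewrite /e -{2}(sg_epoly_sym im mn) coef_map. Qed.

Definition epoly' m : {poly R} := \prod_(i < m) (1 + (x i.+1)%:P * 'X).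

Lemma sg0_epoly' m : (m < n)%N -> map_poly (S 0) (epoly' m) = epoly' m.
Proof.
move=> mn; rewrite /epoly' rmorph_prod; apply: eq_bigr => i _.
rewrite rmorphD rmorph1 rmorphM /= map_polyX map_polyC /= sg0x //.
by have := ltn_ord i; lia.
Qed.

Lemma epoly_recl m : epoly m.+1 = (1 + (x 0)%:P * 'X) * epoly' m.
Proof. by rewrite /epoly big_ord_recl. Qed.

(** In terms of the elementary symmetric polynomials e'_k of the variables other than
    x_0, this is x_0^2 e'_(k-1) - e'_(k+1). *)
Lemma sg0_e_comb m k : (m < n)%N ->
  S 0 (x 0 * e m.+1 k - e m.+1 k.+1) = x 0 * e m.+1 k - e m.+1 k.+1.
Proof.
move=> mn; pose e' k := (epoly' m)`_k.
have Se' l : S 0 (e' l) = e' l by rewrite /e' -{2}(sg0_epoly' mn) coef_map.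
have -> : x 0 * e m.+1 k - e m.+1 k.+1 =
    (x 0) ^+ 2 * (if k is k'.+1 then e' k' else 0) - e' k.+1.
  rewrite /e epoly_recl !coefDMX /e'; case: k => [|k].
    by move: (_`_1) (_`_0) => u v; ring.
  by move: (_`_k.+2) (_`_k.+1) (_`_k) => u v w; ring.
rewrite rmorphB rmorphM rmorphXn Se' sg0x0 ?sqrrN; last lia.
by case: k => [|k]; rewrite ?rmorph0 ?Se'.
Qed.

Definition inv_under m c := forall i, (i < m)%N -> S i c = c.

Lemma inv_under0 m : inv_under m 0. Proof. by move=> i _; rewrite rmorph0. Qed.
Lemma inv_under1 m : inv_under m 1. Proof. by move=> i _; rewrite rmorph1. Qed.
Lemma inv_underN m c : inv_under m c -> inv_under m (- c).
Proof. by move=> cm i im; rewrite rmorphN cm. Qed.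
Lemma inv_underM m c c' : inv_under m c -> inv_under m c' -> inv_under m (c * c').
Proof. by move=> cm cm' i im; rewrite rmorphM cm ?cm'. Qed.
Lemma inv_underX m c k : inv_under m c -> inv_under m (c ^+ k).
Proof. by move=> cm i im; rewrite rmorphXn cm. Qed.
Lemma inv_under_y m j : (m <= n)%N -> inv_under m (y j).
Proof. by move=> mn i im; rewrite sgy //; lia. Qed.

(** The filtration by the length of products of the e_k, over the ring of invariants
    of the hyperoctahedral group of the first m variables. *)
Inductive lenlt m r : R -> Prop :=
| Lenlt0 : lenlt m r 0
| LenltD f g : lenlt m r f -> lenlt m r g -> lenlt m r (f + g)
| LenltM c s : inv_under m c -> (size s < r)%N -> lenlt m r (c * \prod_(k <- s) e m k).

Lemma lenlt_prod m r s : (size s < r)%N -> lenlt m r (\prod_(k <- s) e m k).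
Proof. by move=> sr; rewrite -[X in lenlt _ _ X]mul1r; apply: LenltM => //; apply: inv_under1. Qed.

Lemma lenlt_sub m r r' f : (r <= r')%N -> lenlt m r f -> lenlt m r' f.
Proof.
move=> rr'; elim=> [|g h _ IHg _ IHh|c s mc sr]; [exact: Lenlt0 | exact: LenltD |].
by apply: LenltM => //; apply: leq_trans rr'.
Qed.

Lemma lenlt_invM m r c f : inv_under m c -> lenlt m r f -> lenlt m r (c * f).
Proof.
move=> cm; elim=> [|g h _ IHg _ IHh|c' s mc sr]; first by rewrite mulr0; apply: Lenlt0.
  by rewrite mulrDr; apply: LenltD.
by rewrite mulrA; apply: LenltM => //; apply: inv_underM.
Qed.

Lemma lenltN m r f : lenlt m r f -> lenlt m r (- f).
Proof. by rewrite -mulN1r; apply: lenlt_invM; apply/inv_underN/inv_under1. Qed.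

Lemma lenltB m r f g : lenlt m r f -> lenlt m r g -> lenlt m r (f - g).
Proof. by move=> fr gr; apply: LenltD => //; apply: lenltN. Qed.

Lemma lenlt_sum m r (I : Type) (t : seq I) (P : pred I) (F : I -> R) :
  (forall z, P z -> lenlt m r (F z)) -> lenlt m r (\sum_(z <- t | P z) F z).
Proof. by move=> H; apply: big_ind => //; [exact: Lenlt0 | exact: LenltD]. Qed.

Lemma lenltS m r k f : lenlt m r f -> lenlt m r.+1 (e m k * f).
Proof.
elim=> [|g h _ IHg _ IHh|c s mc sr]; first by rewrite mulr0; apply: Lenlt0.
  by rewrite mulrDr; apply: LenltD.
rewrite mulrCA -(big_cons _ _ k s xpredT (e m)).
exact: LenltM.
Qed.

Lemma lenlt_prodM m r s f : lenlt m r f -> lenlt m (size s + r) (\prod_(k <- s) e m k * f).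
Proof.
move=> fr; elim: s => [|k s IH]; first by rewrite big_nil mul1r.
by rewrite big_cons -mulrA; apply: lenltS.
Qed.

Lemma lenlt_0 m f : lenlt m 0 f -> f = 0.
Proof. by elim=> // g h _ -> _ ->; rewrite addr0. Qed.

(** The e_k in m + 1 variables are combinations of those in m variables with the
    coefficients 1 and x_m, which the smaller group leaves invariant. *)
Lemma lenlt_down m r f : (m < n)%N -> lenlt m.+1 r f -> lenlt m r f.
Proof.
move=> mn; elim=> [|g h _ IHg _ IHh|c s mc sr]; [exact: Lenlt0 | exact: LenltD |].
apply: lenlt_invM; first by move=> i im; apply: mc; lia.
apply: (@lenlt_sub _ (size s).+1) => //; elim: s {sr} => [|k s IH] /=.
  by have := @lenlt_prod m 1 [::] isT; rewrite !big_nil.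
rewrite big_cons; case: k => [|k].
  by rewrite e_0 mul1r; apply: lenlt_sub IH.
rewrite e_recr mulrDl; apply: LenltD; first exact: lenltS.
rewrite -mulrA; apply: lenlt_invM; last exact: lenltS.
case=> [|i] im; [rewrite sg0x | rewrite sgx] => //; lia.
Qed.

Lemma lenlt_sym m r f i : (m <= n)%N -> lenlt m r f -> (0 < i < m)%N -> S i f = f.
Proof.
move=> mn fr im; elim: fr => [|g h _ IHg _ IHh|c s mc sr]; first by rewrite rmorph0.
  by rewrite rmorphD IHg IHh.
rewrite rmorphM mc; [|lia]; congr (_ * _).
by rewrite rmorph_prod; apply: eq_bigr => k _; rewrite sg_e_sym.
Qed.

(** For j <= m this maps e_(j+1) to (-1)^m and the other e_k to 0; up to sign it
    removes a part j + 1. *)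
Definition rmpart m j f : R := dd_chain 0 m.+1 (x 0 ^+ (m - j) * f).

(** The combination x_0 e_k - e_(k+1) is invariant under the sign change of x_0, and
    the other operators of the chain commute with the e_k and with f. *)
Lemma rmpart_e m j k f : (j < m < n)%N -> (forall i, (0 < i <= m)%N -> S i f = f) ->
  rmpart m j (e m.+1 k * f) + e m.+1 k * rmpart m j f =
  rmpart m j.+1 (e m.+1 k.+1 * f) - e m.+1 k.+1 * rmpart m j.+1 f.
Proof.
move=> jm Sf; rewrite /rmpart /=; have n0 : (0 < n)%N by lia.
have -> : (m - j = (m - j.+1).+1)%N by lia.
set b := (m - j.+1)%N; set ek := e m.+1 k; set ek1 := e m.+1 k.+1.
pose g := x 0 ^+ b * f.
have x0D : x 0 * D 0 g = g - D 0 (x 0 * g).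
  by rewrite ddM // dd0_x0 // mul1r sg0x0 //; ring.
have E : D 0 ((x 0 * ek - ek1) * g) = ek * g - ek * D 0 (x 0 * g) - ek1 * D 0 g.
  rewrite dd_invl //; last by apply: sg0_e_comb; lia.
  by rewrite mulrBl [x 0 * ek]mulrC -mulrA x0D; ring.
have dd_chain_e l u : dd_chain 1 m (e m.+1 l * u) = e m.+1 l * dd_chain 1 m u.
  by rewrite dd_chain_invl //; [lia | move=> i im; apply: sg_e_sym; lia].
have dd_chain_g : dd_chain 1 m g = 0.
  rewrite /g mulrC dd_chain_invl; [|lia|by move=> i im; apply: Sf; lia].
  by rewrite dd_chain_pow ?mulr0 //; rewrite /b; lia.
have := congr1 (dd_chain 1 m) E.
rewrite !dd_chainD ?dd_chainN ?dd_chain_e ?dd_chain_g; [|lia..].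
rewrite mulrBl ddB // dd_chainD ?dd_chainN; [|lia..].
have -> : x 0 * ek * g = x 0 ^+ b.+1 * (ek * f) by rewrite /g exprS; ring.
have -> : ek1 * g = x 0 ^+ b * (ek1 * f) by rewrite /g; ring.
have -> : x 0 * g = x 0 ^+ b.+1 * f by rewrite /g exprS; ring.
rewrite /g mulr0 sub0r => H.
have rearrange (u v p q : R) : u - v = - p - q -> u + p = v - q.
  by move=> uv; rewrite -[u](subrK v) uv; ring.
exact: rearrange.
Qed.

Lemma rmpart_top m f : (m < n)%N -> (forall i, (0 < i <= m)%N -> S i f = f) ->
  rmpart m m (e m.+1 m.+1 * f) = (-1) ^+ m * f - e m.+1 m.+1 * rmpart m m f.
Proof.
move=> mn Sf; rewrite /rmpart /= subnn expr0 !mul1r; have n0 : (0 < n)%N by lia.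
set q := \prod_(i < m) x (1 + i)%N.
have em : e m.+1 m.+1 = x 0 * q by rewrite e_mm big_ord_recl.
have Sq : S 0 q = q.
  rewrite /q rmorph_prod; apply: eq_bigr => i _; rewrite sg0x //.
  by have := ltn_ord i; lia.
have -> : D 0 (e m.+1 m.+1 * f) = q * f - e m.+1 m.+1 * D 0 f.
  rewrite em [x 0 * q]mulrC -mulrA dd_invl // ddM // dd0_x0 // sg0x0 //; ring.
rewrite dd_chainD ?dd_chainN; [|lia..]; congr (_ - _); last first.
  by rewrite dd_chain_invl //; move=> i im; apply: sg_e_sym; lia.
rewrite dd_chain_invr; [|lia|by move=> i im; apply: Sf; lia].
congr (_ * _); rewrite -(@dd_chain_prodD n R d 0 m 0); [|lia|by move=> i _; rewrite rmorph0].
by congr (dd_chain _ _ _); apply: eq_bigr => i _; rewrite addr0.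
Qed.

(** Removing a part shortens the products of the e_k.  The relation [rmpart_e]
    allows to raise or lower j and k simultaneously, which ends in one of the
    cases k = 0, k > m + 1, or j = m, k = m + 1. *)
Lemma lenlt_rmpart m j s : (j <= m < n)%N ->
  lenlt m.+1 (size s) (rmpart m j (\prod_(k <- s) e m.+1 k)).
Proof.
elim: s j => [|k s IH] j jm /=.
  rewrite big_nil /rmpart mulr1 /=.
  suff -> : dd_chain 1 m (D 0 (x 0 ^+ (m - j))) = 0 by apply: Lenlt0.
  case E : (m - j)%N => [|b]; first by rewrite expr0 dd1 ?dd_chain0 //; lia.
  have n0 : (0 < n)%N by lia.
  have [c cb ->] : exists2 c : R, inv_under n c & D 0 (x 0 ^+ b.+1) = c * x 0 ^+ b.
    have D2 l : D 0 (x 0 ^+ l.+2) = x 0 ^+ 2 * D 0 (x 0 ^+ l).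
      by rewrite -(addn2 l) addnC exprD dd_invl // rmorphXn sg0x0 // sqrrN.
    elim/ltn_ind: b {E} => -[|[|b]] IHb.
    - by exists 1; [exact: inv_under1 | rewrite expr1 dd0_x0 // mul1r].
    - by exists 0; [exact: inv_under0 | rewrite mul0r D2 expr0 dd1 // mulr0].
    have [c cb Ec] := IHb b (ltnW (ltnSn _)); exists c => //.
    by rewrite D2 Ec !exprS; ring.
  rewrite dd_chain_invl; [|lia|by move=> i im; apply: cb; lia].
  by rewrite dd_chain_pow ?mulr0 //; lia.
set f := \prod_(l <- s) e m.+1 l.
have Sf i : (0 < i <= m)%N -> S i f = f.
  move=> im; rewrite rmorph_prod; apply: eq_bigr => l _.
  by apply: sg_e_sym; lia.
rewrite big_cons -/f.
have small : lenlt m.+1 (size s).+1 f by apply: lenlt_prod.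
have shift j' k' : (j' < m)%N ->
    lenlt m.+1 (size s).+1 (rmpart m j' (e m.+1 k' * f)) <->
    lenlt m.+1 (size s).+1 (rmpart m j'.+1 (e m.+1 k'.+1 * f)).
  move=> j'm; have E := @rmpart_e m j' k' f; rewrite j'm in E.
  have {}E := E _ Sf; move/andP: jm => [_ mn]; have {}E := E mn.
  have l1 : lenlt m.+1 (size s).+1 (e m.+1 k' * rmpart m j' f).
    by apply/lenltS/IH; lia.
  have l2 : lenlt m.+1 (size s).+1 (e m.+1 k'.+1 * rmpart m j'.+1 f).
    by apply/lenltS/IH; lia.
  split=> H.
    by rewrite -[X in lenlt _ _ X](subrK (e m.+1 k'.+1 * rmpart m j'.+1 f)) -E;
      apply: LenltD => //; apply: LenltD.
  by rewrite -[X in lenlt _ _ X](addrK (e m.+1 k' * rmpart m j' f)) E;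
    apply: lenltB => //; apply: lenltB.
have [kj|jk] := leqP k j.
  elim: k j jm kj => [|k IHk] j jm kj.
    by rewrite e_0 mul1r; apply: lenlt_sub (IH j jm).
  case: j jm kj => // j jm kj; have jm' : (j < m)%N by lia.
  by apply/(shift j k jm')/IHk; lia.
have [i ij] : exists i, (j + i = m)%N by exists (m - j)%N; lia.
elim: i j k jm jk ij => [|i IHi] j k jm jk ij; last first.
  have jm' : (j < m)%N by lia.
  by apply/(shift j k jm')/IHi; lia.
have {ij} ij : j = m by lia.
rewrite {}ij in jk jm *.
have [km|mk] := leqP k m.+1; last first.
  by rewrite e_big // mul0r /rmpart mulr0 dd_chain0; [exact: Lenlt0 | lia].
have -> : k = m.+1 by lia.
rewrite rmpart_top //; last lia.
apply: lenltB; last by apply/lenltS/IH; lia.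
by apply: lenlt_invM => //; apply/inv_underX/inv_underN/inv_under1.
Qed.

End Elementary.

(** * The operator of the longest Grassmannian element *)

Section Grassmannian.
Variables (n : nat) (R : idomainType) (d : dd_system n R).
Implicit Types (f g h c z : R) (i j k m a r : nat) (s : seq nat).
Local Notation x := (xv d).
Local Notation y := (yv d).
Local Notation S := (sg d).
Local Notation D := (dd d).
Local Notation dd_chain := (dd_chain d).
Local Notation e := (e d).
Local Notation lenlt := (lenlt d).
Local Notation inv_under := (inv_under d).

Definition rootsY m : {poly R} := \prod_(j < m) ('X - (y j)%:P).

Lemma size_rootsY m : size (rootsY m) = m.+1.
Proof. by rewrite /rootsY size_prod_XsubC /index_enum -enumT size_enum_ord. Qed.

Lemma rootsY_inv i m : (i < n)%N -> map_poly (S i) (rootsY m) = rootsY m.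
Proof.
move=> i_n; rewrite rmorph_prod; apply: eq_bigr => j _.
by rewrite rmorphB /= map_polyX map_polyC /= sgy.
Qed.

Lemma rootsY_eval m t : (rootsY m).[t] = \prod_(j < m) (t - y j).
Proof. by rewrite horner_prod; apply: eq_bigr => j _; rewrite hornerXsubC. Qed.

Definition stair a k : R := gen_stair d rootsY a k.

(** For m = n, the divided difference of (-n, ..., -1), which is the longest of the
    minimal representatives of the cosets of the symmetric group. *)
Fixpoint ddG m f : R := if m is m'.+1 then ddG m' (dd_chain 0 m'.+1 f) else f.

Lemma ddGD m f g : (m <= n)%N -> ddG m (f + g) = ddG m f + ddG m g.
Proof. by elim: m f g => [|m IH] f g mn //=; rewrite ddD ?dd_chainD ?IH //; lia. Qed.

Lemma ddG0 m : (m <= n)%N -> ddG m 0 = 0.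
Proof. by elim: m => [|m IH] mn //=; rewrite dd0 ?dd_chain0 ?IH //; lia. Qed.

Lemma ddG_invl m c f : (m <= n)%N -> inv_under m c -> ddG m (c * f) = c * ddG m f.
Proof.
elim: m f => [|m IH] f mn cm //; rewrite [ddG _ _]/ddG -/ddG dd_chain_invl.
- by apply: IH; [lia | move=> i im; apply: cm; lia].
- by lia.
by move=> i im; apply: cm; lia.
Qed.

(** The effect on the cofactor f of the staircase, by [ddG_stair]. *)
Definition Lop m f : R := dd_chain 0 m.+1 ((rootsY m).[x 0] * f).

(** The expansion of the product of the x_0 - y_j in powers of x_0 makes this a
    combination of the operators [rmpart]. *)
Lemma lenlt_Lop m r f : (m < n)%N -> lenlt m.+1 r.+1 f -> lenlt m.+1 r (Lop m f).
Proof.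
move=> mn; rewrite /Lop; elim=> [|g h _ IHg _ IHh|c s mc sr].
- by rewrite mulr0 dd_chain0; [exact: Lenlt0 | lia].
- by rewrite mulrDr dd_chainD; [exact: LenltD | lia].
rewrite mulrCA dd_chain_invl; [|lia|by move=> i im; apply: mc; lia].
apply: lenlt_invM => //; rewrite (@horner_coef_wide _ m.+1); last by rewrite size_rootsY.
rewrite mulr_suml dd_chain_sum; last lia.
apply: lenlt_sum => j _; rewrite -mulrA dd_chain_invl; [|lia|]; last first.
  by move=> i im; rewrite -{2}(@rootsY_inv i m) ?coef_map //; lia.
apply: lenlt_invM.
  by move=> i im; rewrite -{2}(@rootsY_inv i m) ?coef_map //; lia.
have jm : (m - (m - j) = j)%N by have := ltn_ord j; lia.
have := @lenlt_rmpart n R d m (m - j) s; rewrite /rmpart jm leq_subr mn => /(_ isT).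
by apply: lenlt_sub.
Qed.

Lemma ddG_stair m f : (m < n)%N -> (forall i, (0 < i <= m)%N -> S i f = f) ->
  ddG m.+1 (stair 0 m.+1 * f) = ddG m (stair 0 m * Lop m f).
Proof.
move=> mn Sf; rewrite /Lop /stair /=; congr (ddG _ _).
have n0 : (0 < n)%N by lia.
rewrite mulrAC dd_invr ?sg0_gen_stair //; [|exact: rootsY_inv].
rewrite dd_chain_shift //.
- by rewrite mulrC.
- by move=> k; rewrite size_rootsY.
- by move=> i k; apply: rootsY_inv.
move=> i im; have [|E _] := @sg_dd_far n R d 0 i ((rootsY m).[x 0] * f); first lia.
have [|_ ->] := @sg_dd_far n R d 0 i ((rootsY m).[x 0] * f); first lia.
rewrite rmorphM (sg_H (H := rootsY)) //; [|by move=> *; apply: rootsY_inv|lia].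
rewrite Sf; last lia.
by case: i im {E} => // i im; rewrite sgx //; lia.
Qed.

(** Each of the m chains shortens the products by one; after r of them, products of
    fewer than 0 factors would be left, that is, none. *)
Lemma ddG_short m r f : (r <= m <= n)%N -> lenlt m r f -> ddG m (stair 0 m * f) = 0.
Proof.
elim: m r f => [|m IH] r f rm fr.
  have r0 : r = 0%N by lia.
  by rewrite (@lenlt_0 _ _ d 0 f) ?mulr0 //; rewrite r0 in fr.
case: r rm fr => [|r] rm fr; first by rewrite (lenlt_0 fr) mulr0 ddG0 //; lia.
rewrite ddG_stair; [|lia|]; last by move=> i im; apply: (lenlt_sym _ fr); lia.
apply: (IH r); first lia.
by apply: lenlt_down; [lia | apply: lenlt_Lop => //; lia].
Qed.

Definition evalE m z : R := \prod_(i < m) (x i + z).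

Lemma evalE_recr m z : evalE m.+1 z = evalE m z * (x m + z).
Proof. by rewrite /evalE big_ord_recr. Qed.

Lemma evalE_e m z : evalE m z = \sum_(k < m.+1) z ^+ (m - k) * e m k.
Proof.
elim: m => [|m IH]; first by rewrite /evalE big_ord0 big_ord1 e_0 mulr1.
have zE : z * evalE m z = z ^+ m.+1 + \sum_(k < m.+1) z ^+ (m - k) * e m k.+1.
  rewrite [RHS](_ : _ = \sum_(k < m.+2) z ^+ (m.+1 - k) * e m k); last first.
    by rewrite [RHS]big_ord_recl /= subn0 e_0 mulr1.
  rewrite big_ord_recr /= e_big // mulr0 addr0 IH mulr_sumr; apply: eq_bigr => k _.
  by rewrite mulrA -exprS subSn // -ltnS.
rewrite evalE_recr [RHS]big_ord_recl /= subn0 e_0 mulr1.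
rewrite (eq_bigr (fun k : 'I_m.+1 => z ^+ (m - k) * e m k.+1 + x m * (z ^+ (m - k) * e m k))).
  by rewrite big_split /= addrA -zE -mulr_sumr -IH; ring.
by move=> k _; rewrite /bump /= e_recr subSS; ring.
Qed.

Lemma lenlt_evalE m r z f : inv_under m z -> lenlt m r f -> lenlt m r.+1 (evalE m z * f).
Proof.
move=> mz fr; rewrite evalE_e mulr_suml; apply: lenlt_sum => k _.
by rewrite -mulrA; apply: lenlt_invM; [exact: inv_underX | exact: lenltS].
Qed.

Lemma lenlt_prod_evalE m r (zs : seq R) f : (forall z, z \in zs -> inv_under m z) ->
  lenlt m r f -> lenlt m (size zs + r) (\prod_(z <- zs) evalE m z * f).
Proof.
elim: zs => [|z zs IH] mz fr; first by rewrite big_nil mul1r.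
rewrite big_cons -mulrA; apply: lenlt_evalE; first by apply: mz; rewrite mem_head.
by apply: IH => // z' zs'; apply: mz; rewrite in_cons zs' orbT.
Qed.

Lemma sg_evalE i m z : (0 < i < m)%N -> (m <= n)%N -> inv_under m z -> S i (evalE m z) = evalE m z.
Proof.
move=> im mn mz; apply: (lenlt_sym (m := m) (r := 2)) => //.
rewrite -[evalE m z]mulr1; apply: lenlt_evalE => //.
by have := @lenlt_prod n R d m 1 [::] isT; rewrite big_nil.
Qed.

(** As the roots y_j of the staircase are among the parameters of the test function,
    the factors x_0 - y_j and x_0 + y_j combine to even functions of x_0, and the
    operator of index 0 only sees the factor x_0 + y_m.  The remaining operators
    see the product of the x_0 - y_j only through its value at x_0 = - y_m: the
    difference is divisible by x_0 + y_m, which completes a symmetric function and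
    leaves a quotient of too low degree. *)
Lemma Lop_test m : (m < n)%N ->
  Lop m (\prod_(a < m.+1) evalE m.+1 (y a)) =
  (\prod_(j < m) (y m + y j)) * \prod_(a < m) evalE m.+1 (y a).
Proof.
move=> mn; rewrite /Lop /=; have n0 : (0 < n)%N by lia.
pose E' z := \prod_(i < m) (x (1 + i)%N + z).
have EE' z : evalE m.+1 z = (x 0 + z) * E' z by rewrite /evalE big_ord_recl.
have SE' z : inv_under 1 z -> S 0 (E' z) = E' z.
  move=> Sz; rewrite rmorph_prod; apply: eq_bigr => i _.
  by rewrite rmorphD Sz // sg0x //; have := ltn_ord i; lia.
have y1 j : inv_under 1 (y j) by apply: inv_under_y.
have -> : (rootsY m).[x 0] * (\prod_(a < m.+1) evalE m.+1 (y a)) =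
    (\prod_(a < m) ((x 0 ^+ 2 - y a ^+ 2) * E' (y a))) * E' (y m) * (x 0 + y m).
  rewrite big_ord_recr /= EE' [_ * E' (y m)]mulrC !mulrA; congr (_ * _ * _).
  rewrite rootsY_eval -big_split /=; apply: eq_bigr => a _.
  by rewrite EE'; ring.
rewrite dd_invl //; last first.
  rewrite rmorphM SE' //; congr (_ * _); rewrite rmorph_prod.
  by apply: eq_bigr => a _; rewrite rmorphM SE' // rmorphB !rmorphXn sg0x0 // sqrrN sgy.
rewrite ddD // dd0_x0 // (dd_inv _ (sgy d _ n0)) // addr0 mulr1.
have -> : (\prod_(a < m) ((x 0 ^+ 2 - y a ^+ 2) * E' (y a))) * E' (y m) =
    (\prod_(a < m) evalE m.+1 (y a)) * ((rootsY m).[x 0] * E' (y m)).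
  rewrite mulrA; congr (_ * _); rewrite rootsY_eval -big_split /=; apply: eq_bigr => a _.
  by rewrite EE'; ring.
rewrite dd_chain_invl; [|lia|]; last first.
  move=> i im; rewrite rmorph_prod; apply: eq_bigr => a _.
  by apply: sg_evalE => //; apply: inv_under_y.
rewrite mulrC; congr (_ * _).
have /factor_theorem[q Eq] : root (rootsY m - (rootsY m).[- y m]%:P) (- y m).
  by apply/rootP; rewrite hornerD hornerN hornerC subrr.
have ym i : (i < n)%N -> S i (- y m) = - y m by move=> i_n; rewrite rmorphN sgy.
have ev : (rootsY m).[x 0] * E' (y m) = (rootsY m).[- y m] * E' (y m) + evalE m.+1 (y m) * q.[x 0].
  have := congr1 (horner^~ (x 0)) Eq; rewrite hornerD hornerN hornerC hornerM hornerXsubC.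
  by rewrite opprK EE' => Eq'; rewrite -[(rootsY m).[x 0]](subrK (rootsY m).[- y m]) Eq'; ring.
have cst i : (i < n)%N -> S i (rootsY m).[- y m] = (rootsY m).[- y m].
  by move=> i_n; rewrite -horner_map rootsY_inv // rmorphN sgy.
rewrite ev dd_chainD; last lia.
rewrite (dd_chain_invl (c := (rootsY m).[- y m])); [|lia|by move=> i im; apply: cst; lia].
rewrite dd_chain_invl; [|lia|]; last first.
  by move=> i im; apply: sg_evalE => //; apply: inv_under_y.
have -> : dd_chain 1 m q.[x 0] = 0.
  apply: dd_chain_poly => //; last first.
    move=> i i_n; apply: (@mulIf _ ('X - (- y m)%:P)); first by rewrite polyXsubC_eq0.
    have XE : map_poly (S i) ('X - (- y m)%:P) = 'X - (- y m)%:P.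
      by rewrite rmorphB /= map_polyX map_polyC /= ym.
    by rewrite -Eq -{1}XE -rmorphM -Eq rmorphB /= rootsY_inv // map_polyC /= cst.
  have [->|q0] := eqVneq q 0; first by rewrite size_poly0.
  have := size_Mmonic q0 (monicXsubC (- y m)); rewrite -Eq size_XsubC addn2 /= => sq.
  rewrite -ltnS -sq; apply: leq_trans (size_polyD _ _) _.
  rewrite size_polyN geq_max size_rootsY leqnn /=.
  by apply: leq_trans (size_polyC_leq1 _) _.
rewrite mulr0 addr0 (dd_chain_prodD (a := 0)) //; last by move=> i i_n; rewrite sgy.
rewrite rootsY_eval mulrC -{1}(card_ord m) -prodr_const -big_split /=.
by apply: eq_bigr => j _; ring.
Qed.

Lemma ddG_test m : (m <= n)%N ->
  ddG m (stair 0 m * \prod_(a < m) evalE m (y a)) =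
  \prod_(k < m) \prod_(j < k) ((y k + y j) * (x k + y j)).
Proof.
elim: m => [|m IH] mn; first by rewrite !big_ord0 mulr1.
have Sy i a : (0 < i <= m)%N -> S i (evalE m.+1 (y a)) = evalE m.+1 (y a).
  by move=> im; apply: sg_evalE => //; apply: inv_under_y.
rewrite ddG_stair //; last first.
  by move=> i im; rewrite rmorph_prod; apply: eq_bigr => a _; apply: Sy.
rewrite Lop_test //.
have -> : \prod_(a < m) evalE m.+1 (y a) =
    \prod_(a < m) evalE m (y a) * \prod_(a < m) (x m + y a).
  by rewrite -big_split; apply: eq_bigr => a _; rewrite evalE_recr.
set c1 := \prod_(j < m) (y m + y j); set c2 := \prod_(j < m) (x m + y j).
set f := \prod_(a < m) evalE m (y a).
have -> : stair 0 m * (c1 * (f * c2)) = c1 * c2 * (stair 0 m * f) by ring.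
rewrite ddG_invl; [|lia|]; last first.
  apply: inv_underM => i im; rewrite rmorph_prod; apply: eq_bigr => j _.
    by rewrite rmorphD !sgy //; lia.
  rewrite rmorphD sgy; [|lia]; congr (_ + _).
  by case: i im => [|i] im; [rewrite sg0x | rewrite sgx] => //; lia.
rewrite IH; last lia.
by rewrite [RHS]big_ord_recr /= mulrC big_split.
Qed.

End Grassmannian.

(** * The value on the product of the elementary symmetric polynomials *)

Section TopProduct.
Variables (n : nat) (R : idomainType) (d : dd_system n R).
Implicit Types (f g h c z : R) (i j k m a r : nat) (s : seq nat).
Local Notation x := (xv d).
Local Notation y := (yv d).
Local Notation S := (sg d).
Local Notation e := (e d).
Local Notation lenlt := (lenlt d).
Local Notation inv_under := (inv_under d).
Local Notation evalE := (evalE d).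

Definition ddG_Delta f : R := ddG d n (stair d 0 n * f).

Lemma ddG_DeltaD f g : ddG_Delta (f + g) = ddG_Delta f + ddG_Delta g.
Proof. by rewrite /ddG_Delta mulrDr ddGD. Qed.

Lemma ddG_Delta0 : ddG_Delta 0 = 0.
Proof. by rewrite /ddG_Delta mulr0 ddG0. Qed.

Lemma ddG_Delta_invl c f : inv_under n c -> ddG_Delta (c * f) = c * ddG_Delta f.
Proof. by move=> cn; rewrite /ddG_Delta mulrCA (ddG_invl _ _ cn). Qed.

Lemma ddG_Delta_signl k f : ddG_Delta ((-1) ^+ k * f) = (-1) ^+ k * ddG_Delta f.
Proof. by apply: ddG_Delta_invl; apply/inv_underX/inv_underN/inv_under1. Qed.

Lemma ddG_Delta_sum (I : Type) (r : seq I) (P : pred I) (F : I -> R) :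
  ddG_Delta (\sum_(i <- r | P i) F i) = \sum_(i <- r | P i) ddG_Delta (F i).
Proof. exact: (big_morph ddG_Delta ddG_DeltaD ddG_Delta0). Qed.

Lemma ddG_Delta_short r f : (r <= n)%N -> lenlt n r f -> ddG_Delta f = 0.
Proof. by move=> rn fr; apply: ddG_short fr; rewrite rn leqnn. Qed.

Definition epolyN m : {poly R} := \prod_(i < m) (1 + (- x i)%:P * 'X).

Lemma epolyN_coef m k : (epolyN m)`_k = (-1) ^+ k * e m k.
Proof.
rewrite /epolyN; elim: m k => [|m IH] k.
  rewrite big_ord0 coef1; case: k => [|k]; first by rewrite e_0 mulr1.
  by rewrite e_big ?mulr0.
rewrite big_ord_recr /= mulrC coefDMX IH; case: k => [|k].
  by rewrite !e_0 mulr0 addr0.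
by rewrite IH e_recr exprS; ring.
Qed.

(** The product of the generating functions of the e_k at T and at - T has the
    invariant coefficients of the product of the 1 - x_i^2 T^2. *)
Lemma e_quadratic m k : (m <= n)%N ->
  inv_under m (\sum_(j < k.+1) e m j * ((-1) ^+ (k - j) * e m (k - j))).
Proof.
move=> mn i im.
pose q : {poly R} := \prod_(l < m) (1 - (x l ^+ 2)%:P * 'X^2).
have Eq : epoly d m * epolyN m = q.
  rewrite /epoly /epolyN -big_split /=; apply: eq_bigr => l _.
  by rewrite polyCN rmorphXn /=; ring.
have Sq : map_poly (S i) q = q.
  rewrite /q rmorph_prod /=.
  have E l : map_poly (S i) (1 - (x l ^+ 2)%:P * 'X^2) = 1 - (S i (x l) ^+ 2)%:P * 'X^2.
    by rewrite rmorphB rmorph1 rmorphM /= map_polyXn map_polyC /= rmorphXn.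
  case: i im E => [|i] im E.
    apply: eq_bigr => l _; rewrite E; congr (1 - (_)%:P * _).
    have [->|l0] := posnP l; first by rewrite sg0x0 ?sqrrN //; lia.
    by rewrite sg0x //; have := ltn_ord l; lia.
  apply: (@prod_swap_adjacent _ (fun l => 1 - (x l ^+ 2)%:P * 'X^2)
    (fun l => map_poly (S i.+1) (1 - (x l ^+ 2)%:P * 'X^2)) m i) => // [||l lm li li1];
    rewrite E.
  - by rewrite sgxl //; lia.
  - by rewrite sgxr //; lia.
  - by rewrite sgx //; lia.
have -> : \sum_(j < k.+1) e m j * ((-1) ^+ (k - j) * e m (k - j)) = q`_k.
  by rewrite -Eq coefM; apply: eq_bigr => j _; rewrite epolyN_coef.
by rewrite -{2}Sq coef_map.
Qed.

Lemma ddG_Delta_square i f : lenlt n n f ->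
  (forall j, (j < i)%N -> ddG_Delta (e n j * (e n (i + i - j) * f)) = 0) ->
  ddG_Delta (e n i * (e n i * f)) = 0.
Proof.
move=> fn H; have E := ddG_Delta_invl f (@e_quadratic n (i + i) (leqnn n)).
rewrite (ddG_Delta_short (leqnn n) fn) mulr0 mulr_suml ddG_Delta_sum in E.
have i2 : (i < (i + i).+1)%N by lia.
rewrite (bigD1 (Ordinal i2)) //= big1 ?addr0 in E; last first.
  move=> j; rewrite -val_eqE /= => ji.
  have -> : e n j * ((-1) ^+ (i + i - j) * e n (i + i - j)) * f =
    (-1) ^+ (i + i - j) * (e n j * (e n (i + i - j) * f)) by ring.
  rewrite ddG_Delta_signl.
  suff -> : ddG_Delta (e n j * (e n (i + i - j) * f)) = 0 by rewrite mulr0.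
  have [jlt|jge] := ltnP j i; first exact: H.
  have ji' : (i + i - (i + i - j) = j)%N by have := ltn_ord j; lia.
  by rewrite mulrCA -{2}ji'; apply: H; lia.
have := E; rewrite addnK.
have -> : e n i * ((-1) ^+ i * e n i) * f = (-1) ^+ i * (e n i * (e n i * f)) by ring.
rewrite ddG_Delta_signl.
by move/eqP; rewrite mulf_eq0 expf_eq0 oppr_eq0 oner_eq0 andbF /= => /eqP.
Qed.

(** In this lemma and the next one, expanding the square of e_i by [e_quadratic]
    gives products in which a smaller, respectively larger, index is repeated. *)
Lemma ddG_Delta_low_run i r f : (0 < i)%N -> (i + r <= n)%N -> lenlt n r f ->
  ddG_Delta (e n i * (e n i * (\prod_(k <- iota 1 i.-1) e n k * f))) = 0.
Proof.
elim/ltn_ind: i r f => i IH r f i0 irn fr.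
have qr : lenlt n (i.-1 + r) (\prod_(k <- iota 1 i.-1) e n k * f).
  by have := lenlt_prodM (iota 1 i.-1) fr; rewrite size_iota.
apply: ddG_Delta_square => [|j ji]; first by apply: lenlt_sub qr; lia.
have [->|j0] := posnP j.
  rewrite e_0 mul1r; apply: (@ddG_Delta_short n) => //.
  by apply: lenlt_sub (lenltS _ qr); lia.
have -> : iota 1 i.-1 = iota 1 j.-1 ++ j :: iota j.+1 (i - j.+1).
  have -> : (i.-1 = j.-1 + (i - j.+1).+1)%N by lia.
  by rewrite iotaD /=; congr (_ ++ _); congr (_ :: _); [lia | congr (iota _ _); lia].
rewrite big_cat big_cons /=.
set u := \prod_(k <- _) _; set v := \prod_(k <- _) _.
have -> : e n j * (e n (i + i - j) * (u * (e n j * v) * f)) =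
   e n j * (e n j * (u * (v * (e n (i + i - j) * f)))) by ring.
apply: (IH j ji (i - j + r)%N) => //; first lia.
have := lenlt_prodM (iota j.+1 (i - j.+1)) (lenltS (i + i - j) fr).
by rewrite size_iota; apply: lenlt_sub; lia.
Qed.

Lemma ddG_Delta_high_run i r f : (i <= n)%N -> (r < i)%N -> lenlt n r f ->
  ddG_Delta (e n i * (e n i * (\prod_(k <- iota i.+1 (n - i)) e n k * f))) = 0.
Proof.
have [p] := ubnP (n - i); elim: p i r f => // p IH i r f ip i_n ri fr.
have qr : lenlt n (n - i + r) (\prod_(k <- iota i.+1 (n - i)) e n k * f).
  by have := lenlt_prodM (iota i.+1 (n - i)) fr; rewrite size_iota.
apply: ddG_Delta_square => [|j ji]; first by apply: lenlt_sub qr; lia.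
set b := (i + i - j)%N.
have [nb|bn] := ltnP n b; first by rewrite (e_big _ nb) mul0r mulr0 ddG_Delta0.
have -> : iota i.+1 (n - i) = iota i.+1 (b - i.+1) ++ b :: iota b.+1 (n - b).
  have -> : (n - i = b - i.+1 + (n - b).+1)%N by rewrite /b; lia.
  have e1 : (i.+1 + (b - i.+1) = b)%N by rewrite /b; lia.
  by rewrite iotaD /= e1.
rewrite big_cat big_cons /=.
set u := \prod_(k <- _) _; set v := \prod_(k <- _) _.
have -> : e n j * (e n b * (u * (e n b * v) * f)) =
   e n b * (e n b * (v * (u * (e n j * f)))) by ring.
apply: (IH b (b - i.+1 + r.+1)%N) => //; [rewrite /b; lia | rewrite /b; lia|].
have := lenlt_prodM (iota i.+1 (b - i.+1)) (lenltS j fr).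
by rewrite size_iota.
Qed.

(** As a polynomial in T, the value on e_1 ... e_k E(T) times the product of the
    E(z) has the roots - z, since E(z) E(- z) is invariant and the other factors
    are too few.  The coefficients of degree n - j with j <= k vanish by
    [ddG_Delta_low_run], as e_j is repeated, so that the leading coefficient and the
    roots determine the polynomial. *)
Lemma ddG_Delta_evalE_step k (zs : seq R) t : (size zs + k.+1 = n)%N ->
  uniq zs -> (forall z, z \in zs -> inv_under n z) -> inv_under n t ->
  ddG_Delta (\prod_(j <- iota 1 k) e n j * (evalE n t * \prod_(z <- zs) evalE n z)) =
  \prod_(z <- zs) (t + z) * ddG_Delta (\prod_(j <- iota 1 k.+1) e n j * \prod_(z <- zs) evalE n z).
Proof.
move=> sz uz Sz St.
set P := \prod_(j <- iota 1 k) e n j; set B := \prod_(z <- zs) evalE n z.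
pose u j := ddG_Delta (P * (e n j * B)).
have lB : lenlt n (size zs).+1 B.
  have := @lenlt_prod_evalE n R d n 1 zs 1 Sz; rewrite mulr1 addn1; apply.
  by have := @lenlt_prod n R d n 1 [::] isT; rewrite big_nil.
have u0 j : (j <= k)%N -> u j = 0.
  move=> jk; rewrite /u; have [->|j0] := posnP j.
    rewrite e_0 mul1r; apply: (@ddG_Delta_short n) => //.
    by have := lenlt_prodM (iota 1 k) lB; rewrite size_iota; apply: lenlt_sub; lia.
  have -> : P = \prod_(l <- iota 1 j.-1) e n l * (e n j * \prod_(l <- iota j.+1 (k - j)) e n l).
    rewrite /P; have -> : (k = j.-1 + (k - j).+1)%N by lia.
    rewrite iotaD big_cat /= big_cons; congr (_ * (e n _ * _)); first lia.
    by congr (\prod_(l <- iota _ _) _); lia.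
  set v := \prod_(l <- _) _; set w := \prod_(l <- _) _.
  have -> : v * (e n j * w) * (e n j * B) = e n j * (e n j * (v * (w * B))) by ring.
  apply: (@ddG_Delta_low_run j (k - j + (size zs).+1)) => //; first lia.
  by have := lenlt_prodM (iota j.+1 (k - j)) lB; rewrite size_iota.
(* E(T) = \sum_l e_(n - l) T^l, cut off where u vanishes *)
pose Q : {poly R} := \poly_(l < n - k) u (n - l)%N.
have QE z : inv_under n z -> Q.[z] = ddG_Delta (P * (evalE n z * B)).
  move=> nz; rewrite horner_poly evalE_e mulr_suml mulr_sumr ddG_Delta_sum.
  rewrite [RHS](reindex_inj rev_ord_inj) /=.
  rewrite [RHS](eq_bigr (fun l : 'I_n.+1 => u (n - l)%N * z ^+ l)); last first.
    move=> l _; have ln : (n - (n.+1 - l.+1) = l)%N by have := ltn_ord l; lia.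
    rewrite subSS ln -mulrA mulrCA ddG_Delta_invl; last exact: inv_underX.
    by rewrite mulrC.
  rewrite (big_ord_widen n.+1 (fun l => u (n - l)%N * z ^+ l)); last lia.
  rewrite big_mkcond; apply: eq_bigr => l _; case: ltnP => // kl.
  by rewrite u0 ?mul0r //; lia.
have rootQ : all (root Q) [seq - z | z <- zs].
  apply/allP => _ /mapP[z zzs ->]; apply/rootP.
  rewrite QE; last by apply/inv_underN/Sz.
  have -> : B = evalE n z * \prod_(z' <- rem z zs) evalE n z'.
    by rewrite /B (big_rem z).
  set B' := \prod_(z' <- _) _.
  have -> : P * (evalE n (- z) * (evalE n z * B')) = evalE n (- z) * evalE n z * (P * B') by ring.
  rewrite ddG_Delta_invl; last first.
    move=> i i_n.
    have -> : evalE n (- z) * evalE n z = \prod_(l < n) (x l ^+ 2 - z ^+ 2).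
      by rewrite /evalE -big_split /=; apply: eq_bigr => l _; ring.
    rewrite rmorph_prod /=.
    have E l : S i (x l ^+ 2 - z ^+ 2) = S i (x l) ^+ 2 - z ^+ 2.
      by rewrite rmorphB !rmorphXn (Sz z zzs).
    case: i i_n E => [|i] i_n E.
      apply: eq_bigr => l _; rewrite E; congr (_ - _).
      have [->|l0] := posnP l; first by rewrite sg0x0 ?sqrrN.
      by rewrite sg0x //; have := ltn_ord l; lia.
    apply: (@prod_swap_adjacent _ (fun l => x l ^+ 2 - z ^+ 2)
      (fun l => S i.+1 (x l ^+ 2 - z ^+ 2)) n i) => // [||l lm li li1]; rewrite E.
    - by rewrite sgxl.
    - by rewrite sgxr.
    - by rewrite sgx.
  rewrite (@ddG_Delta_short n) ?mulr0 //.
  have lB' : lenlt n (size (rem z zs)).+1 B'.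
    have := @lenlt_prod_evalE n R d n 1 (rem z zs) 1; rewrite mulr1 addn1; apply.
      by move=> z' /mem_rem; apply: Sz.
    by have := @lenlt_prod n R d n 1 [::] isT; rewrite big_nil.
  have := lenlt_prodM (iota 1 k) lB'; rewrite size_iota size_rem //.
  have zs0 : (0 < size zs)%N by case: (zs) zzs.
  apply: lenlt_sub; rewrite prednK // -sz addnC.
  by rewrite leq_add2l.
set M := \prod_(z <- zs) ('X - (- z)%:P).
have szM : size M = (size zs).+1 by rewrite size_prod_XsubC.
have lM : M`_(size zs) = 1.
  have := monicP (monic_prod_XsubC zs xpredT -%R); rewrite -/M lead_coefE szM /=.
  exact.
set c := Q`_(size zs).
have cE : c = ddG_Delta (\prod_(j <- iota 1 k.+1) e n j * B).
  rewrite /c coef_poly; have -> : (size zs < n - k)%N by lia.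
  have -> : (n - size zs = k.+1)%N by lia.
  rewrite /u; congr ddG_Delta; rewrite -(addn1 k) iotaD big_cat big_seq1 /=.
  by rewrite mulrA add1n addn1.
have Eq : Q = c%:P * M.
  apply/eqP; rewrite -subr_eq0; apply/negPn/negP => nz.
  have rootsQM : all (root (Q - c%:P * M)) [seq - z | z <- zs].
    apply/allP => z zzs; rewrite rootE hornerD hornerN hornerM.
    rewrite (rootP (allP rootQ z zzs)) sub0r oppr_eq0 mulf_eq0; apply/orP; right.
    case/mapP: zzs => z' zzs ->; rewrite horner_prod (big_rem z') //= hornerXsubC.
    by rewrite subrr mul0r.
  have uQ : uniq [seq - z | z <- zs] by rewrite map_inj_uniq //; apply: oppr_inj.
  have := max_poly_roots nz rootsQM uQ; rewrite size_map ltnNge => /negP; apply.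
  apply/leq_sizeP => j; rewrite leq_eqVlt => /orP[/eqP <-|zj].
    by rewrite coefB coefCM lM mulr1 subrr.
  rewrite coefB coefCM [M`_j]nth_default ?szM // mulr0 subr0 nth_default //.
  by apply: leq_trans (size_poly _ _) _; lia.
rewrite -QE // Eq hornerM hornerC -cE mulrC; congr (_ * _).
rewrite horner_prod; apply: eq_bigr => z _.
by rewrite hornerXsubC opprK.
Qed.

Theorem ddG_Delta_top :
  ddG_Delta (\prod_(j <- iota 1 n) e n j) = \prod_(k < n) \prod_(j < k) (x k + y j).
Proof.
have nz : \prod_(k < n) \prod_(j < k) (y k + y j) != 0.
  apply/prodf_neq0 => k _; apply/prodf_neq0 => j _.
  by apply: yvD_neq0 => //; apply: ltn_trans (ltn_ord k).
apply: (mulfI nz).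
rewrite -[RHS]big_split /=.
rewrite [RHS](eq_bigr (fun k : 'I_n => \prod_(j < k) ((y k + y j) * (x k + y j))));
  last by move=> k _; rewrite big_split.
rewrite -ddG_test // -/(ddG_Delta _).
pose zs k := [seq y a | a <- iota k (n - k)].
have step k : (k <= n)%N -> ddG_Delta (\prod_(a < n) evalE n (y a)) =
    (\prod_(l < k) \prod_(a < n | (l < a)%N) (y l + y a)) *
    ddG_Delta (\prod_(j <- iota 1 k) e n j * \prod_(z <- zs k) evalE n z).
  elim: k => [|k IH] kn.
    rewrite big_ord0 mul1r big_nil mul1r /zs big_map subn0.
    by rewrite -(big_mkord xpredT (fun a => evalE n (y a))) /index_iota subn0.
  rewrite IH; last lia.
  rewrite big_ord_recr /= -mulrA; congr (_ * _).
  have -> : zs k = y k :: zs k.+1 by rewrite /zs -(subnSK kn).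
  rewrite big_cons ddG_Delta_evalE_step.
  - congr (_ * _); rewrite /zs big_map -/(index_iota k.+1 n) big_geq_mkord /=.
    by apply: eq_bigl.
  - by rewrite size_map size_iota; lia.
  - rewrite map_inj_in_uniq ?iota_uniq // => a b; rewrite !mem_iota => an bn.
    by apply: yv_inj; lia.
  - by move=> z /mapP[a _ ->]; apply: inv_under_y.
  - exact: inv_under_y.
rewrite (step n (leqnn n)) /zs subnn /= big_nil mulr1; congr (_ * _).
rewrite (exchange_big_dep predT) //=; apply: eq_bigr => a _.
rewrite (big_ord_widen n (fun j => y a + y j)); last exact/ltnW.
by apply: eq_bigr => j _; rewrite addrC.
Qed.

End TopProduct.

(** * Perfect matchings and the Pfaffian of the quadratic polynomials *)

Lemma big_evenodd (T : Type) (idx : T) (op : Monoid.com_law idx) m (g : 'I_(m.*2) -> T) :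
  \big[op/idx]_(r < m.*2) g r =
  \big[op/idx]_(k < m) op (g (evenpos k)) (g (oddpos k)).
Proof.
pose G r := if insub r is Some o then g o else idx.
have GE (o : 'I_(m.*2)) : g o = G o by rewrite /G valK.
rewrite (eq_bigr (fun r : 'I_(m.*2) => G r)) => [|r _]; last exact: GE.
rewrite [RHS](eq_bigr (fun k : 'I_m => op (G k.*2) (G k.*2.+1))) => [|k _]; last by rewrite !GE.
elim: m {g GE} G => [|m IH] G; first by rewrite !big_ord0.
by rewrite !big_ord_recr /= Monoid.mulmA IH.
Qed.

Section Matchings.
Variable m : nat.
Implicit Types (s : 'S_(m.*2)) (k l : 'I_m) (p q r : 'I_(m.*2)).

Lemma pos_cases q : (exists l, q = evenpos l) \/ (exists l, q = oddpos l).
Proof.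
have qm : (q./2 < m)%N by have := ltn_ord q; lia.
have := odd_double_half q; case: (odd q) => /= Eq; [right | left];
  by exists (Ordinal qm); apply: val_inj; rewrite /= -{1}Eq ?add1n ?add0n.
Qed.

Lemma matching_pair s k : is_matching s -> (s (evenpos k) < s (oddpos k))%N.
Proof. by case/andP => /forallP. Qed.

Lemma matching_even s k l : is_matching s -> (k < l)%N -> (s (evenpos k) < s (evenpos l))%N.
Proof. by case/andP => _ /forallP/(_ k)/forallP/(_ l)/implyP. Qed.

Lemma matchingP s : (forall k, (s (evenpos k) < s (oddpos k))%N) ->
  (forall k l, (k < l)%N -> (s (evenpos k) < s (evenpos l))%N) -> is_matching s.
Proof.
move=> H1 H2; apply/andP; split; first exact/forallP.
by apply/forallP => k; apply/forallP => l; apply/implyP; apply: H2.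
Qed.

Definition fixes s (j : nat) := [forall q : 'I_(m.*2), (q < j)%N ==> (s q == q)].

Lemma fixesP s j : reflect (forall q, (q < j)%N -> s q = q) (fixes s j).
Proof.
apply: (iffP forallP) => H q; first by move=> qj; apply/eqP/(implyP (H q)).
by apply/implyP => /H ->.
Qed.

Lemma fixes_lt s j q : fixes s j -> (s q < j)%N -> s q = q.
Proof. by move/fixesP => H sq; apply/(@perm_inj _ s)/H. Qed.

Lemma matching_first_move s k : is_matching s -> fixes s k.*2 -> ~~ fixes s k.*2.+2 ->
  s (evenpos k) = evenpos k /\
  exists l, l = k.+1 :> nat /\ s (evenpos l) = oddpos k.
Proof.
move=> ms fs nfs.
have sa : s (evenpos k) = evenpos k.
  have Eq : s (s^-1 (evenpos k))%g = evenpos k by rewrite permKV.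
  case: (pos_cases (s^-1 (evenpos k))%g) => -[l El]; rewrite El in Eq.
    case: (ltngtP k l) => kl.
    - have := matching_even ms kl; rewrite Eq /= => lt1.
      have := fixes_lt fs lt1 => E; move: lt1; rewrite E /=; lia.
    - have /fixesP/(_ (evenpos l)) := fs; rewrite Eq /= => /(_ _)/(congr1 val) /=; lia.
    - by rewrite -{1}(val_inj kl : k = l) in Eq.
  have := matching_pair l ms; rewrite Eq /= => lt1.
  have := fixes_lt fs lt1 => E; move: lt1; rewrite E /= => lt1.
  have /fixesP/(_ (oddpos l)) := fs; rewrite Eq /= => /(_ _)/(congr1 val) /=; lia.
split=> //.
have fs1 q : (s q < k.*2.+1)%N -> s q = q.
  rewrite ltnS leq_eqVlt => /orP[/eqP E|]; last exact: fixes_lt.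
  by apply: (@perm_inj _ s); rewrite (_ : s q = evenpos k) ?sa //; apply: val_inj.
have sb : s (oddpos k) != oddpos k.
  apply: contra nfs => /eqP sb; apply/fixesP => q.
  rewrite ltnS leq_eqVlt => /orP[/eqP E|]; first by rewrite (_ : q = oddpos k) //; apply: val_inj.
  rewrite ltnS leq_eqVlt => /orP[/eqP E|]; first by rewrite (_ : q = evenpos k) //; apply: val_inj.
  by move/fixesP: fs; apply.
have Eq : s (s^-1 (oddpos k))%g = oddpos k by rewrite permKV.
case: (pos_cases (s^-1 (oddpos k))%g) => -[l El]; rewrite El in Eq.
  exists l; split=> //.
  have kl : (k < l)%N.
    case: (ltngtP k l) => // kl.
      have /fixesP/(_ (evenpos l)) := fs; rewrite Eq /= => /(_ _)/(congr1 val) /=; lia.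
    by move: Eq; rewrite -(val_inj kl : k = l) sa => /(congr1 val) /=; lia.
  apply/eqP; rewrite eqn_leq kl andbT leqNgt; apply/negP => kl'.
  have k1m : (k.+1 < m)%N by apply: ltn_trans kl' _.
  have := @matching_even s (Ordinal k1m) l ms kl'; rewrite Eq => lt1.
  by have := fs1 _ lt1 => E; move: lt1; rewrite E /=; lia.
have := matching_pair l ms; rewrite Eq => lt1.
have E := fs1 _ lt1; move: lt1; rewrite E /= => lt1.
have [kl|kl] := eqVneq k l; first by rewrite -kl in Eq; rewrite Eq eqxx in sb.
have /fixesP/(_ (oddpos l)) := fs; rewrite Eq /= => /(_ _)/(congr1 val) /=.
by move: kl; rewrite -val_eqE /=; lia.
Qed.

(** In such a matching, 2k and 2k + 1 are the smaller elements of two different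
    pairs, the k-th and the next one; exchanging their partners is an involution
    that changes the sign. *)
Lemma matching_sign_step k :
  \sum_(s | [&& is_matching s, fixes s k.*2 & ~~ fixes s k.*2.+2]) (-1) ^+ s = 0 :> int.
Proof.
have [k1m|mk] := ltnP k.+1 m; last first.
  rewrite big_pred0 // => s; apply/negP => /and3P[ms fs nfs].
  have [_ [l [lk _]]] := matching_first_move ms fs nfs.
  by have := ltn_ord l; lia.
pose k1 := Ordinal k1m; pose t := tperm (oddpos k) (oddpos k1).
pose P s := [&& is_matching s, fixes s k.*2 & ~~ fixes s k.*2.+2].
change (\sum_(s | P s) (-1) ^+ s = 0 :> int).
have tE l : t (evenpos l) = evenpos l.
  by rewrite /t tpermD // -val_eqE /=; lia.
have tD q : q != oddpos k -> q != oddpos k1 -> t q = q.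
  by move=> q1 q2; rewrite /t tpermD // eq_sym.
have Pt s : P s -> P (t * s)%g.
  move=> /and3P[ms fs nfs].
  have [sa [l [lk sl]]] := matching_first_move ms fs nfs.
  have {lk} El : l = k1 by apply: val_inj.
  rewrite {}El in sl.
  have s3 : (k.*2.+1 < s (oddpos k1))%N by have := matching_pair k1 ms; rewrite sl.
  have s1 : (k.*2.+1 < s (oddpos k))%N.
    have := matching_pair k ms; rewrite sa /= leq_eqVlt => /orP[/eqP E|//].
    have : s (oddpos k) = s (evenpos k1) by rewrite sl; apply: val_inj.
    by move/perm_inj/(congr1 val) => /=; lia.
  apply/and3P; split.
  - apply: matchingP => [j|j j' jj]; rewrite !permM !tE; last exact: matching_even.
    have [->|jk] := eqVneq j k; first by rewrite tpermL sa; apply: ltn_trans s3 => /=.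
    have [->|jk1] := eqVneq j k1; first by rewrite tpermR sl.
    by rewrite tD ?matching_pair // -val_eqE /=; move: jk jk1; rewrite -!val_eqE /=; lia.
  - apply/fixesP => q qk; rewrite permM tD; first by move/fixesP: fs; apply.
      by rewrite -val_eqE /=; lia.
    by rewrite -val_eqE /=; lia.
  apply/negP => /fixesP/(_ (oddpos k)); rewrite permM tpermL => /(_ _)/(congr1 val) /=.
  by move=> E; move: s3; rewrite E //; lia.
have tt s : (t * (t * s) = s)%g by rewrite mulgA tperm2 mul1g.
have Pt' s : P (t * s)%g = P s by apply/idP/idP => [/Pt|/Pt //]; rewrite tt.
have odd_t : odd_perm t by rewrite odd_tperm -val_eqE /=; lia.
set Sg : int := \sum_(s | P s) _; suff : Sg = - Sg by lia.
rewrite {1}/Sg (reindex_inj (mulgI t)) -sumrN.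
apply: eq_big => s; first exact: Pt'.
by move=> _; rewrite odd_permM odd_t signr_addb expr1 mulN1r.
Qed.

(** Only the matching of all 2k with 2k + 1 escapes the cancellations. *)
Lemma matching_sign : \sum_(s : 'S_(m.*2) | is_matching s) (-1) ^+ s = 1 :> int.
Proof.
have step j : (j <= m)%N ->
    \sum_(s : 'S_(m.*2) | is_matching s) (-1) ^+ s =
    \sum_(s : 'S_(m.*2) | is_matching s && fixes s j.*2) (-1) ^+ s :> int.
  elim: j => [|j IH] jm.
    by apply: eq_bigl => s; rewrite (introT (fixesP s 0)) ?andbT.
  rewrite IH ?(ltnW jm) // (bigID (fun s => fixes s j.+1.*2)) /=.
  rewrite [X in _ + X](eq_bigl (fun s => [&& is_matching s, fixes s j.*2 & ~~ fixes s j.*2.+2]));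
    last by move=> s; rewrite -andbA.
  rewrite (matching_sign_step (Ordinal jm)) addr0; apply: eq_bigl => s.
  rewrite -andbA; case: (is_matching s) => //=.
  case: (boolP (fixes s j.+1.*2)) => [/fixesP fs|_]; last by rewrite andbF.
  by rewrite andbT; apply/fixesP => q qj; apply: fs; rewrite doubleS; lia.
rewrite (step m (leqnn m)) (bigD1 1%g) /=; last first.
  apply/andP; split; last by apply/fixesP => q _; rewrite perm1.
  by apply: matchingP => [k|k l kl]; rewrite !perm1 /=; lia.
rewrite odd_perm1 expr0 big1 ?addr0 // => s /andP[/andP[_ /fixesP fs] /eqP []].
by apply/permP => q; rewrite perm1 fs.
Qed.

End Matchings.

Lemma rmorph_Pfaffian (R R' : comNzRingType) (phi : {rmorphism R -> R'}) m (A : 'M[R]_(m.*2)) :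
  phi (Pfaffian A) = Pfaffian (map_mx phi A).
Proof.
rewrite /Pfaffian rmorph_sum; apply: eq_bigr => s _; rewrite rmorphM rmorph_sign rmorph_prod.
by congr (_ * _); apply: eq_bigr => k _; rewrite mxE.
Qed.

Section PfaffianQ.
Variables (n : nat) (R : idomainType) (d : dd_system n R).
Implicit Types (f g h c : R) (i j m a r : nat).
Local Notation e := (e d).
Local Notation lenlt := (lenlt d).
Local Notation ddG_Delta := (ddG_Delta d).

Definition q2 i j : R :=
  e n i * e n j + 2%:R * \sum_(1 <= k < j.+1) (-1) ^+ k * e n (i + k) * e n (j - k).

Definition PfQ (la : seq nat) : R :=
  Pfaffian (\matrix_(i < (uphalf (size la)).*2, j < (uphalf (size la)).*2)
              q2 (nth 0%N la i) (nth 0%N la j)).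

Lemma lenlt_e0 r i f : lenlt n r f -> lenlt n ((0 < i) + r) (e n i * f).
Proof. by case: i => [|i] fr; [rewrite e_0 mul1r | apply: lenltS]. Qed.

Lemma lenlt_q2 r i j f : ((0 < j) ==> (0 < i))%N -> lenlt n r f ->
  lenlt n ((0 < i) + (0 < j) + r) (q2 i j * f).
Proof.
move=> ij fr; rewrite /q2 mulrDl; apply: LenltD.
  by rewrite -mulrA -addnA; do 2 apply: lenlt_e0.
case: j ij => [_|j /= i0]; first by rewrite big_geq // mulr0 mul0r; apply: Lenlt0.
rewrite -mulrA mulr_suml; apply: lenlt_invM; first by move=> k _; rewrite rmorph_nat.
rewrite big_nat; apply: lenlt_sum => k _; rewrite -!mulrA; apply: lenlt_invM.
  exact/inv_underX/inv_underN/inv_under1.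
by rewrite i0; do 2 apply: lenltS.
Qed.

Lemma lenlt_prod_q2 (I : Type) (t : seq I) (P : pred I) (u v : I -> nat) r f :
  (forall z, P z -> (0 < v z) ==> (0 < u z))%N -> lenlt n r f ->
  lenlt n (\sum_(z <- t | P z) ((0 < u z) + (0 < v z)) + r)%N
    (\prod_(z <- t | P z) q2 (u z) (v z) * f).
Proof.
move=> uv fr; elim: t => [|z t IH]; first by rewrite !big_nil mul1r.
rewrite !big_cons; case: ifP => // Pz.
by rewrite -mulrA -addnA; apply: lenlt_q2 => //; apply: uv.
Qed.

Lemma lenlt_prod_e (I : Type) (t : seq I) (P : pred I) (u : I -> nat) r f : lenlt n r f ->
  lenlt n (\sum_(z <- t | P z) (0 < u z) + r)%N (\prod_(z <- t | P z) e n (u z) * f).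
Proof.
move=> fr; elim: t => [|z t IH]; first by rewrite !big_nil mul1r.
rewrite !big_cons; case: ifP => // Pz.
by rewrite -mulrA -addnA; apply: lenlt_e0.
Qed.

Lemma lenlt_1 : lenlt n 1 1.
Proof. by have := @lenlt_prod n R d n 1 [::] isT; rewrite big_nil. Qed.

Lemma sum_ltn_const m r : (r <= m)%N -> (\sum_(p < m) (p < r) = r)%N.
Proof.
move=> rm; rewrite -(big_mkord xpredT (fun p => (p < r) : nat)) (big_cat_nat (n := r)) //=.
rewrite [X in (_ + X)%N]big_nat [X in (_ + X)%N]big1; last first.
  by move=> p rp; rewrite ltnNge; case/andP: rp => ->.
rewrite addn0 big_nat (eq_bigr (fun=> 1%N)); last by move=> p pr; case/andP: pr => _ ->.
by rewrite -big_nat sum_nat_const_nat subn0 muln1.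
Qed.

(** Each term of the Pfaffian uses every part once, and the correction terms of
    [q2] do not lengthen the products.  The index 0, present when the number of parts
    is odd, contributes the factor e_0 = 1. *)
Lemma lenlt_PfQ la : all (ltn 0) la -> lenlt n (size la).+1 (PfQ la).
Proof.
move=> la0; set m := uphalf (size la).
have pos p : (0 < nth 0%N la p)%N = (p < size la)%N.
  have [pl|pl] := ltnP p (size la); last by rewrite nth_default.
  exact: (allP la0) (mem_nth _ pl).
apply: lenlt_sum => s ms; apply: lenlt_invM.
  exact/inv_underX/inv_underN/inv_under1.
under eq_bigr do rewrite mxE.
have := @lenlt_prod_q2 _ (index_enum 'I_m) xpredT (fun k => nth 0%N la (s (evenpos k)))
  (fun k => nth 0%N la (s (oddpos k))) 1 1 _ lenlt_1.
rewrite mulr1 addn1 => H; have {}H := H _.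
have E : (\sum_(k < m) ((0 < nth 0 la (s (evenpos k))) + (0 < nth 0 la (s (oddpos k)))) =
    size la)%N.
  rewrite -(@big_evenodd _ _ addn m (fun r : 'I_(m.*2) => (0 < nth 0 la (s r)) : nat)).
  rewrite (reindex_inj (@perm_inj _ (s^-1)%g)).
  rewrite (eq_bigr (fun p : 'I_m.*2 => (p < size la) : nat)) => [|p _]; last by rewrite permKV pos.
  by rewrite sum_ltn_const // /m; lia.
rewrite E in H; apply: H => k _; rewrite !pos; apply/implyP; apply: ltn_trans.
exact: matching_pair.
Qed.

(** Modulo the kernel of the operator, the pairs of a matching may be replaced one
    after the other, starting with the largest parts: the correction terms of
    Q_(i, j) repeat an index larger than i, while all the e_b with b > i are
    already present, so that [ddG_Delta_high_run] applies. *)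
Lemma ddG_Delta_matching m (s : 'S_(m.*2)) : (n <= m.*2 <= n.+1)%N -> is_matching s ->
  ddG_Delta (\prod_(k < m) q2 (n - s (evenpos k)) (n - s (oddpos k))) =
  ddG_Delta (\prod_(b <- iota 1 n) e n b).
Proof.
move=> nm ms.
pose ev k : nat := (n - s (evenpos k))%N; pose ov k : nat := (n - s (oddpos k))%N.
(* the first c pairs have been replaced *)
pose F (c : nat) (k : 'I_m) : R := if (k < c)%N then e n (ev k) * e n (ov k) else q2 (ev k) (ov k).
have wtE (p : 'I_(m.*2)) : (0 < n - p)%N = (p < n)%N by rewrite subn_gt0.
have evn k : (s (evenpos k) < n)%N.
  by have := matching_pair k ms; have := ltn_ord (s (oddpos k)); lia.
have step (c : 'I_m) : ddG_Delta (\prod_(k < m) F c k) = ddG_Delta (\prod_(k < m) F c.+1 k).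
  rewrite (bigD1 c) //= [in RHS](bigD1 c) //= /F ltnn ltnSn.
  set rest := \prod_(k | _) _.
  rewrite [X in _ = ddG_Delta (_ * X)](_ : _ = rest); last first.
    by apply: eq_bigr => k kc; rewrite ltnS leq_eqVlt val_eqE (negPf kc).
  rewrite /q2 mulrDl ddG_DeltaD -[RHS]addr0; congr (_ + _).
  rewrite -mulrA mulr_suml mulr_sumr ddG_Delta_sum big_nat big1 // => t t_ov.
  set b := (ev c + t)%N.
  have ov0 : (s (oddpos c) < n)%N by rewrite -subn_gt0 -/(ov c); lia.
  have [nb|bn] := ltnP n b.
    by rewrite (e_big _ nb) mulr0 mul0r mul0r mulr0 ddG_Delta0.
  have restE : rest = \prod_(k < m | (k < c)%N) (e n (ev k) * e n (ov k)) *
                      \prod_(k < m | (c < k)%N) q2 (ev k) (ov k).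
    rewrite /rest (bigID (fun k : 'I_m => (k < c)%N)) /=; congr (_ * _).
      apply: eq_big => [k|k /andP[_ ->] //].
      by case: ltngtP => [|//|/val_inj ->]; rewrite ?andbF ?eqxx // andbT neq_ltn => ->.
    apply: eq_big => [k|k /andP[_ /negPf ->] //].
    by rewrite -val_eqE /=; lia.
  (* p belongs to one of the first c pairs *)
  pose DD (p : 'I_(m.*2)) := (s^-1%g p < c.*2)%N.
  have DDE (T : Type) (idx : T) (op : Monoid.com_law idx) (g : 'I_(m.*2) -> T) :
      \big[op/idx]_(k < m | (k < c)%N) op (g (s (evenpos k))) (g (s (oddpos k))) =
      \big[op/idx]_(p | DD p) g p.
    rewrite [RHS](reindex_inj (@perm_inj _ s)) big_mkcond [RHS]big_mkcond /=.
    rewrite big_evenodd; apply: eq_bigr => k _; rewrite /DD !permK /=.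
    have -> : (k.*2 < c.*2)%N = (k < c)%N by lia.
    have -> : (k.*2.+1 < c.*2)%N = (k < c)%N by lia.
    by case: ifP; rewrite ?Monoid.mulm1.
  have DDlow (p : 'I_(m.*2)) : (p < s (evenpos c))%N -> DD p.
    rewrite /DD; have Ep : s (s^-1%g p) = p by rewrite permKV.
    case: (pos_cases (s^-1%g p)) => -[l El]; rewrite El in Ep *; rewrite -Ep => lt1.
      have [lc|cl] := ltnP l c; first by rewrite /=; lia.
      move: cl; rewrite leq_eqVlt => /orP[/eqP/val_inj cl|cl].
        by rewrite cl ltnn in lt1.
      by have := matching_even ms cl; lia.
    have lt2 := ltn_trans (matching_pair l ms) lt1.
    have [lc|cl] := ltnP l c; first by rewrite /=; lia.
    move: cl; rewrite leq_eqVlt => /orP[/eqP/val_inj cl|cl].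
      by rewrite cl ltnn in lt2.
    by have := matching_even ms cl; lia.
  have nb_c : (n - b < s (evenpos c))%N by move: bn t_ov (evn c); rewrite /b /ev; lia.
  have WE : \prod_(k < m | (k < c)%N) (e n (ev k) * e n (ov k)) =
     e n b * \prod_(a <- iota b.+1 (n - b)) e n a *
       \prod_(p : 'I_(m.*2) | DD p && ~~ (p <= n - b)%N) e n (n - p).
    rewrite (DDE _ _ _ (fun p : 'I_(m.*2) => e n (n - p))).
    rewrite (bigID (fun p : 'I_(m.*2) => p <= n - b)%N) /=.
    congr (_ * _); rewrite -(big_cons _ _ b _ xpredT (e n)).
    have -> : b :: iota b.+1 (n - b) = [seq (b + i)%N | i <- index_iota 0 (n - b).+1].
      by rewrite /index_iota subn0 -iotaDl addn0.
    rewrite (eq_bigl (fun p : 'I_(m.*2) => p < (n - b).+1)%N); last first.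
      move=> p; rewrite ltnS; case: leqP => [pb|]; rewrite ?andbF // andbT.
      by apply: DDlow; lia.
    rewrite -(big_ord_widen _ (fun p => e n (n - p))); last by have := ltn_ord (s (evenpos c)); lia.
    rewrite big_map big_mkord [LHS](reindex_inj rev_ord_inj) /=.
    apply: eq_bigr => i _; congr (e n _).
    by have := ltn_ord i; lia.
  rewrite restE WE.
  set u := \prod_(a <- _) _; set v := \prod_(p | _) _; set w := \prod_(k < m | _) _.
  have -> : (-1) ^+ t * e n b * e n (ov c - t) * (e n b * u * v * w) =
    (-1) ^+ t * (e n b * (e n b * (u * (v * (e n (ov c - t) * (w * 1)))))) by ring.
  have -> : 2%:R * ((-1) ^+ t * (e n b * (e n b * (u * (v * (e n (ov c - t) * (w * 1))))))) =
    (-1) ^+ t * (2%:R * (e n b * (e n b * (u * (v * (e n (ov c - t) * (w * 1))))))) by ring.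
  rewrite ddG_Delta_signl ddG_Delta_invl; last by move=> k _; rewrite rmorph_nat.
  have -> : ddG_Delta (e n b * (e n b * (u * (v * (e n (ov c - t) * (w * 1)))))) = 0;
    last by rewrite !mulr0.
  set wv := (\sum_(p : 'I_(m.*2) | DD p && ~~ (p <= n - b)%N) (0 < n - p))%N.
  set ww := (\sum_(k < m | (c < k)%N) ((0 < ev k) + (0 < ov k)))%N.
  have lw : lenlt n (wv + (ww + 1).+1)%N (v * (e n (ov c - t) * (w * 1))).
    apply: lenlt_prod_e; apply: lenltS; apply: lenlt_prod_q2; last exact: lenlt_1.
    by move=> k _; rewrite /ev subn_gt0 evn implybT.
  apply: (@ddG_Delta_high_run _ _ _ b _ _ bn _ lw).
  have total : (\sum_(k < m) ((0 < ev k) + (0 < ov k)) = n)%N.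
    rewrite -(@big_evenodd _ _ addn m (fun r : 'I_(m.*2) => (0 < n - s r) : nat)).
    rewrite (reindex_inj (@perm_inj _ (s^-1)%g)).
    rewrite (eq_bigr (fun p : 'I_m.*2 => (p < n) : nat)) => [|p _]; last by rewrite permKV wtE.
    by rewrite sum_ltn_const //; lia.
  have lowE : (\sum_(k < m | (k < c)%N) ((0 < ev k) + (0 < ov k)) = (n - b).+1 + wv)%N.
    rewrite (DDE _ _ addn (fun p : 'I_(m.*2) => (0 < n - p)%N : nat)).
    rewrite (bigID (fun p : 'I_(m.*2) => p <= n - b)%N) /=; congr addn.
    rewrite (eq_bigl (fun p : 'I_(m.*2) => p < (n - b).+1)%N); last first.
      move=> p; rewrite ltnS; case: leqP => [pb|]; rewrite ?andbF // andbT.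
      by apply: DDlow; lia.
    rewrite (eq_bigr (fun=> 1%N)); last by move=> p pb; have := evn c; lia.
    rewrite -(big_ord_widen _ (fun=> 1%N)); last by have := ltn_ord (s (evenpos c)); lia.
    by rewrite sum_nat_const card_ord muln1.
  move: total; rewrite (bigD1 c) //= (bigID (fun k : 'I_m => (k < c)%N)) /=.
  rewrite [X in (_ + (X + _))%N = _](_ : _ = (n - b).+1 + wv)%N; last first.
    rewrite -lowE; apply: eq_bigl => k; rewrite -val_eqE /=; lia.
  rewrite [X in (_ + (_ + X))%N = _](_ : _ = ww); last first.
    by apply: eq_bigl => k; rewrite -val_eqE /=; lia.
  by rewrite /ev /ov !subn_gt0 evn ov0; lia.
have all_steps (c : nat) : (c <= m)%N ->
    ddG_Delta (\prod_(k < m) F 0%N k) = ddG_Delta (\prod_(k < m) F c k).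
  elim: c => [|c IH] cm //; rewrite IH ?(ltnW cm) //.
  exact: (step (Ordinal cm)).
rewrite -[LHS]/(ddG_Delta (\prod_(k < m) F 0%N k)) (all_steps m (leqnn m)); congr ddG_Delta.
rewrite (eq_bigr (fun k => e n (n - s (evenpos k)) * e n (n - s (oddpos k)))); last first.
  by move=> k _; rewrite /F ltn_ord.
rewrite -(@big_evenodd _ _ _ m (fun r : 'I_(m.*2) => e n (n - s r))).
rewrite (reindex_inj (@perm_inj _ (s^-1)%g)).
rewrite (eq_bigr (fun p : 'I_m.*2 => e n (n - p))) => [|p _]; last by rewrite permKV.
rewrite -(big_mkord xpredT (fun p => e n (n - p))) (big_cat_nat (n := n)) //=; last lia.
rewrite [X in _ * X]big_nat [X in _ * X]big1 ?mulr1; last first.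
  by move=> p pn; have -> : (n - p)%N = 0%N; [lia | rewrite e_0].
rewrite big_mkord (reindex_inj rev_ord_inj) /=.
have -> : iota 1 n = [seq i.+1 | i <- index_iota 0 n].
  by rewrite /index_iota subn0 -[1%N]addn0 iotaDl.
rewrite big_map big_mkord; apply: eq_bigr => i _; congr (e n _).
by have := ltn_ord i; lia.
Qed.

Lemma ddG_Delta_PfQ_top :
  ddG_Delta (PfQ (rev (iota 1 n))) = ddG_Delta (\prod_(b <- iota 1 n) e n b).
Proof.
rewrite /PfQ /Pfaffian size_rev size_iota; set m := uphalf n.
have nthE p : nth 0%N (rev (iota 1 n)) p = (n - p)%N.
  have [pn|np] := ltnP p n; last by rewrite nth_default ?size_rev ?size_iota //; lia.
  by rewrite nth_rev size_iota // nth_iota; lia.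
rewrite ddG_Delta_sum.
rewrite (eq_bigr (fun s : 'S_(m.*2) => (-1) ^+ s * ddG_Delta (\prod_(b <- iota 1 n) e n b))).
  rewrite -mulr_suml; have := congr1 (fun z : int => z%:~R : R) (matching_sign m).
  rewrite rmorph_sum /= (eq_bigr (fun s : 'S_(m.*2) => (-1) ^+ s)) => [->|s _].
    by rewrite mul1r.
  by rewrite rmorph_sign.
move=> s ms; rewrite ddG_Delta_signl; congr (_ * _).
rewrite -(@ddG_Delta_matching m s) //; last by rewrite /m; lia.
by congr ddG_Delta; apply: eq_bigr => k _; rewrite mxE !nthE.
Qed.

End PfaffianQ.

(** * The divided differences of polynomials *)

Lemma yvar_inj n : injective (@yvar n).
Proof.
move=> i j /(congr1 (mcoeff U_(rshift n i))); rewrite !mcoeffXU eqxx.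
by case: eqP => // /rshift_inj ->.
Qed.

Lemma yvarD_neq0 n (i j : 'I_n) : yvar i + yvar j != 0.
Proof.
apply/eqP => /(congr1 (mcoeff U_(rshift n i))); rewrite mcoeff0 mcoeffD !mcoeffXU eqxx.
by case: eqP.
Qed.

Section System.
Variable n' : nat.
Local Notation n := n'.+1.
Implicit Types (f g : polyXY n).

Definition px (i : nat) : polyXY n := xvar (inord i).
Definition py (i : nat) : polyXY n := yvar (inord i).
Definition psg (i : nat) : {rmorphism polyXY n -> polyXY n} := wact (sgen (inord i : 'I_n)).
Definition pdd (i : nat) : polyXY n -> polyXY n := divdiff (inord i : 'I_n).
Definition pden (i : nat) : polyXY n := if i is j.+1 then px j - px j.+1 else 2%:R * px 0.

Lemma inord_eq (i j : nat) : (i < n)%N -> (j < n)%N ->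
  (inord i == inord j :> 'I_n) = (i == j).
Proof. by move=> i_n jn; rewrite -val_eqE /= !inordK. Qed.

Lemma prev_inord j : (j.+1 < n)%N -> prev_ord (inord j.+1 : 'I_n) = inord j.
Proof. by move=> jn; apply: val_inj; rewrite /= !inordK //; apply: ltnW. Qed.

Lemma pdenE i : (i < n)%N -> pden i = divdiff_den (inord i : 'I_n).
Proof.
rewrite /pden /divdiff_den; case: i => [|i] i_n; rewrite !inordK //=.
by rewrite prev_inord.
Qed.

Lemma pden_neq0 i : (i < n)%N -> pden i != 0.
Proof. by move=> i_n; rewrite pdenE // divdiff_den_neq0. Qed.

Lemma pddE i f : (i < n)%N -> pdd i f * pden i = f - psg i f.
Proof. by move=> i_n; rewrite pdenE //; apply: divdiffE. Qed.

Lemma psgK i f : (i < n)%N -> psg i (psg i f) = f.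
Proof. by move=> _; apply: sactK. Qed.

Lemma psg0x0 : (0 < n)%N -> psg 0 (px 0) = - px 0.
Proof. by move=> _; rewrite /psg /px /= sact0_x ?inordK // eqxx. Qed.

Lemma psg0x j : (0 < j < n)%N -> psg 0 (px j) = px j.
Proof.
move=> /andP[j0 jn]; rewrite /psg /px /= sact0_x ?inordK // inord_eq //.
by rewrite (gtn_eqF j0).
Qed.

Lemma psgxl j : (j.+1 < n)%N -> psg j.+1 (px j) = px j.+1.
Proof.
by move=> jn; rewrite /psg /px /= sactS_x ?inordK // prev_inord // tpermL.
Qed.

Lemma psgx j k : (j.+1 < n)%N -> (k < n)%N -> k != j -> k != j.+1 -> psg j.+1 (px k) = px k.
Proof.
move=> jn kn kj kj1; rewrite /psg /px /= sactS_x ?inordK // prev_inord // tpermD //.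
  by rewrite inord_eq 1?eq_sym // ltnW.
by rewrite inord_eq 1?eq_sym.
Qed.

Lemma psgy i j : (i < n)%N -> psg i (py j) = py j.
Proof. by move=> _; apply: wact_y. Qed.

Lemma psgC i j f : (i.+1 < j < n)%N -> psg i (psg j f) = psg j (psg i f).
Proof.
move=> /andP[ij jn]; rewrite /psg /= -!wactM; congr (wact _ f).
have := @sgen_comm n (inord i) (inord j) 1%g; rewrite !mulg1 => ->//.
by rewrite !inordK //; lia.
Qed.

Lemma psg_braid3 i f : (0 < i)%N -> (i.+1 < n)%N ->
  psg i (psg i.+1 (psg i f)) = psg i.+1 (psg i (psg i.+1 f)).
Proof.
move=> i0 i_n; rewrite /psg /= -!wactM; congr (wact _ f).
have := @sgen_braid3 n (inord i) (inord i.+1) 1%g; rewrite !mulg1 => H.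
by rewrite H ?inordK //; lia.
Qed.

Lemma psg_braid4 f : (1 < n)%N ->
  psg 0 (psg 1 (psg 0 (psg 1 f))) = psg 1 (psg 0 (psg 1 (psg 0 f))).
Proof.
move=> n1; rewrite /psg /= -!wactM; congr (wact _ f).
have := @sgen_braid4 n (inord 0) (inord 1) 1%g; rewrite !mulg1 => H.
by rewrite H ?inordK.
Qed.

Lemma py_inj a b : (a < n)%N -> (b < n)%N -> py a = py b -> a = b.
Proof. by move=> an bn /yvar_inj/(congr1 val); rewrite /= !inordK. Qed.

Lemma pyD_neq0 a b : (a < n)%N -> (b < n)%N -> py a + py b != 0.
Proof. by move=> _ _; apply: yvarD_neq0. Qed.

Definition pd : dd_system n (polyXY n) :=
  DDSystem pden_neq0 pddE psgK psg0x0 psg0x psgxl psgx psgy psgC psg_braid3 psg_braid4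
    py_inj pyD_neq0.

End System.

(** * Reduced words *)

Fixpoint ddG_word (m : nat) : seq nat :=
  if m is m'.+1 then ddG_word m' ++ rev (iota 0 m'.+1) else [::].

Lemma ddG_wordS m : ddG_word m.+1 = ddG_word m ++ rev (iota 0 m.+1).
Proof. by []. Qed.

Lemma dd_chain_foldr n R (d : dd_system n R) a k f :
  dd_chain d a k f = foldr (dd d) f (rev (iota a k)).
Proof.
elim: k a f => [|k IH] a f //=.
by rewrite IH rev_cons foldr_rcons.
Qed.

Lemma ddG_foldr n R (d : dd_system n R) m f : ddG d m f = foldr (dd d) f (ddG_word m).
Proof.
elim: m f => [|m IH] f //; have -> : ddG d m.+1 f = ddG d m (dd_chain d 0 m.+1 f) by [].
rewrite IH dd_chain_foldr.
by rewrite ddG_wordS foldr_cat.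
Qed.

Lemma size_ddG_word m : size (ddG_word m) = ('C(m, 2) + m)%N.
Proof.
elim: m => [|m IH] //; rewrite ddG_wordS.
by rewrite size_cat IH size_rev size_iota binS bin1.
Qed.

Lemma count_ddG_word m : count (fun i => i != 0%N) (ddG_word m) = 'C(m, 2).
Proof.
elim: m => [|m IH] //; rewrite ddG_wordS.
rewrite count_cat IH count_rev binS bin1; congr addn => /=.
have -> : count (fun i => i != 0%N) (iota 1 m) = size (iota 1 m).
  by apply/eqP; rewrite -all_count; apply/allP => i; rewrite mem_iota; lia.
by rewrite size_iota.
Qed.

Section Words.
Variable n' : nat.
Local Notation n := n'.+1.
Implicit Types (w z : Weyl n) (u v : 'S_n) (a b : seq 'I_n).

Definition ord_word (s : seq nat) : seq 'I_n := [seq inord i | i <- s].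

Lemma winv_cat a b : winv (a ++ b) = (winv a * winv b)%g.
Proof.
elim: a => [|i a IH] /=; first by rewrite winv_nil mul1g.
by rewrite !winv_cons IH mulgA.
Qed.

Definition ent w (j : nat) : int := entry w (inord j).

Lemma ent_block k w j : (k < n)%N -> (j < n)%N ->
  ent (winv (ord_word (rev (iota 0 k.+1))) * w)%g j =
  if (j < k)%N then ent w j.+1 else if j == k then - ent w 0 else ent w j.
Proof.
elim: k j => [|k IH] j kn jn.
  rewrite /= winv_cons winv_nil mulg1 /ent entry_sgen inordK // eqxx inord_eq //.
  by case: eqP => // ->.
rewrite -[k.+2]addn1 iotaD cats1 rev_rcons add0n [ord_word _]/= winv_cons -mulgA /ent entry_sgen.
rewrite inordK //= prev_inord //.
have [->|jk] := eqVneq j k.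
  rewrite tpermL -/(ent _ _) IH ?(ltnW kn) // ltnSn.
  have -> : (k.+1 < k)%N = false by lia.
  by have -> : (k.+1 == k) = false by lia.
have [->|jk1] := eqVneq j k.+1.
  by rewrite tpermR -/(ent _ _) IH ?ltnn ?eqxx //; apply: ltnW.
rewrite tpermD; last first.
- by rewrite inord_eq // eq_sym.
- by rewrite inord_eq 1?eq_sym //; apply: ltnW.
rewrite -/(ent _ _) IH //; last exact: ltnW.
rewrite (negPf jk); have -> : (j < k.+1)%N = (j < k)%N by rewrite ltnS leq_eqVlt (negPf jk).
by [].
Qed.

Lemma ent_ddG_word m w : (m <= n)%N ->
  (forall j, (j < m)%N -> ent w j = ((j + (n - m)).+1)%:Z) ->
  (forall j, (m <= j < n)%N -> ent w j = - ((n - j)%N)%:Z) ->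
  forall j, (j < n)%N -> ent (winv (ord_word (ddG_word m)) * w)%g j = - ((n - j)%N)%:Z.
Proof.
elim: m w => [|m IH] w mn lo hi j jn; first by rewrite winv_nil mul1g hi.
rewrite ddG_wordS /ord_word map_cat winv_cat -mulgA.
apply: IH => //; first exact: ltnW.
  move=> l lm; rewrite ent_block // ?lm ?lo //; last lia.
  by congr Posz; lia.
move=> l /andP[ml ln]; rewrite ent_block // ltnNge ml /=.
case: eqP => [->|/eqP lm]; first by rewrite lo //; congr (- Posz _); lia.
by rewrite hi //; lia.
Qed.

Lemma ent1 j : (j < n)%N -> ent 1%g j = j.+1%:Z.
Proof. by move=> jn; rewrite /ent /entry /= perm1 mul1r /= inordK. Qed.

Lemma entry_ddG_word (i : 'I_n) : entry (winv (ord_word (ddG_word n))) i = - ((n - i)%N)%:Z.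
Proof.
have : ent (winv (ord_word (ddG_word n)) * 1)%g i = - ((n - i)%N)%:Z.
  apply: ent_ddG_word => // [j jn|j]; last by lia.
  by rewrite ent1 // subnn addn0.
by rewrite mulg1 /ent inord_val.
Qed.

Lemma entry_perm u (i : 'I_n) : entry (Weyl_of_perm u) i = (u i).+1%:Z.
Proof. by rewrite /entry /= permE /= mul1r. Qed.

Lemma entry_permM u w (i : 'I_n) : entry (Weyl_of_perm u * w)%g i = entry w (u i).
Proof.
have E : sgval (Weyl_of_perm u) (i, false) = (u i, false) by rewrite /= permE.
by rewrite /entry Defs.sgvalM permM E.
Qed.

Lemma Weyl_of_permM u v : Weyl_of_perm (u * v)%g = (Weyl_of_perm u * Weyl_of_perm v)%g.
Proof.
apply: entry_inj => i; rewrite entry_perm permM /entry Defs.sgvalM permM /=.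
by rewrite !permE /= /lift_fun /= mul1r.
Qed.

Lemma Weyl_of_permV u : Weyl_of_perm u^-1%g = (Weyl_of_perm u)^-1%g.
Proof.
apply/esym/eqP; rewrite eq_invg_mul -Weyl_of_permM mulgV.
by apply/eqP/entry_inj => i; rewrite entry_perm perm1 /entry /= perm1 mul1r.
Qed.

Lemma entry_mulw0 u (i : 'I_n) : entry (Weyl_of_perm u * w0 n)%g i = - (u i).+1%:Z.
Proof. by rewrite /entry Defs.sgvalM permM /= !permE /= /bar_fun /= mulN1r. Qed.

(** For i > 0 this is the letter of the conjugate of s_i by the longest permutation;
    [flip 0] is a default value. *)
Definition flip (i : 'I_n) : 'I_n := inord (n - i).

Lemma val_flip (i : 'I_n) : (0 < i)%N -> flip i = (n - i)%N :> nat.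
Proof. by move=> i0; rewrite inordK //; have := ltn_ord i; lia. Qed.

Lemma omega0E (i : 'I_n) : omega0 n i = rev_ord i.
Proof. by rewrite permE. Qed.

Lemma omega0V : ((omega0 n)^-1)%g = omega0 n.
Proof.
apply/eqP; rewrite eq_invg_mul; apply/eqP/permP => i.
by rewrite permM !omega0E rev_ordK perm1.
Qed.

Lemma sgen_pos (i : 'I_n) : (0 < i)%N -> sgen i = Weyl_of_perm (tperm (prev_ord i) i).
Proof. by rewrite /sgen lt0n => /negPf ->. Qed.

Lemma sgen_flip (i : 'I_n) : (0 < i)%N ->
  sgen (flip i) = (Weyl_of_perm (omega0 n) * sgen i * Weyl_of_perm (omega0 n))%g.
Proof.
move=> i0; have fi := val_flip i0; have i_n := ltn_ord i.
rewrite !sgen_pos //; last by rewrite fi; lia.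
rewrite -!Weyl_of_permM; congr Weyl_of_perm.
have -> : prev_ord (flip i) = omega0 n i.
  by apply: val_inj; rewrite omega0E /= fi; lia.
have -> : flip i = omega0 n (prev_ord i).
  by apply: val_inj; rewrite omega0E /= fi; lia.
by rewrite tpermC -tpermJ conjgE omega0V mulgA.
Qed.

Lemma winv_flip a : all (fun i : 'I_n => (0 < i)%N) a ->
  winv (map flip a) =
  (Weyl_of_perm (omega0 n) * winv a * Weyl_of_perm (omega0 n))%g.
Proof.
have oo : (Weyl_of_perm (omega0 n) * Weyl_of_perm (omega0 n) = 1)%g.
  by rewrite -{1}omega0V Weyl_of_permV mulVg.
elim: a => [|i a IH] /=; first by rewrite winv_nil mulg1 oo.
move=> /andP[i0 a0]; rewrite !winv_cons (IH a0) sgen_flip //.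
by rewrite !mulgA -[(_ * Weyl_of_perm _ * Weyl_of_perm _)%g]mulgA oo mulg1.
Qed.

(** A letter of a reduced word, if 0, makes a positive entry negative, and otherwise
    only permutes the entries. *)
Lemma count_neg a : red a ->
  (count (fun i : 'I_n => i == 0 :> nat) a =
   \sum_(j < n) (entry (winv a) j < 0)%R)%N.
Proof.
elim: a => [|i a IH] ra.
  rewrite winv_nil big1 // => j _; rewrite /entry /= perm1 mul1r.
  by case: ltP.
have [ra' nd] := red_cons ra; rewrite /= (IH ra') winv_cons.
have [i0|i0] := eqVneq (i : nat) 0%N.
  rewrite (bigD1 i) //= [in RHS](bigD1 i) //= entry_sgen i0 /= eqxx.
  have {nd} nd : (entry (winv a) i < 0) = false by move: nd; rewrite /desc i0 => /negPf.
  have -> : (- entry (winv a) i < 0) by have := entry_neq0 (winv a) i; lia.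
  rewrite nd add0n; congr addn; apply: eq_bigr => j /negPf ji.
  by rewrite entry_sgen i0 /= ji.
rewrite add0n (reindex_inj (@perm_inj _ (tperm (prev_ord i) i))); apply: eq_bigr => j _.
by rewrite entry_sgen (negPf i0).
Qed.

Lemma red_perm_pos a u : red a -> winv a = Weyl_of_perm u ->
  all (fun i : 'I_n => (0 < i)%N) a.
Proof.
move=> ra au; have := count_neg ra; rewrite au big1 => [|j _]; last first.
  by rewrite entry_perm.
move/eqP; rewrite -leqn0 leqNgt -has_count => /hasPn H.
by apply/allP => i /H; rewrite lt0n.
Qed.

Lemma invn_perm u : invn (Weyl_of_perm u) =
  (\sum_(p : 'I_n * 'I_n) (p.1 < p.2) * (u p.2 < u p.1))%N.
Proof.
rewrite /invn [X in (_ + X)%N]big1 => [|j _]; last by rewrite entry_perm.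
rewrite addn0; apply: eq_bigr => p _; rewrite !entry_perm; congr (_ * _)%N.
have -> : ((u p.1).+1%:Z + (u p.2).+1%:Z < 0) = false by lia.
by rewrite addn0; congr nat_of_bool; lia.
Qed.

Lemma sum_pairs_lt : (\sum_(p : 'I_n * 'I_n) (p.1 < p.2) = 'C(n, 2))%N.
Proof.
rewrite -(pair_bigA _ (fun i j : 'I_n => (i < j) : nat)) /= exchange_big /=.
rewrite (eq_bigr (fun j : 'I_n => val j)); last first.
  by move=> j _; rewrite sum_ltn_const //; apply: ltnW.
by rewrite -(big_mkord xpredT id) -bin2_sum.
Qed.

(** All sums of two entries are negative, and the inversions of u w_0 are the pairs
    that are not inverted by u, that is, the inversions of omega_0 u. *)
Lemma invn_mulw0 u : invn (Weyl_of_perm u * w0 n)%g =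
  (invn (Weyl_of_perm (omega0 n * u)%g) + 'C(n, 2) + n)%N.
Proof.
rewrite invn_perm -sum_pairs_lt /invn; congr addn; last first.
  rewrite (eq_bigr (fun=> 1%N)) ?sum_nat_const ?card_ord ?muln1 // => j _.
  by rewrite entry_mulw0; lia.
pose h (p : 'I_n * 'I_n) := (rev_ord p.2, rev_ord p.1).
have hK : involutive h by move=> [i j]; rewrite /h /= !rev_ordK.
rewrite [X in (X + _)%N](reindex_inj (inv_inj hK)) -big_split /=.
apply: eq_bigr => -[i j] _ /=; rewrite !permM !omega0E !rev_ordK !entry_mulw0.
have -> : (n - j.+1 < n - i.+1)%N = (i < j)%N by have := ltn_ord i; have := ltn_ord j; lia.
case: (i < j)%N; rewrite ?mul1n ?mul0n // addnC [RHS]addnC; congr (_ + _)%N.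
Qed.

(** The element u^-1 w_0 is the product of u^-1 omega_0 and of v = (-n, ..., -1), and
    the lengths add up; u^-1 omega_0 is the conjugate by omega_0 of the element
    that gives the type A polynomial of u^*. *)
Lemma reduced_word_C u a : reduced_word (Weyl_of_perm (compg (star u)^-1%g (omega0 n))) a ->
  all (fun i : 'I_n => (0 < i)%N) a /\
  reduced_word (compg (Weyl_of_perm u)^-1%g (w0 n)) (map flip a ++ ord_word (ddG_word n)).
Proof.
rewrite !reduced_wordE => /andP[/eqP aw ra].
have wa : winv a = Weyl_of_perm (omega0 n * u)%g.
  rewrite /winv aw -Weyl_of_permV /compg invMg invgK omega0V.
  have oo : (omega0 n * omega0 n = 1)%g by rewrite -{1}omega0V mulVg.
  by rewrite /star /compg -mulgA oo mulg1.
have a0 := red_perm_pos ra wa; split=> //.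
have wv : winv (map flip a ++ ord_word (ddG_word n)) = (Weyl_of_perm u * w0 n)%g.
  rewrite winv_cat winv_flip // wa -!Weyl_of_permM mulgA -{1}omega0V mulVg mul1g.
  apply: entry_inj => i; rewrite entry_mulw0.
  rewrite entry_permM permM omega0E entry_ddG_word /=; congr (- Posz _).
  by have := ltn_ord (u i); lia.
apply/andP; split.
  apply/eqP/invg_inj; rewrite -/(winv _) wv /compg invMg invgK.
  congr mulg; apply/esym/eqP; rewrite eq_invg_mul; apply/eqP/entry_inj => i.
  by rewrite /entry Defs.sgvalM permM /= !permE /=.
rewrite /red wv size_cat !size_map size_ddG_word invn_mulw0 addnA.
by rewrite (eqP ra) wa.
Qed.

End Words.

(** * Comparison of the two families *)

Lemma coef_prod_linear (R : comNzRingType) n (c : 'I_n -> R) k :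
  (\prod_(i < n) (1 + (c i)%:P * 'X))`_k =
  \sum_(J : {set 'I_n} | #|J| == k) \prod_(i in J) c i.
Proof.
under eq_bigr do rewrite addrC.
rewrite bigA_distr coef_sum [RHS]big_mkcond; apply: eq_bigr => J _.
have -> : \prod_i (if i \in J then (c i)%:P * 'X else 1) = (\prod_(i in J) c i)%:P * 'X^#|J|.
  rewrite -big_mkcond big_split /= prodr_const -rmorph_prod //.
by rewrite coefCM coefXn eq_sym; case: eqP => _; rewrite ?mulr1 ?mulr0.
Qed.

Lemma stairE n R (d : dd_system n R) a k :
  stair d a k = \prod_(i < k) \prod_(j < k.-1 - i) (xv d (a + i) - yv d j).
Proof.
rewrite /stair; elim: k a => [|k IH] a /=; first by rewrite big_ord0.
rewrite IH big_ord_recl addn0 subn0 rootsY_eval; congr (_ * _); apply: eq_bigr => i _.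
have -> : (k - bump 0 i = k.-1 - i)%N by rewrite /bump /=; lia.
by apply: eq_bigr => j _; rewrite /bump /= addnS.
Qed.

Section Comparison.
Variable n' : nat.
Local Notation n := n'.+1.
Implicit Types (f g : polyXY n) (i j : 'I_n) (a b : seq 'I_n) (w : Weyl n).
Local Notation d := (pd n').
Local Opaque divdiff.

Lemma divdiffN i f : divdiff i (- f) = - divdiff i f.
Proof. by rewrite -(inord_val i); apply: (ddN d f (ltn_ord i)). Qed.

Lemma divdiff_sgn i k f : divdiff i ((-1) ^+ k * f) = (-1) ^+ k * divdiff i f.
Proof. by rewrite -signr_odd; case: odd; rewrite ?expr1 ?mulN1r ?divdiffN // expr0 !mul1r. Qed.

Lemma divdiff_comm i j f : (i.+1 < j)%N -> divdiff i (divdiff j f) = divdiff j (divdiff i f).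
Proof.
move=> ij; have H : (i.+1 < j < n)%N by rewrite ij ltn_ord.
by have := ddC d f H; rewrite /= /pdd !inord_val.
Qed.

Lemma divdiff_braid3 i j f : (0 < i)%N -> j = i.+1 :> nat ->
  divdiff i (divdiff j (divdiff i f)) = divdiff j (divdiff i (divdiff j f)).
Proof.
move=> i0 ji; have jn := ltn_ord j; rewrite ji in jn.
by have := dd_braid3 d f i0 jn; rewrite -ji /= /pdd !inord_val.
Qed.

Lemma divdiff_braid4 i j f : i = 0 :> nat -> j = 1 :> nat ->
  divdiff i (divdiff j (divdiff i (divdiff j f))) =
  divdiff j (divdiff i (divdiff j (divdiff i f))).
Proof.
move=> i0 j1; have jn := ltn_ord j; rewrite j1 in jn.
have -> : i = inord 0 by apply: val_inj; rewrite /= inordK.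
have -> : j = inord 1 by apply: val_inj; rewrite /= inordK.
exact: (dd_braid4 d f jn).
Qed.

Lemma divdiff'E i f : divdiff' i f = (-1) ^+ (i != 0 :> nat) * divdiff i f.
Proof. by rewrite /divdiff'; case: eqP => _; rewrite ?expr0 ?mul1r // expr1 mulN1r. Qed.

Lemma foldr_divdiff' f a :
  foldr (@divdiff' n) f a =
  (-1) ^+ count (fun i : 'I_n => i != 0 :> nat) a * foldr (@divdiff n) f a.
Proof.
elim: a => [|i a IH] /=; first by rewrite expr0 mul1r.
by rewrite IH divdiff'E divdiff_sgn mulrA exprD.
Qed.

Lemma divdiff'_comm i j f : (i.+1 < j)%N ->
  divdiff' i (divdiff' j f) = divdiff' j (divdiff' i f).
Proof.
by move=> ij; rewrite !divdiff'E !divdiff_sgn (divdiff_comm _ ij) mulrCA.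
Qed.

Lemma divdiff'_braid3 i j f : (0 < i)%N -> j = i.+1 :> nat ->
  divdiff' i (divdiff' j (divdiff' i f)) = divdiff' j (divdiff' i (divdiff' j f)).
Proof.
move=> i0 ji; apply: (etrans (foldr_divdiff' f [:: i; j; i])).
apply/esym; apply: (etrans (foldr_divdiff' f [:: j; i; j])); apply/esym.
have C : count (fun i : 'I_n => i != 0 :> nat) [:: i; j; i] =
    count (fun i : 'I_n => i != 0 :> nat) [:: j; i; j] by rewrite /= ji -lt0n i0.
have E : foldr (@divdiff n) f [:: i; j; i] = foldr (@divdiff n) f [:: j; i; j].
  exact: divdiff_braid3.
by rewrite C E.
Qed.

Lemma divdiff'_braid4 i j f : i = 0 :> nat -> j = 1 :> nat ->
  divdiff' i (divdiff' j (divdiff' i (divdiff' j f))) =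
  divdiff' j (divdiff' i (divdiff' j (divdiff' i f))).
Proof.
move=> i0 j1; apply: (etrans (foldr_divdiff' f [:: i; j; i; j])).
apply/esym; apply: (etrans (foldr_divdiff' f [:: j; i; j; i])); apply/esym.
have C : count (fun i : 'I_n => i != 0 :> nat) [:: i; j; i; j] =
    count (fun i : 'I_n => i != 0 :> nat) [:: j; i; j; i] by rewrite /= i0 j1.
have E : foldr (@divdiff n) f [:: i; j; i; j] = foldr (@divdiff n) f [:: j; i; j; i].
  exact: divdiff_braid4.
by rewrite C E.
Qed.

Lemma divdiffw'_red w a f : reduced_word w a -> divdiffw' w f = foldr (@divdiff' n) f a.
Proof.
move=> wa; rewrite /divdiffw'; set b := xchoose _.
have wb : reduced_word w b := xchooseP (reduced_word_exists w).
move: wa wb; rewrite !reduced_wordE => /andP[/eqP aw ra] /andP[/eqP bw rb].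
apply: (matsumoto divdiff'_comm divdiff'_braid3 divdiff'_braid4) => //.
by rewrite /winv aw bw.
Qed.

(** * The polynomial of the longest permutation *)

Lemma DeltaXY_stair : DeltaXY n = stair d 0 n.
Proof.
rewrite stairE /DeltaXY; apply: eq_bigr => i _.
rewrite add0n (big_ord_widen n (fun j : nat => px n' i - py n' j)); last by rewrite /=; lia.
apply: eq_big => [j|j _]; last by rewrite /px /py !inord_val.
by have := ltn_ord i; have := ltn_ord j; lia.
Qed.

Lemma mesym_e k : mesym n int k \mPo [tuple xvar i | i < n] = e d n k.
Proof.
rewrite /e /epoly (coef_prod_linear (fun i : 'I_n => px n' i)) /mesym rmorph_sum /=.
apply: eq_bigr => J _; rewrite rmorph_prod; apply: eq_bigr => i _.
by rewrite /= comp_mpolyXU -tnth_nth tnth_mktuple /px inord_val.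
Qed.

Lemma Qtilde_PfQ la : Qtilde n la \mPo [tuple xvar i | i < n] = PfQ d la.
Proof.
rewrite /Qtilde (rmorph_Pfaffian (comp_mpoly [tuple xvar i | i < n])) /PfQ.
congr Pfaffian; apply/matrixP => i j; rewrite !mxE /Qt2 /q2.
rewrite rmorphD !rmorphM rmorph_nat /= /Qt1 !mesym_e; congr (_ + _ * _).
rewrite rmorph_sum; apply: eq_bigr => k _.
by rewrite !rmorphM rmorphXn rmorphN rmorph1 /= !mesym_e.
Qed.

Lemma Y_inv_under (f : {mpoly int[n]}) : inv_under d n (f \mPo [tuple yvar i | i < n]).
Proof.
move=> i _; set phi := comp_mpoly [tuple yvar i | i < n].
apply: (rmorph_mpoly_ext (f := sg d i \o phi) (g := phi)) => k /=.
by rewrite comp_mpolyXU -tnth_nth tnth_mktuple wact_y.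
Qed.

Lemma partsT : parts [set: 'I_n] = rev (iota 1 n).
Proof.
rewrite /parts enum_setT -enumT; congr rev.
by rewrite (map_comp S val) val_enum_ord -[1%N]addn0 iotaDl.
Qed.

Lemma Qtilde_nil : Qtilde n [::] = 1.
Proof.
have one (s : 'S_0) : s = 1%g by apply/permP => -[].
rewrite /Qtilde /Pfaffian (bigD1 1%g) /=; last by apply/andP; split; apply/forallP => -[].
rewrite odd_perm1 expr0 mul1r big_ord0 big_pred0 ?addr0 // => s.
by rewrite (one s) eqxx andbF.
Qed.

Lemma size_parts (A : {set 'I_n}) : size (parts A) = #|A|.
Proof. by rewrite size_rev size_map -cardE. Qed.

(** Any strict partition other than (n, ..., 1) has fewer than n parts, and its
    Qtilde-polynomial is too short to count. *)
Lemma ddG_Delta_QtildeXY :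
  ddG_Delta d (QtildeXY n) = \prod_(k < n) \prod_(j < k) (px n' k + py n' j).
Proof.
rewrite /QtildeXY ddG_Delta_sum (bigD1 setT) //= big1 ?addr0.
  rewrite setCT /parts enum_set0 Qtilde_nil comp_mpoly1 mulr1 -/(parts _) partsT.
  by rewrite Qtilde_PfQ ddG_Delta_PfQ_top ddG_Delta_top.
move=> A AT; rewrite Qtilde_PfQ mulrC ddG_Delta_invl; last exact: Y_inv_under.
rewrite (@ddG_Delta_short _ _ d #|A|.+1) ?mulr0 //.
  have : A \proper [set: 'I_n] by rewrite properT.
  by move/proper_card; rewrite cardsT card_ord.
rewrite -size_parts; apply: lenlt_PfQ; apply/allP => k.
by move/parts_bound/andP => [].
Qed.

Lemma revX_oppY_Delta :
  revX_oppY (DeltaXY n) = \prod_(k < n) \prod_(j < k) (px n' k + py n' j).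
Proof.
rewrite /DeltaXY /revX_oppY rmorph_prod (reindex_inj rev_ord_inj) /=.
apply: eq_bigr => k _; rewrite rmorph_prod.
rewrite (big_ord_widen n (fun j : nat => px n' k + py n' j)); last exact/ltnW.
apply: eq_big => [j|j _].
  by rewrite /=; have := ltn_ord k; have := ltn_ord j; lia.
by rewrite rmorphB /= substXY_x substXY_y rev_ordK opprK /px /py !inord_val.
Qed.

Lemma SchubertC_base : (-1) ^+ (n * n.-1)./2 *
  foldr (@divdiff' n) (DeltaXY n * QtildeXY n) (ord_word n' (ddG_word n)) = revX_oppY (DeltaXY n).
Proof.
rewrite foldr_divdiff' /ord_word count_map foldr_map.
have -> : count (preim (fun i : nat => inord i : 'I_n) (fun i : 'I_n => i != 0 :> nat))
    (ddG_word n) = (n * n.-1)./2.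
  rewrite -bin2 -count_ddG_word; apply: eq_in_count => i icn /=.
  rewrite inordK //; move: icn; elim: {1 3}n (leqnn n) => // m IH mn.
  rewrite ddG_wordS mem_cat mem_rev mem_iota => /orP[|/andP[_]]; first exact/IH/ltnW.
  by rewrite add0n => im; apply: leq_trans mn.
rewrite signrMK.
have -> : foldr (fun (k : nat) z => divdiff (inord k) z) (DeltaXY n * QtildeXY n) (ddG_word n) =
    ddG d n (DeltaXY n * QtildeXY n) by rewrite ddG_foldr.
by rewrite {1}DeltaXY_stair -/(ddG_Delta d _) ddG_Delta_QtildeXY revX_oppY_Delta.
Qed.

(** Reversing the variables X exchanges the differences of neighbouring variables
    up to sign, whence the sign of the operators of type C. *)
Lemma revX_oppY_divdiff i f : (0 < i)%N ->
  revX_oppY (divdiff i f) = divdiff' (flip i) (revX_oppY f).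
Proof.
move=> i0; have fi := val_flip i0; have i_n := ltn_ord i.
have f0 : (flip i == 0 :> nat) = false by rewrite fi; lia.
have pf : prev_ord (flip i) = rev_ord i by apply: val_inj; rewrite /= fi; lia.
have fr : flip i = rev_ord (prev_ord i) by apply: val_inj; rewrite /= fi; lia.
have act g : revX_oppY (wact (sgen i) g) = wact (sgen (flip i)) (revX_oppY g).
  pose phi : {rmorphism polyXY n -> polyXY n} :=
    substXY (fun i => xvar (rev_ord i)) (fun j => - yvar j).
  apply: (polyXY_ext (f := phi \o wact (sgen i)) (g := wact (sgen (flip i)) \o phi)) => k /=.
    rewrite sactS_x // !substXY_x sactS_x ?lt0n ?f0 // pf fr; congr xvar.
    rewrite -(inj_tperm _ _ _ rev_ord_inj) tpermC //.
  by rewrite wact_y !substXY_y rmorphN /= wact_y.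
pose phi : {rmorphism polyXY n -> polyXY n} :=
  substXY (fun i => xvar (rev_ord i)) (fun j => - yvar j).
have phi_den : phi (divdiff_den i) = - divdiff_den (flip i).
  rewrite /divdiff_den f0; have -> : (i == 0 :> nat) = false by lia.
  by rewrite rmorphB /= !substXY_x opprB fr -fr pf.
rewrite /divdiff' f0; apply: (mulIf (divdiff_den_neq0 (flip i))).
transitivity (- (phi f - wact (sgen (flip i)) (phi f))); last first.
  by rewrite -(divdiffE (flip i) (phi f)) mulNr.
have E := congr1 phi (divdiffE i f).
rewrite rmorphM phi_den mulrN rmorphB in E.
by rewrite -(act f) -E opprK.
Qed.

Lemma foldr_revX_oppY f a : all (fun i => (0 < i)%N) a ->
  foldr (@divdiff' n) (revX_oppY f) (map (@flip n') a) = revX_oppY (foldr (@divdiff n) f a).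
Proof.
elim: a => [|i a IH] // /andP[i0 a0].
exact: etrans (congr1 (divdiff' (flip i)) (IH a0)) (esym (revX_oppY_divdiff _ i0)).
Qed.

Lemma foldr_divdiff'_sgn k f a :
  (-1) ^+ k * foldr (@divdiff' n) f a = foldr (@divdiff' n) ((-1) ^+ k * f) a.
Proof.
elim: a => [|i a IH] //.
apply: etrans (congr1 (divdiff' i) IH); rewrite [foldr _ _ _]/=.
by rewrite (divdiff'E i (_ ^+ _ * _)) (divdiff_sgn i k) mulrCA -divdiff'E.
Qed.

Theorem SchubertC_perm (w : 'S_n) : SchubertC (Weyl_of_perm w) = revX_oppY (SchubertA (star w)).
Proof.
rewrite /SchubertC /SchubertA /divdiffw.
set a := xchoose _.
have ra : reduced_word (Weyl_of_perm (compg (star w)^-1%g (omega0 n))) a.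
  exact: xchooseP (reduced_word_exists _).
have [a0 rc] := reduced_word_C ra.
rewrite (divdiffw'_red _ rc) foldr_cat foldr_divdiff'_sgn SchubertC_base.
exact: foldr_revX_oppY.
Qed.

End Comparison.

(** * Positivity *)

Section PositivePolynomials.
Variables (N : nat).
Implicit Types (f g : {mpoly int[N]}).

Definition pos f := forall m, 0 <= f@_m.

Lemma pos0 : pos 0. Proof. by move=> m; rewrite mcoeff0. Qed.

Lemma posD f g : pos f -> pos g -> pos (f + g).
Proof. by move=> pf pg m; rewrite mcoeffD addr_ge0. Qed.

Lemma posM f g : pos f -> pos g -> pos (f * g).
Proof. by move=> pf pg m; rewrite mcoeffM sumr_ge0 // => k _; rewrite mulr_ge0. Qed.

Lemma posC (c : int) : 0 <= c -> pos c%:MP.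
Proof. by move=> c0 m; rewrite mcoeffC mulr_ge0. Qed.

Lemma posX i : pos 'X_i.
Proof. by move=> m; rewrite mcoeffX. Qed.

Lemma pos_comp k (lq : N.-tuple {mpoly int[k]}) f :
  pos f -> (forall i, forall m, 0 <= (tnth lq i)@_m) ->
  forall m, 0 <= (f \mPo lq)@_m.
Proof.
move=> pf plq; rewrite comp_mpolyE.
have pM (u v : {mpoly int[k]}) : (forall m, 0 <= u@_m) -> (forall m, 0 <= v@_m) ->
    forall m, 0 <= (u * v)@_m.
  by move=> pu pv m; rewrite mcoeffM sumr_ge0 // => l _; rewrite mulr_ge0.
have p1 m : 0 <= (1 : {mpoly int[k]})@_m by rewrite mcoeff1.
have pX (a : 'X_{1..N}) m : 0 <= (\prod_(i < N) tnth lq i ^+ a i)@_m.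
  move: m; apply: (big_ind (fun u : {mpoly int[k]} => forall m, 0 <= u@_m)) => // i _.
  by elim: (a i : nat) => [|l IH]; rewrite ?expr0 // exprS; apply: pM.
by move=> m; rewrite raddf_sum sumr_ge0 // => a _ /=; rewrite mcoeffZ mulr_ge0.
Qed.

End PositivePolynomials.

Lemma dd_commute (R : idomainType) (s t : {rmorphism R -> R}) (D T : R -> R) (al be : R) :
  al != 0 -> be != 0 -> (forall f, D f * al = f - s f) -> (forall f, T f * be = f - t f) ->
  s be = be -> t al = al -> (forall f, s (t f) = t (s f)) ->
  forall f, D (T f) = T (D f).
Proof.
move=> al0 be0 DE TE sbe tal st f; apply: (mulIf al0); apply: (mulIf be0).
rewrite DE mulrBl -{2}sbe -rmorphM !TE mulrAC TE mulrBl -{2}tal -rmorphM !DE.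
by rewrite !rmorphB st; ring.
Qed.

Section AbstractPositivity.
Variables (n : nat) (R : idomainType) (d : dd_system n R).
Local Notation x := (xv d).
Local Notation dd_chain := (dd_chain d).

(** The borderline case of [dd_chain_pow]. *)
Lemma dd_chain_pow_top a k : (a + k < n)%N -> dd_chain a.+1 k (x a ^+ k) = 1.
Proof.
elim: k a => [|k IH] a akn //=; have an : (a.+1 < n)%N by lia.
have := dd_monomial_ge d 0 k.+1 an; rewrite expr0 mulr1 !add0n => ->.
rewrite dd_chain_sum; last lia.
rewrite big_ord_recr /= !add0n subnn expr0 mul1r IH; last lia.
rewrite big1 ?add0r // => i _; have ik := ltn_ord i.
rewrite dd_chain_invl; [by rewrite dd_chain_pow ?mulr0 //; lia | lia |].
by case=> // j aj; rewrite rmorphXn sgx //; lia.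
Qed.

Fixpoint ddA m f : R := if m is m'.+1 then ddA m' (dd_chain 1 m' f) else f.

(** The operator of the longest permutation maps Delta to 1: each chain removes the
    first factor of the staircase, whose leading coefficient is 1. *)
Lemma ddA_stair m : (m <= n)%N -> ddA m (stair d 0 m) = 1.
Proof.
elim: m => [|m IH] mn //; apply: (etrans (y := ddA m (stair d 0 m))); last exact/IH/ltnW.
change (ddA m (dd_chain 1 m (stair d 0 m.+1)) = ddA m (stair d 0 m)); congr (ddA _ _).
have -> : stair d 0 m.+1 = (rootsY d m).[x 0] * gen_stair d (rootsY d) 1 m by [].
have Hc i : (i < n)%N -> forall j, sg d i (rootsY d m)`_j = (rootsY d m)`_j.
  by move=> i_n j; rewrite -{2}(@rootsY_inv _ _ d i m i_n) coef_map.
rewrite dd_chain_shift //.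
- rewrite (@horner_coef_wide _ m.+1); last by rewrite size_rootsY.
  rewrite dd_chain_sum; last by lia.
  rewrite big_ord_recr /= big1 ?add0r; last first.
    move=> i _; rewrite dd_chain_invl; [by rewrite dd_chain_pow ?mulr0 | lia |].
    by move=> j jm; apply: Hc; lia.
  rewrite dd_chain_invl; [|lia|by move=> j jm; apply: Hc; lia].
  rewrite dd_chain_pow_top //; have : rootsY d m \is monic by apply: monic_prod_XsubC.
  by move/monicP; rewrite lead_coefE size_rootsY /= => ->; rewrite !mul1r.
- by move=> k; rewrite size_rootsY.
- by move=> i k; apply: rootsY_inv.
move=> i im; rewrite (sg_H (H := rootsY d)); [|by move=> *; apply: rootsY_inv|lia].
by case: i im => // i im; rewrite sgx //; lia.
Qed.

Lemma stair_scale (phi : {rmorphism R -> R}) (c : R) a k :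
  (forall i j, phi (x i - yv d j) = c * (x i - yv d j)) ->
  phi (stair d a k) = c ^+ 'C(k, 2) * stair d a k.
Proof.
move=> H; rewrite /stair; elim: k a => [|k IH] a /=; first by rewrite rmorph1 mulr1.
rewrite rmorphM IH rootsY_eval rmorph_prod (eq_bigr (fun j : 'I_k => c * (x a - yv d j))) //.
by rewrite big_split /= prodr_const card_ord binS bin1 exprD; ring.
Qed.

Definition ddA_word (m : nat) : seq nat :=
  (fix w m := if m is m'.+1 then w m' ++ rev (iota 1 m') else [::]) m.

Lemma ddA_foldr m f : ddA m f = foldr (dd d) f (ddA_word m).
Proof.
elim: m f => [|m IH] f //; have -> : ddA m.+1 f = ddA m (dd_chain 1 m f) by [].
by rewrite IH dd_chain_foldr -foldr_cat.
Qed.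

Lemma size_ddA_word m : size (ddA_word m) = 'C(m, 2).
Proof.
elim: m => [|m IH] //; have -> : ddA_word m.+1 = ddA_word m ++ rev (iota 1 m) by [].
by rewrite size_cat IH size_rev size_iota binS bin1.
Qed.

Lemma ddA_word_pos m i : i \in ddA_word m -> (0 < i < m)%N.
Proof.
elim: m => [|m IH] //; have -> : ddA_word m.+1 = ddA_word m ++ rev (iota 1 m) by [].
by rewrite mem_cat mem_rev mem_iota => /orP[/IH|]; lia.
Qed.

End AbstractPositivity.

Section Positivity.
Variable n' : nat.
Local Notation n := n'.+1.
Implicit Types (f g : polyXY n) (i j : 'I_n) (a b : seq 'I_n).
Local Notation d := (pd n').
Local Opaque divdiff.

Local Notation pletters a := (all (fun i : 'I_n => (0 < i)%N) a).

Definition oppY : {rmorphism polyXY n -> polyXY n} := substXY (@xvar n) (fun j => - yvar j).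

(** The polynomials with nonnegative coefficients in X and - Y. *)
Definition pn f := pos (oppY f).

Lemma pn0 : pn 0. Proof. by rewrite /pn rmorph0; apply: pos0. Qed.
Lemma pnD f g : pn f -> pn g -> pn (f + g).
Proof. by rewrite /pn rmorphD; apply: posD. Qed.
Lemma pnM f g : pn f -> pn g -> pn (f * g).
Proof. by rewrite /pn rmorphM; apply: posM. Qed.
Lemma pn_sub_trans f g h : pn (f - g) -> pn (g - h) -> pn (f - h).
Proof. by move=> fg gh; have := pnD fg gh; rewrite addrA subrK. Qed.
Lemma pn_x i : pn (xvar i).
Proof. by rewrite /pn /= substXY_x; apply: posX. Qed.
Lemma pn_Ny j : pn (- yvar j).
Proof. by rewrite /pn rmorphN /= substXY_y opprK; apply: posX. Qed.

Lemma pos_substXY (A B : 'I_n -> polyXY n) f : (forall i, pos (A i)) -> (forall j, pos (B j)) ->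
  pos f -> pos (substXY A B f).
Proof.
move=> pA pB pf; apply: pos_comp => // k; rewrite tnth_mktuple.
by case: split.
Qed.

Lemma pn_subst (A B : 'I_n -> polyXY n) f : (forall i, pn (A i)) -> (forall j, pn (- B j)) ->
  pn f -> pn (substXY A B f).
Proof.
move=> pA pB pf; rewrite /pn.
pose th : {rmorphism polyXY n -> polyXY n} := substXY A B.
pose th' : {rmorphism polyXY n -> polyXY n} :=
  substXY (fun i => oppY (A i)) (fun j => oppY (- B j)).
have -> : oppY (substXY A B f) = th' (oppY f).
  apply: (polyXY_ext (f := oppY \o th) (g := th' \o oppY)) => k /=.
    by rewrite !substXY_x.
  by rewrite !substXY_y rmorphN /= substXY_y rmorphN opprK.
exact: pos_substXY.
Qed.

Lemma pn_revX_oppY f : pn f -> pos (revX_oppY f).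
Proof.
move=> pf.
pose th : {rmorphism polyXY n -> polyXY n} := substXY (fun i => xvar (rev_ord i)) (@yvar n).
pose ph : {rmorphism polyXY n -> polyXY n} :=
  substXY (fun i => xvar (rev_ord i)) (fun j => - yvar j).
have -> : revX_oppY f = th (oppY f).
  apply: (polyXY_ext (f := ph) (g := th \o oppY)) => k /=; first by rewrite !substXY_x.
  by rewrite !substXY_y rmorphN /= substXY_y.
by apply: pos_substXY => // i; apply: posX.
Qed.

(** f(x_0, ..., x_(k-1), 0, x_k, ..., x_(n-2)), the last variable being dropped. *)
Definition ins0 (k : nat) : {rmorphism polyXY n -> polyXY n} :=
  substXY (fun j => if (j < k)%N then xvar j else if j == k :> nat then 0 else xvar (prev_ord j))
    (@yvar n).

Lemma pn_ins0 k f : pn f -> pn (ins0 k f).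
Proof.
apply: pn_subst => [i|j]; last exact: pn_Ny.
by case: ifP => _; [exact: pn_x | case: ifP => _; [exact: pn0 | exact: pn_x]].
Qed.

(** The reflection s_i moves the inserted 0 from one place to the next, and the root
    becomes - x_(i-1) when the 0 is inserted. *)
Lemma ins0_step i f : (0 < i)%N ->
  ins0 i f = ins0 i.-1 f + xvar (prev_ord i) * ins0 i.-1 (divdiff i f).
Proof.
move=> i0.
have act : ins0 i f = ins0 i.-1 (wact (sgen i) f).
  apply: (polyXY_ext (f := ins0 i) (g := ins0 i.-1 \o wact (sgen i))) => k;
    rewrite /ins0 /=; last by rewrite wact_y !substXY_y.
  rewrite sactS_x // !substXY_x; case: tpermP => [->|->|/eqP k1 /eqP k2] /=.
  - have -> : (i.-1 < i)%N by lia.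
    have -> : (i < i.-1)%N = false by lia.
    by have -> : (i == i.-1 :> nat) = false by lia.
  - by rewrite !ltnn !eqxx.
  move: k1 k2; rewrite -!val_eqE /= => k1 k2.
  have -> : (k < i.-1)%N = (k < i)%N by lia.
  by rewrite (negPf k1) (negPf k2).
have E := congr1 (ins0 i.-1) (divdiffE i f).
have E0 : (i == 0 :> nat) = false by lia.
have Eden : ins0 i.-1 (divdiff_den i) = - xvar (prev_ord i).
  rewrite /divdiff_den E0 rmorphB /= !substXY_x /= ltnn eqxx.
  have -> : (i < i.-1)%N = false by lia.
  have -> : (i == i.-1 :> nat) = false by lia.
  by rewrite sub0r.
rewrite rmorphM Eden mulrN rmorphB -act in E.
by rewrite mulrC -[X in _ + X]opprK E opprB addrC subrK.
Qed.

Lemma pn_ins0_diff f k : (k < n)%N -> (forall i, (0 < i)%N -> pn (divdiff i f)) ->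
  pn (ins0 k f - ins0 0 f).
Proof.
move=> kn pf; elim: k kn => [|k IH] kn; first by rewrite subrr; apply: pn0.
have := @ins0_step (Ordinal kn) f isT; rewrite [nat_of_ord _]/= [k.+1.-1]/= => ->.
rewrite addrAC; apply: pnD; first exact/IH/ltnW.
by apply: pnM; [exact: pn_x | apply/pn_ins0/pf].
Qed.

(** f(0, ..., 0, x_0, ..., x_(n-k-1)): the zeros are inserted one by one, those
    before the last one being kept in front. *)
Definition zeroX (k : nat) : {rmorphism polyXY n -> polyXY n} :=
  substXY (fun j => if (j < k)%N then 0 else xvar (inord (j - k))) (@yvar n).

Lemma pn_zeroX k f : pn f -> pn (zeroX k f).
Proof.
apply: pn_subst => [i|j]; last exact: pn_Ny.
by case: ifP => _; [exact: pn0 | exact: pn_x].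
Qed.

Lemma zeroX0 f : zeroX 0 f = f.
Proof.
apply: (polyXY_ext (f := zeroX 0) (g := idfun)) => k /=; last by rewrite substXY_y.
by rewrite substXY_x subn0 inord_val.
Qed.

Lemma zeroXS k f : zeroX k.+1 f = zeroX k (ins0 0 f).
Proof.
apply: (polyXY_ext (f := zeroX k.+1) (g := zeroX k \o ins0 0)) => j /=;
  last by rewrite !substXY_y.
rewrite !substXY_x; case: eqP => [->|/eqP j0]; first by rewrite rmorph0.
rewrite substXY_x /=; have -> : (j.-1 < k)%N = (j < k.+1)%N by lia.
by case: ifP => // _; congr (xvar (inord _)); lia.
Qed.

(** Each inserted 0 changes f by a sum of terms x_k R (d_i f), where R inserts a 0,
    and the insertion at the last place changes nothing. *)
Lemma pn_zeroX_diff f : ins0 n' f = f -> (forall i, (0 < i)%N -> pn (divdiff i f)) ->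
  pn (f - zeroX n f).
Proof.
move=> fl pf; have p1 : pn (f - ins0 0 f) by rewrite -{1}fl; apply: pn_ins0_diff.
suff : forall k, pn (f - zeroX k f) by apply.
elim=> [|k IH]; first by rewrite zeroX0 subrr; apply: pn0.
rewrite zeroXS; apply: pn_sub_trans IH _.
have -> : zeroX k f - zeroX k (ins0 0 f) = zeroX k (f - ins0 0 f) by rewrite (rmorphB (zeroX k)).
exact: pn_zeroX.
Qed.

Definition swapXY : {rmorphism polyXY n -> polyXY n} :=
  substXY (fun i => - yvar i) (fun j => - xvar j).

Lemma swapXY_x i : swapXY (xvar i) = - yvar i. Proof. exact: substXY_x. Qed.
Lemma swapXY_y j : swapXY (yvar j) = - xvar j. Proof. exact: substXY_y. Qed.

Lemma swapXYN f : swapXY (- f) = - swapXY f. Proof. exact: rmorphN. Qed.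

Lemma wactN w f : wact w (- f) = - wact w f :> polyXY n. Proof. exact: rmorphN. Qed.

Lemma swapXYK f : swapXY (swapXY f) = f.
Proof.
apply: (polyXY_ext (f := swapXY \o swapXY) (g := idfun)) => k; rewrite [LHS]/=.
  by rewrite [X in substXY _ _ X]substXY_x rmorphN /= substXY_y opprK.
by rewrite [X in substXY _ _ X]substXY_y rmorphN /= substXY_x opprK.
Qed.

Lemma pn_swapXY f : pn f -> pn (swapXY f).
Proof.
apply: pn_subst => k; first exact: pn_Ny.
by rewrite opprK; apply: pn_x.
Qed.

Local Notation inD := (fun p : 'I_n * 'I_n => (p.1.+1 + p.2.+1 <= n)%N).

Lemma Delta_pair : DeltaXY n = \prod_(p | inD p) (xvar p.1 - yvar p.2).
Proof.
rewrite /DeltaXY (pair_big_dep xpredT (fun i j : 'I_n => (i.+1 + j.+1 <= n)%N)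
  (fun i j => xvar i - yvar j)) //=.
Qed.

Definition swapP (p : 'I_n * 'I_n) := (p.2, p.1).
Lemma swapPK : involutive swapP. Proof. by case. Qed.

Lemma swapXY_factor p : swapXY (xvar p.1 - yvar p.2) = xvar p.2 - yvar p.1 :> polyXY n.
Proof. by rewrite rmorphB swapXY_x swapXY_y opprK addrC. Qed.

Lemma swapXY_Delta : swapXY (DeltaXY n) = DeltaXY n.
Proof.
rewrite {1}Delta_pair rmorph_prod (reindex_inj (inv_inj swapPK)) Delta_pair.
apply: eq_big => [p|p _]; first by rewrite /= addnC.
by rewrite swapXY_factor.
Qed.

Lemma divdiff_Delta i : (0 < i)%N ->
  divdiff i (DeltaXY n) =
  \prod_(p | inD p && (p != (prev_ord i, rev_ord i))) (xvar p.1 - yvar p.2).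
Proof.
move=> i0; have i_n := ltn_ord i; set K := \prod_(p | _) _.
have DK : DeltaXY n = (xvar (prev_ord i) - yvar (rev_ord i)) * K.
  by rewrite Delta_pair (bigD1 (prev_ord i, rev_ord i)) //=; lia.
have act1 k : wact (sgen i) (xvar k) = xvar (tperm (prev_ord i) i k) :> polyXY n by exact: sactS_x.
have SK : wact (sgen i) K = K.
  pose h (p : 'I_n * 'I_n) := (tperm (prev_ord i) i p.1, p.2).
  have hK : involutive h by move=> [k l]; rewrite /h /= tpermK.
  rewrite /K rmorph_prod (reindex_inj (inv_inj hK)).
  apply: eq_big => [[k l]|[k l] _]; last by rewrite rmorphB /= act1 wact_y tpermK.
  rewrite /h /= !xpair_eqE -!val_eqE /=.
  case: tpermP => [->|->|/eqP k1 /eqP k2] /=; [lia | lia |].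
  by move: k1 k2; rewrite -!val_eqE /=.
have E0 : (i == 0 :> nat) = false by lia.
apply: (mulIf (divdiff_den_neq0 i)); apply: (etrans (divdiffE i _)).
rewrite DK rmorphM /= SK rmorphB /= act1 tpermL wact_y /divdiff_den E0 -mulrBl mulrC.
by rewrite opprB addrA subrK.
Qed.

Lemma swapXY_divdiff_Delta i : (0 < i)%N ->
  swapXY (divdiff i (DeltaXY n)) = divdiff (flip i) (DeltaXY n).
Proof.
move=> i0; have fi := val_flip i0; have i_n := ltn_ord i.
have f0 : (0 < flip i)%N by rewrite fi; lia.
rewrite (divdiff_Delta i0) (divdiff_Delta f0).
have -> : prev_ord (flip i) = rev_ord i by apply: val_inj; rewrite /= fi; lia.
have -> : rev_ord (flip i) = prev_ord i by apply: val_inj; rewrite /= fi; lia.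
rewrite rmorph_prod (reindex_inj (inv_inj swapPK)).
apply: eq_big => [[k l]|p _]; last by rewrite swapXY_factor.
by rewrite /swapP /= !xpair_eqE addnC andbC [RHS]andbC [(l == _) && _]andbC.
Qed.

Definition divdiffY i f := swapXY (divdiff i (swapXY f)).

Lemma divdiffY_comm i j f : (0 < i)%N -> (0 < j)%N ->
  divdiff i (divdiffY j f) = divdiffY j (divdiff i f).
Proof.
move=> i0 j0.
pose t : {rmorphism polyXY n -> polyXY n} := swapXY \o wact (sgen j) \o swapXY.
have tE g : t g = swapXY (wact (sgen j) (swapXY g)) by [].
have ty k : t (xvar k) = xvar k.
  by rewrite tE swapXY_x wactN wact_y swapXYN swapXY_y opprK.
have tx k : t (yvar k) = yvar (tperm (prev_ord j) j k).
  by rewrite tE swapXY_y wactN sactS_x // swapXYN swapXY_x opprK.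
have i0' : (i == 0 :> nat) = false by lia.
have j0' : (j == 0 :> nat) = false by lia.
have beE : swapXY (divdiff_den j) = yvar j - yvar (prev_ord j).
  by rewrite /divdiff_den j0' rmorphB !swapXY_x opprK addrC.
apply: (dd_commute (s := wact (sgen i)) (t := t) (al := divdiff_den i)
  (be := swapXY (divdiff_den j))).
- exact: divdiff_den_neq0.
- by apply: contraNneq (divdiff_den_neq0 j) => H; rewrite -(swapXYK (divdiff_den j)) H rmorph0.
- exact: divdiffE.
- move=> g; rewrite /divdiffY -rmorphM.
  apply: (etrans (congr1 swapXY (divdiffE j (swapXY g)))).
  by rewrite rmorphB swapXYK.
- by rewrite beE rmorphB /= !wact_y.
- have tB g h : t (g - h) = t g - t h by exact: rmorphB.
  by rewrite /divdiff_den i0' tB !ty.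
move=> g; apply: (polyXY_ext (f := wact (sgen i) \o t) (g := t \o wact (sgen i))) => k.
  change (wact (sgen i) (t (xvar k)) = t (wact (sgen i) (xvar k))).
  by rewrite ty sactS_x // ty.
change (wact (sgen i) (t (yvar k)) = t (wact (sgen i) (yvar k))).
by rewrite tx !wact_y tx.
Qed.

Local Notation ddw a := (foldr (@divdiff n) (DeltaXY n) a).

Lemma divdiffY_foldr i f a : (0 < i)%N -> pletters a ->
  divdiffY i (foldr (@divdiff n) f a) = foldr (@divdiff n) (divdiffY i f) a.
Proof.
move=> i0; elim: a => [|j a IH] // /andP[j0 a0].
exact: etrans (esym (divdiffY_comm _ j0 i0)) (congr1 (divdiff j) (IH a0)).
Qed.

(** This is the symmetry between the type A double Schubert polynomials of an element
    and of its inverse.  The divided difference i of Delta in X is the divided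
    difference n - i in - Y, and these commute with those in X: so the letters can
    be moved one by one to the other set of variables, which reverses the word. *)
Lemma swapXY_ddw a : pletters a -> swapXY (ddw a) = ddw (rev (map (@flip n') a)).
Proof.
elim: a => [|i a IH]; first by rewrite [ddw _]/= swapXY_Delta.
move=> /andP[i0 a0].
have -> : swapXY (ddw (i :: a)) = divdiffY i (swapXY (ddw a)).
  by rewrite /divdiffY swapXYK.
rewrite (IH a0) divdiffY_foldr //; last first.
  rewrite all_rev all_map; apply: sub_all a0 => j j0 /=.
  by rewrite val_flip //; have := ltn_ord j; lia.
rewrite map_cons rev_cons foldr_rcons; congr (foldr _ _ _).
by rewrite /divdiffY swapXY_Delta swapXY_divdiff_Delta.
Qed.

(** The last variable of Y does not occur in Delta, and the divided differences in X
    do not bring it in; the symmetry exchanges it with the last variable of X. *)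
Lemma ins0_ddw a : pletters a -> ins0 n' (ddw a) = ddw a.
Proof.
move=> a0.
pose L : {rmorphism polyXY n -> polyXY n} :=
  substXY (@xvar n) (fun j => if j == n' :> nat then 0 else yvar j).
have LD f b : pletters b -> L (foldr (@divdiff n) f b) = foldr (@divdiff n) (L f) b.
  elim: b => [|i b IH] // /andP[i0 b0].
  have act g : L (wact (sgen i) g) = wact (sgen i) (L g).
    apply: (polyXY_ext (f := L \o wact (sgen i)) (g := wact (sgen i) \o L)) => k /=.
      by rewrite sactS_x // !substXY_x sactS_x.
    rewrite wact_y !substXY_y; case: ifP => _; first by rewrite rmorph0.
    by rewrite wact_y.
  have Lden : L (divdiff_den i) = divdiff_den i.
    rewrite /divdiff_den; have -> : (i == 0 :> nat) = false by lia.
    by rewrite rmorphB /= !substXY_x.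
  apply: etrans _ (congr1 (divdiff i) (IH b0)).
  apply: (mulIf (divdiff_den_neq0 i)); apply/esym; apply: (etrans (divdiffE i _)).
  set g := foldr _ f b; transitivity (L (divdiff i g) * L (divdiff_den i)); last by rewrite Lden.
  rewrite -act -[LHS](rmorphB L) -[RHS](rmorphM L); congr (L _).
  exact/esym/divdiffE.
have LDelta : L (DeltaXY n) = DeltaXY n.
  rewrite Delta_pair rmorph_prod; apply: eq_bigr => -[k l] kl.
  rewrite rmorphB /= substXY_x substXY_y; have -> : (l == n' :> nat) = false; last by [].
  by move: kl => /=; lia.
have iL f : ins0 n' (swapXY f) = swapXY (L f).
  apply: (polyXY_ext (f := ins0 n' \o swapXY) (g := swapXY \o L)) => k /=.
    by rewrite [X in substXY _ _ X = _]substXY_x [X in _ = substXY _ _ X]substXY_x substXY_x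
      rmorphN /= substXY_y.
  rewrite [X in substXY _ _ X = _]substXY_y [X in _ = substXY _ _ X]substXY_y rmorphN /= substXY_x.
  have kn := ltn_ord k; case: ltnP => kn'.
    by rewrite ltn_eqF // substXY_y.
  have -> : (k == n' :> nat) by lia.
  by rewrite rmorph0 oppr0.
have a'0 : pletters (rev (map (@flip n') a)).
  rewrite all_rev all_map; apply: sub_all a0 => j j0 /=.
  by rewrite val_flip //; have := ltn_ord j; lia.
have E : ddw a = swapXY (ddw (rev (map (@flip n') a))) by rewrite -(swapXY_ddw a0) swapXYK.
rewrite E; apply: (etrans (iL _)); congr (swapXY _).
by apply: (etrans (LD _ _ a'0)); rewrite LDelta.
Qed.

Lemma nonred_foldr f a : ~~ red a -> foldr (@divdiff n) f a = 0.
Proof.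
have dz i : divdiff i 0 = 0 :> polyXY n.
  by rewrite -(inord_val i); apply: (dd0 d (ltn_ord i)).
elim: a => [|i a IH]; first by rewrite /red winv_nil invn1.
case: (boolP (red a)) => ra nr.
  have [c Ec] := nonred_cons (@divdiff_comm n') (@divdiff_braid3 n') (@divdiff_braid4 n') ra nr.
  apply: (etrans (congr1 (divdiff i) (Ec f))).
  by rewrite -(inord_val i); apply: (dd_sqr d _ (ltn_ord i)).
exact: etrans (congr1 (divdiff i) (IH ra)) (dz i).
Qed.

Lemma pletters_perm a : pletters a -> exists u : 'S_n, winv a = Weyl_of_perm u.
Proof.
elim: a => [|i a IH].
  exists 1%g; apply: entry_inj => j; rewrite winv_nil entry_perm perm1.
  by rewrite /entry /= perm1 mul1r.
move=> /andP[i0 /IH[u au]]; exists (tperm (prev_ord i) i * u)%g.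
by rewrite winv_cons au sgen_pos // -Weyl_of_permM.
Qed.

Lemma invn_perm_max (u : 'S_n) : (invn (Weyl_of_perm u) <= 'C(n, 2))%N /\
  ('C(n, 2) <= invn (Weyl_of_perm u) -> u = omega0 n)%N.
Proof.
rewrite invn_perm -(sum_pairs_lt n').
have le (p : 'I_n * 'I_n) : ((p.1 < p.2) * (u p.2 < u p.1) <= (p.1 < p.2))%N.
  by case: (p.1 < p.2)%N; case: (u p.2 < u p.1)%N.
split=> [|ge]; first by apply: leq_sum => p _; apply: le.
have eqs (p : 'I_n * 'I_n) : ((p.1 < p.2) * (u p.2 < u p.1) = (p.1 < p.2))%N.
  apply/eqP/negPn/negP => ne; move: ge; apply/negP; rewrite -ltnNge.
  rewrite (bigD1 p) //= [X in (_ < X)%N](bigD1 p) //= -addSn.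
  apply: leq_add; first by rewrite ltn_neqAle ne le.
  by apply: leq_sum => q _; apply: le.
have dec (k l : 'I_n) : (k < l)%N -> (u l < u k)%N.
  by move=> kl; have := eqs (k, l); rewrite /= kl mul1n; case: (u l < u k)%N.
(* a strictly decreasing sequence of n numbers less than n *)
have hi m (k : 'I_n) : k = m :> nat -> (u k + m < n)%N.
  elim: m k => [|m IH] k km; first by rewrite addn0.
  have mn : (m < n)%N by have := ltn_ord k; lia.
  have := IH (Ordinal mn) erefl; have := dec (Ordinal mn) k; rewrite /= km ltnSn => /(_ isT).
  by lia.
have lo m (k : 'I_n) : (k + m = n')%N -> (m <= u k)%N.
  elim: m k => [|m IH] k km //.
  have kn : (k.+1 < n)%N by lia.
  have := IH (Ordinal kn); rewrite /= => /(_ _); have := dec k (Ordinal kn) (ltnSn k).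
  by lia.
apply/permP => k; apply: val_inj; rewrite omega0E /=.
have kn := ltn_ord k; have := hi k k erefl; have := lo (n' - k)%N k; lia.
Qed.

(** The reduced words of maximal length all belong to omega_0, so it suffices to
    compute the value for one of them, which [ddA_stair] does. *)
Lemma ddw_top a : pletters a -> size a = 'C(n, 2) -> ddw a = 0 \/ ddw a = 1.
Proof.
move=> a0 sa; case: (boolP (red a)) => ra; last by left; apply: nonred_foldr.
right; pose b := ord_word n' (ddA_word n).
have b0 : pletters b.
  by rewrite all_map; apply/allP => i /ddA_word_pos /andP[i0 i_n]; rewrite /= inordK.
have b1 : ddw b = 1.
  rewrite DeltaXY_stair /b /ord_word foldr_map.
  exact: etrans (esym (ddA_foldr d n _)) (ddA_stair d (leqnn n)).
have rb : red b.
  apply/negPn/negP => /(nonred_foldr (DeltaXY n)); rewrite b1 => /eqP.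
  by rewrite oner_eq0.
have top c : pletters c -> red c -> size c = 'C(n, 2) -> winv c = Weyl_of_perm (omega0 n).
  move=> c0 /eqP rc sc; have [u cu] := pletters_perm c0.
  have [_ H] := invn_perm_max u; rewrite cu; congr Weyl_of_perm; apply: H.
  by rewrite -cu -rc sc.
rewrite -b1; apply: (matsumoto (@divdiff_comm n') (@divdiff_braid3 n') (@divdiff_braid4 n')) => //.
by rewrite !top // /b size_map size_ddA_word.
Qed.

Definition scale2 : {rmorphism polyXY n -> polyXY n} :=
  substXY (fun i => 2%:R * xvar i) (fun j => 2%:R * yvar j).

(** Homogeneity, expressed by scaling the variables by 2. *)
Lemma scale2_ddw a : pletters a -> (size a <= 'C(n, 2))%N ->
  scale2 (ddw a) = 2%:R ^+ ('C(n, 2) - size a) * ddw a.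
Proof.
elim: a => [|i a IH].
  move=> _ _; rewrite subn0 [ddw _]/= DeltaXY_stair; apply: stair_scale => k l.
  by rewrite rmorphB /= substXY_x substXY_y mulrBr.
move=> /andP[i0 a0] sa; have sa' : (size a <= 'C(n, 2))%N by apply: ltnW.
have {}IH := IH a0 sa'.
have act g : scale2 (wact (sgen i) g) = wact (sgen i) (scale2 g).
  apply: (polyXY_ext (f := scale2 \o wact (sgen i)) (g := wact (sgen i) \o scale2)) => k /=.
    by rewrite sactS_x // !substXY_x rmorphM rmorph_nat /= sactS_x.
  by rewrite wact_y !substXY_y rmorphM rmorph_nat /= wact_y.
have Eden : scale2 (divdiff_den i) = 2%:R * divdiff_den i.
  rewrite /divdiff_den; have -> : (i == 0 :> nat) = false by lia.
  by rewrite rmorphB /= !substXY_x mulrBr.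
have n2 : 2%:R != 0 :> polyXY n.
  by rewrite -(rmorph_nat (@mpolyC (n + n) int)) mpolyC_eq0.
apply: (mulIf n2); apply: (mulIf (divdiff_den_neq0 i)).
set g := ddw a in IH *.
transitivity (scale2 (divdiff i g) * scale2 (divdiff_den i)); first by rewrite Eden mulrA.
rewrite -rmorphM; apply: (etrans (congr1 scale2 (divdiffE i g))).
rewrite rmorphB act IH rmorphM rmorphXn rmorph_nat -mulrBr.
rewrite -(divdiffE i g) (_ : 'C(n, 2) - size a = ('C(n, 2) - (size a).+1).+1)%N; last first.
  by rewrite subnSK.
by rewrite exprS; set u := 2%:R; rewrite [u * _]mulrC !mulrA [X in X * _]mulrAC.
Qed.

Lemma mcoeff0X k : ('X_k : polyXY n)@_0%MM = 0.
Proof.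
rewrite mcoeffX; case: eqP => // /(congr1 (fun m : 'X_{1..n + n} => m k)).
by rewrite mnm1E eqxx mnm0E.
Qed.

Lemma mcoeff0_scale2 f : (scale2 f)@_0%MM = f@_0%MM.
Proof.
apply: (polyXY_ext (f := (mcoeff 0%MM : {rmorphism polyXY n -> int}) \o scale2)
  (g := (mcoeff 0%MM : {rmorphism polyXY n -> int}))) => k /=.
  by rewrite substXY_x mulr_natl mcoeffMn !mcoeff0X mul0rn.
by rewrite substXY_y mulr_natl mcoeffMn !mcoeff0X mul0rn.
Qed.

Lemma pn_ddw_const a : pletters a -> 0 <= (ddw a)@_0%MM.
Proof.
move=> a0; case: (ltngtP (size a) 'C(n, 2)) => sa; last first.
- by case: (ddw_top a0 sa) => ->; rewrite ?mcoeff0 ?mcoeff1.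
- rewrite nonred_foldr ?mcoeff0 //; apply/negP => /eqP ra.
  have [u au] := pletters_perm a0; have [H _] := invn_perm_max u.
  by move: H; rewrite -au -ra; lia.
have := congr1 (mcoeff 0%MM) (scale2_ddw a0 (ltnW sa)).
rewrite mcoeff0_scale2 -natrX mulr_natl mcoeffMn -mulr_natl natz => E.
have q1 : (2 ^ ('C(n, 2) - size a))%N != 1%N.
  apply: contraTneq sa => /(congr1 (logn 2)); rewrite pfactorK // logn1 => /eqP.
  by rewrite subn_eq0 leqNgt.
move/eqP: E; rewrite -subr_eq0 -[X in X - _]mul1r -mulrBl mulf_eq0 subr_eq0 eq_sym.
by rewrite eqz_nat (negPf q1) => /eqP ->.
Qed.

Lemma zero_const f : zeroX n (swapXY (zeroX n (swapXY f))) = (f@_0%MM)%:MP.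
Proof.
have zN h : zeroX n (- h) = - zeroX n h by exact: rmorphN.
apply: (polyXY_ext (f := zeroX n \o (swapXY \o (zeroX n \o swapXY)))
  (g := (@mpolyC (n + n) int) \o (mcoeff 0%MM : {rmorphism polyXY n -> int}))) => k.
  change (zeroX n (swapXY (zeroX n (swapXY (xvar k)))) = ((xvar k)@_0%MM)%:MP).
  rewrite swapXY_x zN [zeroX n (yvar k)]substXY_y swapXYN swapXY_y opprK [LHS]substXY_x ltn_ord.
  by rewrite mcoeff0X mpolyC0.
change (zeroX n (swapXY (zeroX n (swapXY (yvar k)))) = ((yvar k)@_0%MM)%:MP).
rewrite swapXY_y zN [zeroX n (xvar k)]substXY_x ltn_ord oppr0 mcoeff0X mpolyC0.
by rewrite (rmorph0 swapXY) (rmorph0 (zeroX n)).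
Qed.

(** Descending induction on the length.  Subtracting f(0, Y) leaves nonnegative
    terms; the symmetry applies the same to f(0, Y), up to the constant term. *)
Theorem pn_ddw a : pletters a -> pn (ddw a).
Proof.
have [k] := ubnP ('C(n, 2).+1 - size a); elim: k a => // k IH a ak a0.
have [sa|sa] := ltnP 'C(n, 2) (size a).
  rewrite nonred_foldr; first exact: pn0.
  apply/negP => /eqP ra; have [u au] := pletters_perm a0; have [H _] := invn_perm_max u.
  by move: H; rewrite -au -ra; lia.
have half b : pletters b -> size b = size a -> pn (ddw b - zeroX n (ddw b)).
  move=> b0 sb; apply: pn_zeroX_diff; first exact: ins0_ddw.
  move=> i i0; apply: (IH (i :: b)); last by rewrite /= i0.
  by rewrite /= sb; lia.
pose a' := rev (map (@flip n') a).
have a'0 : pletters a'.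
  rewrite all_rev all_map; apply: sub_all a0 => j j0 /=.
  by rewrite val_flip //; have := ltn_ord j; lia.
have sa' : size a' = size a by rewrite size_rev size_map.
have aE : ddw a = swapXY (ddw a') by rewrite -swapXY_ddw // swapXYK.
have p1 := half a a0 erefl.
have p2 := pn_zeroX n (pn_swapXY (half a' a'0 sa')).
rewrite !rmorphB -aE -(swapXY_ddw a0) zero_const in p2.
rewrite -[ddw a]subr0; apply: pn_sub_trans p1 _; apply: pn_sub_trans p2 _; rewrite subr0.
rewrite /pn; have -> : oppY ((ddw a)@_0%MM)%:MP = ((ddw a)@_0%MM)%:MP by apply: comp_mpolyC.
exact/posC/pn_ddw_const.
Qed.

Theorem SchubertC_perm_pos (w : 'S_n) m : 0 <= (SchubertC (Weyl_of_perm w))@_m.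
Proof.
rewrite SchubertC_perm; apply: pn_revX_oppY; rewrite /SchubertA /divdiffw.
set a := xchoose _.
have ra : reduced_word (Weyl_of_perm (compg (star w)^-1%g (omega0 n))) a.
  exact: xchooseP (reduced_word_exists _).
by have [a0 _] := reduced_word_C ra; apply: pn_ddw.
Qed.

End Positivity.

Theorem theorem2 (n : nat) (hn : (1 <= n)%N) (w : 'S_n) :
  SchubertC (Weyl_of_perm w) = revX_oppY (SchubertA (star w)) /\
  (forall m : 'X_{1..(n + n)}, 0 <= (SchubertC (Weyl_of_perm w))@_m).
Proof.
by case: n hn w => // n' _ w; split; [exact: SchubertC_perm | exact: SchubertC_perm_pos].
Qed.
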